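(* There exists a constant $C<\infty$ such that the following holds for every integer $N\ge1$. Suppose that either $A$ is a deterministic $N\times N$ real symmetric matrix and $V$ is an $N\times N$ random matrix sampled from the GOE, or $A$ is a deterministic $N\times N$ Hermitian matrix and $V$ is an $N\times N$ random matrix sampled from the GUE. Let $H:=A+V$ and, for a Borel set $B\subset\mathbb{R}$, let $\mathcal{N}(B)$ denote the number of eigenvalues of $H$ in $B$. Then for every $1\le k\le N$ and every interval $I\subset\mathbb{R}$, $$\mathbb{P}\left\{\mathcal{N}(I)\ge k\right\}\le \frac{(C\,|I|\,N)^k}{k!}.$$ Moreover, for any $k$-tuple of intervals $I_1,\dots,I_k\subset\mathbb{R}$, $$\mathbb{E}\left[\mathcal{N}(I_1)\,(\mathcal{N}(I_2)-1)_+\cdots(\mathcal{N}(I_k)-k+1)_+\right]\le\prod_{j=1}^k\left(C\,|I_j|\,N\right).$$ The constant $C$ does not depend on $A$, $N$, $k$, or the intervals.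
   Context: Normalization of the ensembles: $V=\frac{X+X^*}{\sqrt{2N}}$, where $X$ is an $N\times N$ matrix with independent standard real Gaussian entries (mean $0$, variance $1$) for the GOE, or independent standard complex Gaussian entries (independent real and imaginary parts, each normal with mean $0$ and variance $1/2$) for the GUE, and $X^*$ is the conjugate transpose. Equivalently, $V$ has density proportional to $\exp\{-\frac{\beta N}{4}\mathrm{tr}\,V^2\}$ with respect to Lebesgue measure on real symmetric ($\beta=1$, GOE) or complex Hermitian ($\beta=2$, GUE) $N\times N$ matrices. Notation: $|I|$ is the Lebesgue measure of $I$; $x_+=\max(x,0)$; eigenvalues are counted with multiplicity. *)

(* Defs.v *)
From mathcomp Require Import all_boot all_order all_algebra.
From mathcomp Require Import all_classical all_reals all_analysis.
From mathcomp Require Import complex.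

Set Implicit Arguments.
Unset Strict Implicit.
Unset Printing Implicit Defensive.

Import Order.TTheory GRing.Theory Num.Theory.
Import numFieldNormedType.Exports.

Local Open Scope classical_set_scope.
Local Open Scope complex_scope.
Local Open Scope sesquilinear_scope.
Local Open Scope ring_scope.

(* Restricted to Borel B because measures are unconstrained on nonmeasurable
   sets; s is the standard deviation, not the variance. *)
Definition has_normal_law (d : measure_display) (T : measurableType d)
    (R : realType) (P : probability T R) (m s : R) (X : {RV P >-> R}) : Prop :=
  forall B : set R, measurable B -> distribution P X B = normal_prob m s B.

Definition mutually_independent (d : measure_display) (T : measurableType d)
    (R : realType) (P : probability T R) (J : finType)
    (X : J -> {RV P >-> R}) : Prop :=
  forall (S : {set J}) (B : J -> set R), (forall j, measurable (B j)) ->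
    (P (\bigcap_(j in [set` S]) (X j @^-1` B j)) =
     \prod_(j in S) P (X j @^-1` B j))%E.

Definition real_ginibre (d : measure_display) (T : measurableType d)
    (R : realType) (P : probability T R) (N : nat)
    (X : T -> 'M[R[i]]_N) : Prop :=
  exists Y : 'I_N * 'I_N -> {RV P >-> R},
    [/\ mutually_independent Y,
        forall p, has_normal_law 0 1 (Y p)
      & forall w, X w = \matrix_(i, j) (Y (i, j) w)%:C].

(* The boolean index selects the real ([false]) or imaginary ([true]) part. *)
Definition complex_ginibre (d : measure_display) (T : measurableType d)
    (R : realType) (P : probability T R) (N : nat)
    (X : T -> 'M[R[i]]_N) : Prop :=
  exists Y : 'I_N * 'I_N * bool -> {RV P >-> R},
    [/\ mutually_independent Y,
        forall p, has_normal_law 0 (Num.sqrt (2^-1)) (Y p)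
      & forall w, X w =
          \matrix_(i, j) (Y (i, j, false) w +i* Y (i, j, true) w)].

Definition hermitize (R : realType) (N : nat) (X : 'M[R[i]]_N) : 'M[R[i]]_N :=
  ((Num.sqrt (2 * N%:R))^-1)%:C *: (X + X ^t*).

(* Real symmetric matrices are represented as complex matrices with real
   entries, so that both ensembles live in the same type. *)
Definition GOE (d : measure_display) (T : measurableType d)
    (R : realType) (P : probability T R) (N : nat)
    (V : T -> 'M[R[i]]_N) : Prop :=
  exists2 X, real_ginibre P X & forall w, V w = hermitize (X w).

Definition GUE (d : measure_display) (T : measurableType d)
    (R : realType) (P : probability T R) (N : nat)
    (V : T -> 'M[R[i]]_N) : Prop :=
  exists2 X, complex_ginibre P X & forall w, V w = hermitize (X w).

(* Multiplicities are those of the roots of the characteristic polynomial; as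
   that polynomial is nonzero, the sum over B has finite support. *)
Definition eigenvalue_count (R : realType) (N : nat) (H : 'M[R[i]]_N)
    (B : set R) : nat :=
  \big[addn/0%N]_(x \in B) mup (x%:C) (char_poly H).

(* Main.v *)
From HB Require Import structures.
Require Import Defs.
From mathcomp Require Import all_boot all_order all_algebra.
From mathcomp Require Import all_classical all_reals all_analysis.
From mathcomp Require Import measurable_realfun complex ring lra.

Set Implicit Arguments.
Unset Strict Implicit.
Unset Printing Implicit Defensive.

Import Order.TTheory GRing.Theory Num.Theory.
Import numFieldNormedType.Exports.

Local Open Scope classical_set_scope.
Local Open Scope ring_scope.

(** * Wegner and Minami estimates for deformed GOE and GUE matrices

The heart of the matter is a bound on the joint moments
E [prod_(j < k) (N(I_j) - j)_+] <= prod_(j < k) (K e_j), where e_j is the half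
length of I_j. It is proved by induction on the size n of the matrix, the scale
of the noise being kept at the value it has for size N ([wegner_bound_le]). The
tail bound follows by taking all the intervals equal, since the product is at
least k! when N(I) >= k.

Cost of one eigenvalue. Let H, of size 1 + n, have an eigenvalue within e of E.
Then |v (H - E)| <= e |v| for some row vector v <> 0. Conjugate H by an
orthogonal matrix whose first row is a normalized vector of signs. For at least
a tenth of the sign vectors the first coordinate of the rotated v carries a
fraction 1 / (4 (1 + n)) of its squared norm, by a fourth moment argument
([signed_sumC_anticoncentration]), and the conjugation leaves the law of the
noise unchanged, because it is an isometry of the space of entries
([ge0_integral_isometry]). So one may assume that v itself is not small in its
first coordinate. Write H in blocks, with minor B, first row r and first column
h off the corner, and put d = det (B - E), M = adj (B - E), b = M h. Pairing
v (H - E) with the vector (d, - b) leaves only the pivot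
F = (H_00 - E) d - r b, and gives |F|^2 <= 4 (1 + n) e^2 (|d|^2 + |b|^2)
([schur_pivot_small]).

Given the minor, F is a quadratic polynomial in the Gaussian border, and its
gradient has squared norm at least 4 kap^2 (|d|^2 + |b|^2), where kap is the
scale of the noise ([pivot_gradient_norm]). It remains to see that a quadratic
polynomial F of a Gaussian vector z is rarely small in comparison with its
gradient. If y is an independent copy of z, rotations of the pair (z, y)
preserve its law, so that the probability of |F(z)| <= delta |DF(z) y| is also
the average frequency of the same event along the curve z cos t + y sin t.
There F is, in the variable tan (t / 2), a polynomial of degree four up to an
explicit factor. A polynomial can be small relatively to its derivative only
near its roots ([near_root]), whence a frequency O(delta)
([quad_anticoncentration]). Finally |DF(z) y| is comparable with the norm of the
gradient for y in an event of probability at least 1/2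
([gauss_linear_anticoncentration]), and y can be eliminated ([quad_small_ball]).
Nothing here depends on the centre A, and the constants depend on the dimension
only through the factor sqrt (1 + n) of the sign argument, which is what the
normalization by sqrt (2 N) can afford.

Induction. The estimate of the pivot holds conditionally on the minor. Hence the
presence of an eigenvalue in a window of half width e multiplies by K e the
expectation of any quantity dominated by a function of the minor
([one_eigenvalue_cost]). By interlacing ([cnt_minor]) the factors N(I_j) - j,
for j > 0, are dominated by the factors of index j - 1 of the minor. A window
with several eigenvalues is treated by cutting it into m pieces: two eigenvalues
in the same piece cost (K e / m)^2, hence O(1 / m) for all the pieces together.

Two facts are needed along the way. The invariance of a product of normal laws
under isometries comes from the Cameron-Martin formula, which characterizes
that law ([cameron_martin_unique]). Eigenvalue counts are measurable because
they are limits of expressions in determinants ([level_ratio_cvg]). *)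

(** * Random vectors indexed by a finite type *)
Section rvec.
Context {R : realType} (J : finType).

Definition box (B : J -> set R) : set (J -> R) := [set x | forall j, B j (x j)].

Definition boxes : set (set (J -> R)) :=
  [set S | exists2 B : J -> set R, (forall j, measurable (B j)) & S = box B].

(** Functions on J with the sigma-algebra of boxes: the finite product space for
an arbitrary finite index type, without an enumeration of J. *)
Definition rvec := g_sigma_algebraType boxes.

End rvec.

Arguments boxes {R} J.
Arguments rvec R J : clear implicits.

Section rvec_theory.
Context {R : realType} {J : finType}.

Lemma measurable_box (B : J -> set R) :
  (forall j, measurable (B j)) -> measurable (box B : set (rvec R J)).
Proof. by move=> mB; apply: sub_sigma_algebra; exists B. Qed.

Lemma measurable_coord (j : J) : measurable_fun setT (fun x : rvec R J => x j).
Proof.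
move=> _ B mB; rewrite setTI.
rewrite (_ : _ @^-1` _ = box (fun i => if i == j then B else setT)).
  by apply: measurable_box => i; case: ifP.
apply/seteqP; split => x /=.
  by move=> Bx i; case: eqP => // ->.
by move=> /(_ j); rewrite eqxx.
Qed.

Lemma measurable_to_rvec d (T : measurableType d) (f : T -> rvec R J) :
  (forall j, measurable_fun setT (fun w => f w j)) -> measurable_fun setT f.
Proof.
move=> mf; apply: (@measurability _ _ T (rvec R J) setT f (boxes J)) => //.
move=> _ [_ [B mB ->] <-]; rewrite setTI.
rewrite (_ : _ @^-1` _ = \bigcap_(j in [set: J]) ((fun w => f w j) @^-1` B j)).
  apply: fin_bigcap_measurable => // j _.
  by rewrite -[_ @^-1` _]setTI; exact: mf.
by apply/seteqP; split => x /= h j; [move=> _; exact: h | exact: (h j)].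
Qed.

Lemma rvec_measure_unique (m1 m2 : probability (rvec R J) R) :
  (forall B, (forall j, measurable (B j)) -> m1 (box B) = m2 (box B)) ->
  forall S, measurable S -> m1 S = m2 S.
Proof.
move=> m12 S mS.
apply: (@measure_unique _ R (rvec R J) (boxes J) (fun=> setT)) => //.
- move=> _ _ [B mB ->] [C mC ->]; exists (fun j => B j `&` C j).
    by move=> j; exact: measurableI.
  apply/seteqP; split => x /=; first by case=> h1 h2 j; split.
  by move=> h; split => j; case: (h j).
- move=> _; exists (fun=> setT) => //.
  by apply/seteqP; split.
- by rewrite bigcup_const//; exists 0%N.
- by move=> _ [B mB ->]; exact: m12.
- by move=> k; rewrite (le_lt_trans (probability_le1 _ _)) ?ltry.
Qed.

End rvec_theory.

Lemma exists_pushforward d d' (T : measurableType d) (T' : measurableType d')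
    (R : realType) (P : probability T R) (f : T -> T') :
  measurable_fun setT f ->
  exists Q : probability T' R, forall A, Q A = P (f @^-1` A).
Proof.
move=> mf.
pose X : {RV P >-> T'} := HB.pack f (isMeasurableFun.Build _ _ _ _ _ mf).
by exists (distribution P X).
Qed.

Section density.
Local Open Scope ereal_scope.
Context d (T : measurableType d) (R : realType).
Variables (mu nu : {measure set T -> \bar R}) (g : T -> R).
Hypothesis mg : measurable_fun setT g.
Hypothesis g0 : forall x, (0 <= g x)%R.
Hypothesis nuE : forall A, measurable A -> nu A = \int[mu]_(x in A) (g x)%:E.

Import HBNNSimple.

Lemma ge0_integral_density (f : T -> \bar R) :
  measurable_fun setT f -> (forall x, 0 <= f x) ->
  \int[nu]_x f x = \int[mu]_x (f x * (g x)%:E).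
Proof.
move=> mf f0; pose f_ := nnsfun_approx measurableT mf.
have f_cvg x : EFin \o f_^~ x @ \oo --> f x.
  by apply: cvg_nnsfun_approx => // *; exact: f0.
transitivity (limn (fun n => \int[nu]_x (f_ n x)%:E)).
  rewrite -monotone_convergence//.
  - by apply: eq_integral => y _; apply/esym/cvg_lim => //; exact: f_cvg.
  - by move=> n; exact/measurable_EFinP/measurable_funP.
  - by move=> n y _; rewrite lee_fin.
  - by move=> y _ m n mn; rewrite lee_fin; exact/lefP/nd_nnsfun_approx.
transitivity (limn (fun n => \int[mu]_x ((f_ n x)%:E * (g x)%:E))); last first.
  rewrite -monotone_convergence//.
  - apply: eq_integral => y _; apply/cvg_lim => //.
    by apply: cvgeZr => //; exact: f_cvg.
  - move=> n; apply: emeasurable_funM; first exact/measurable_EFinP/measurable_funP.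
    exact/measurable_EFinP.
  - by move=> n y _; rewrite mule_ge0// lee_fin.
  - move=> y _ m n mn; rewrite lee_wpmul2r ?lee_fin//; exact/lefP/nd_nnsfun_approx.
congr (limn _); apply/funext => n.
have mn k : measurable (f_ n @^-1` [set k]).
  by rewrite -[X in measurable X]setTI; exact: measurable_funP.
transitivity (\sum_(k \in range (f_ n)) k%:E * nu (f_ n @^-1` [set k])).
  by rewrite integralT_nnsfun sintegralE.
transitivity (\int[mu]_x (\sum_(k \in range (f_ n))
    (k%:E * ((\1_(f_ n @^-1` [set k]) x)%:E * (g x)%:E)))); last first.
  apply: eq_integral => x _; rewrite [in RHS]fimfunE -fsumEFin//.
  rewrite ge0_mule_fsuml; last by move=> i; exact: nnfun_muleindic_ge0.
  by apply: eq_fsbigr => k _; rewrite EFinM muleA.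
have m1g (B : set T) : measurable B -> measurable_fun setT (fun x => (\1_B x)%:E * (g x)%:E).
  move=> mB; apply: emeasurable_funM; exact/measurable_EFinP.
rewrite ge0_integral_fsum//; last 2 first.
- by move=> k; apply: emeasurable_funM => //; exact: m1g.
- by move=> k x _; rewrite muleA mule_ge0// ?lee_fin//; exact: nnfun_muleindic_ge0.
apply: eq_fsbigr => k; rewrite inE => -[y _ <-{k}].
rewrite ge0_integralZl//.
- rewrite nuE// integral_mkcond; congr (_ * _).
  apply: eq_integral => x _; rewrite patchE indicE.
  by case: ifPn; rewrite ?mul1e ?mul0e.
- exact: m1g.
- by move=> x _; rewrite mule_ge0 ?lee_fin.
- by rewrite lee_fin.
Qed.

End density.

(** * Vectors of independent normal variables *)
Section gauss1d.
Local Open Scope ereal_scope.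
Context {R : realType}.
Local Notation mu := (@lebesgue_measure R).

Lemma lebesgue_measure_shift (a : R) (A : set R) : measurable A ->
  pushforward mu ((fun t => t + a)%R : _ -> measurableTypeR R) A = mu A.
Proof.
move=> mA; apply/esym/lebesgue_measure_unique => //=.
  by apply: measurable_funD.
move=> _ _ [[x y]] _ <-.
rewrite /pushforward (_ : _ @^-1` _ = `](x - a)%R, (y - a)%R]%classic); last first.
  apply/seteqP; split => t /=; rewrite !in_itv/=; lra.
rewrite !lebesgue_measure_itv/= !lte_fin ltrD2r; case: ifP => // _.
by rewrite -!EFinB; congr EFin; lra.
Qed.

Lemma ge0_integral_shift (a : R) (f : R -> \bar R) :
  measurable_fun setT f -> (forall t, 0 <= f t) ->
  \int[mu]_t f (t + a)%R = \int[mu]_t f t.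
Proof.
move=> mf f0.
have mshift : measurable_fun setT ((fun t => t + a)%R : R -> measurableTypeR R).
  by apply: measurable_funD.
rewrite -[LHS]/(\int[mu]_(t in (fun t => t + a)%R @^-1` setT)
   (f \o (fun t => t + a)%R) t).
rewrite -(@ge0_integral_pushforward _ _ _ (measurableTypeR R))//.
by apply: eq_measure_integral => //= A mA _; exact: lebesgue_measure_shift.
Qed.

Lemma ge0_integral_normal (s : R) (f : R -> \bar R) :
  measurable_fun setT f -> (forall t, 0 <= f t) ->
  \int[normal_prob 0 s]_t f t = \int[mu]_t (f t * (normal_pdf 0 s t)%:E).
Proof.
move=> mf f0; apply: ge0_integral_density => //.
  exact: measurable_normal_pdf.
by move=> x; exact: normal_pdf_ge0.
Qed.

(** Completing the square in the exponent of the shifted density. *)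
Lemma normal_cameron_martin (s a : R) (f : R -> \bar R) : s != 0%R ->
  measurable_fun setT f -> (forall t, 0 <= f t) ->
  \int[normal_prob 0 s]_t f (t + a)%R =
  \int[normal_prob 0 s]_t (f t * (expR ((a * t - a ^+ 2 / 2) / s ^+ 2))%:E).
Proof.
move=> s0 mf f0.
have mexp : measurable_fun [set: R] (fun t => expR ((a * t - a ^+ 2 / 2) / s ^+ 2)).
  apply: measurableT_comp => //; apply: measurable_funM => //.
  by apply: measurable_funB => //; apply: measurable_funM.
have mpdf : measurable_fun [set: R] (fun t => (normal_pdf 0 s t)%:E).
  by apply/measurable_EFinP; exact: measurable_normal_pdf.
rewrite ge0_integral_normal//; last first.
  by apply: measurableT_comp mf _; exact: measurable_funD.
rewrite ge0_integral_normal//; last 2 first.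
- by apply: emeasurable_funM => //; exact/measurable_EFinP.
- by move=> t; rewrite mule_ge0 ?lee_fin ?expR_ge0.
rewrite -[RHS](ge0_integral_shift a); last 2 first.
- by apply: emeasurable_funM => //; apply: emeasurable_funM => //; exact/measurable_EFinP.
- by move=> t; rewrite !mule_ge0 ?lee_fin ?expR_ge0// normal_pdf_ge0.
apply: eq_integral => t _; rewrite -muleA -EFinM; congr (_ * _%:E).
rewrite normal_pdfE// /normal_fun mulrCA; congr (_ * _)%R.
rewrite -expRD; congr expR; field.
by rewrite s0.
Qed.

End gauss1d.

Section gauss_family.
Local Open Scope ereal_scope.
Context {R : realType} (s : R).

Definition gauss_law (J : finType) (P : probability (rvec R J) R) :=
  forall B, (forall j, measurable (B j)) ->
    P (box B) = \prod_(j : J) normal_prob 0 s (B j).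

Lemma exists_gauss_ord n : exists P : probability (rvec R 'I_n) R, gauss_law P.
Proof.
elim: n => [|n [P PE]].
  pose x0 : rvec R 'I_0 := fun=> 0%R.
  exists (dirac x0) => B mB.
  by rewrite big_ord0 /= diracE mem_set// => -[].
pose f (p : R * rvec R 'I_n) : rvec R 'I_n.+1 :=
  fun i => if unlift ord0 i is Some k then p.2 k else p.1.
have mf : measurable_fun setT f.
  apply: measurable_to_rvec => j; rewrite /f.
  case: (unlift ord0 j) => [k|]; last exact: measurable_fst.
  exact: (measurableT_comp (measurable_coord k) measurable_snd).
have [Q QE] := exists_pushforward ((normal_prob 0 s \x P)%E : probability _ _) mf.
exists Q => B mB; rewrite QE.
rewrite (_ : _ @^-1` _ = B ord0 `*` box (fun k => B (lift ord0 k))); last first.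
  apply/seteqP; split => -[t x] /=.
    move=> h; split; first by have := h ord0; rewrite /f unlift_none.
    by move=> k; have := h (lift ord0 k); rewrite /f liftK.
  move=> [h0 h] j; rewrite /f; case: unliftP => [k|] -> //=.
have mb : measurable (box (fun k : 'I_n => B (lift ord0 k)) : set (rvec R 'I_n)).
  exact: measurable_box.
rewrite [LHS](product_measure1E (normal_prob 0 s) P (mB ord0) mb).
by rewrite big_ord_recl; congr (_ * _); apply: PE.
Qed.

Lemma exists_gauss (J : finType) : exists P : probability (rvec R J) R, gauss_law P.
Proof.
have [P PE] := exists_gauss_ord #|J|.
pose f (x : rvec R 'I_#|J|) : rvec R J := fun j => x (enum_rank j).
have mf : measurable_fun setT f.
  by apply: measurable_to_rvec => j; exact: measurable_coord.
have [Q QE] := exists_pushforward P mf.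
exists Q => B mB; rewrite QE.
rewrite (_ : _ @^-1` _ = box (fun i => B (enum_val i))); last first.
  apply/seteqP; split => x /= h j; first by have := h (enum_val j); rewrite /f enum_valK.
  by have := h (enum_rank j); rewrite enum_rankK.
rewrite PE//; apply/esym; apply: reindex; apply: onW_bij.
exact: enum_val_bij.
Qed.

(** The law of independent centred normal variables of standard deviation s;
[gauss_law] determines it, by uniqueness on boxes. *)
Definition gauss (J : finType) : probability (rvec R J) R := projT1 (cid (exists_gauss J)).

Lemma gauss_box (J : finType) : gauss_law (gauss J).
Proof. exact: (projT2 (cid (exists_gauss J))). Qed.

Lemma gauss_transfer d (T : measurableType d) (P : probability T R) (J : finType)
    (f : T -> rvec R J) : measurable_fun setT f ->
  (forall B, (forall j, measurable (B j)) ->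
    P (f @^-1` box B) = \prod_(j : J) normal_prob 0 s (B j)) ->
  forall g : rvec R J -> \bar R, measurable_fun setT g -> (forall x, 0 <= g x) ->
  \int[gauss J]_x g x = \int[P]_w g (f w).
Proof.
move=> mf Pf g mg g0.
have [Q QE] := exists_pushforward P mf.
have QgE S : measurable S -> gauss J S = Q S.
  by apply: rvec_measure_unique => B mB; rewrite gauss_box// QE Pf.
rewrite -[RHS]/(\int[P]_(w in f @^-1` setT) (g \o f) w).
rewrite -(ge0_integral_pushforward mf)//.
by apply: eq_measure_integral => S mS _; exact: (etrans (QgE S mS) (QE S)).
Qed.

Lemma ge0_integral_reindex (J1 J2 : finType) (iota : J1 -> J2) : injective iota ->
  forall g : rvec R J1 -> \bar R, measurable_fun setT g -> (forall x, 0 <= g x) ->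
  \int[gauss J1]_x g x = \int[gauss J2]_x g (fun q => x (iota q)).
Proof.
move=> iI g mg g0; pose f (x : rvec R J2) : rvec R J1 := fun q => x (iota q).
apply: (@gauss_transfer _ _ (gauss J2) _ f) => //.
  by apply: measurable_to_rvec => j; exact: measurable_coord.
move=> B mB.
pose pi p := [pick q | iota q == p].
have piK q : pi (iota q) = Some q.
  by rewrite /pi; case: pickP => [q' /eqP/iI -> //|/(_ q)]; rewrite eqxx.
have piI p q : pi p = Some q -> iota q = p.
  by rewrite /pi; case: pickP => // q' /eqP + [<-].
pose B' p := if pi p is Some q then B q else setT.
rewrite (_ : _ @^-1` _ = box B'); last first.
  apply/seteqP; split => x /= h p; last by have := h (iota p); rewrite /B' piK.
  by rewrite /B'; case E: (pi p) => [q|]//; rewrite -(piI _ _ E); exact: h.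
have -> : gauss J2 (box B') = \prod_p normal_prob 0 s (B' p).
  by apply: gauss_box => p; rewrite /B'; case: (pi p).
rewrite (bigID (fun p => isSome (pi p)))/= [X in _ * X]big1 ?mule1.
  rewrite (reindex_omap iota pi)/=.
    by apply: eq_big => q; rewrite ?/B' piK ?eqxx.
  by move=> p; case E: (pi p) => [q|]//= _; rewrite (piI _ _ E).
by move=> p; rewrite /B'; case: (pi p) => // _; exact: probability_setT.
Qed.

Definition overwrite (J1 J2 : finType) (pi : J2 -> option J1)
    (xz : rvec R J1 * rvec R J2) : rvec R J2 :=
  fun p => if pi p is Some q then xz.1 q else xz.2 p.

Lemma measurable_overwrite (J1 J2 : finType) (pi : J2 -> option J1) :
  measurable_fun setT (overwrite pi).
Proof.
apply: measurable_to_rvec => j; rewrite /overwrite; case: (pi j) => [q|].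
  exact: (measurableT_comp (measurable_coord q) measurable_fst).
exact: (measurableT_comp (measurable_coord j) measurable_snd).
Qed.

(** Resampling: coordinates in the image of iota are taken from an independent
vector. It serves to condition on the minor while keeping, for the rest, a full
Gaussian vector whose coordinates in the minor are ignored. *)
Lemma ge0_integral_overwrite (J1 J2 : finType) (pi : J2 -> option J1)
    (iota : J1 -> J2) : (forall p q, (pi p == Some q) = (p == iota q)) ->
  forall g : rvec R J2 -> \bar R, measurable_fun setT g -> (forall x, 0 <= g x) ->
  \int[gauss J2]_x g x = \int[gauss J1]_x \int[gauss J2]_z g (overwrite pi (x, z)).
Proof.
move=> piE g mg g0.
rewrite (@gauss_transfer _ _ (gauss J1 \x gauss J2)%E _ _ (measurable_overwrite pi))//.
  rewrite fubini_tonelli1//; apply: (measurableT_comp mg).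
  exact: measurable_overwrite.
move=> B mB.
pose B' p := if pi p is Some _ then setT else B p.
rewrite (_ : _ @^-1` _ = box (fun q => B (iota q)) `*` box B'); last first.
  have piota q : pi (iota q) = Some q by apply/eqP; rewrite piE.
  apply/seteqP; split => -[x z] /=; rewrite /box/= /overwrite/=.
    move=> h; split => [q|p]; first by have := h (iota q); rewrite piota.
    by rewrite /B'; have := h p; case: (pi p).
  move=> [h1 h2] p; have := h2 p; rewrite /B'; case E: (pi p) => [q|]// _.
  by move/eqP: E; rewrite piE => /eqP ->; exact: h1.
have m1 : measurable (box (fun q => B (iota q)) : set (rvec R J1)).
  exact: measurable_box.
have mB' p : measurable (B' p) by rewrite /B'; case: (pi p).
have m2 : measurable (box B' : set (rvec R J2)) by exact: measurable_box.
rewrite [LHS](product_measure1E (gauss J1) (gauss J2) m1 m2).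
transitivity ((\prod_q normal_prob 0 s (B (iota q))) * \prod_p normal_prob 0 s (B' p)).
  by congr (_ * _); apply: gauss_box.
rewrite [RHS](bigID (fun p => isSome (pi p)))/=; congr (_ * _).
  rewrite (reindex_omap iota pi)/=.
    apply: eq_bigl => q; rewrite (_ : pi (iota q) = Some q) ?eqxx//.
    by apply/eqP; rewrite piE.
  move=> p; case E: (pi p) => [q|]//= _; congr Some; apply/esym/eqP.
  by rewrite -piE E.
rewrite (bigID (fun p => isSome (pi p)))/= big1 ?mul1e.
  by apply: eq_bigr => p; rewrite /B'; case: (pi p).
move=> p; rewrite /B'; case: (pi p) => // _ _; exact: probability_setT.
Qed.

Definition update (J : finType) (j : J) (zt : rvec R J * R) : rvec R J :=
  fun i => if i == j then zt.2 else zt.1 i.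

Lemma measurable_update (J : finType) (j : J) : measurable_fun setT (update j).
Proof.
apply: measurable_to_rvec => i; rewrite /update; case: eqP => _.
  exact: measurable_snd.
exact: (measurableT_comp (measurable_coord i) measurable_fst).
Qed.

Lemma ge0_integral_update (J : finType) (j : J) (g : rvec R J -> \bar R) :
  measurable_fun setT g -> (forall x, 0 <= g x) ->
  \int[gauss J]_x g x = \int[gauss J]_z \int[normal_prob 0 s]_t g (update j (z, t)).
Proof.
move=> mg g0.
rewrite (@gauss_transfer _ _ (gauss J \x normal_prob 0 s)%E _ _ (measurable_update j))//.
  rewrite fubini_tonelli1//; apply: (measurableT_comp mg).
  exact: measurable_update.
move=> B mB.
pose B' i := if i == j then setT else B i.
rewrite (_ : _ @^-1` _ = box B' `*` B j); last first.
  apply/seteqP; split => -[z t] /=; rewrite /box/= /update/= /B'.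
    move=> h; split => [i|]; last by have := h j; rewrite eqxx.
    by case: eqP (h i).
  move=> [h1 h2] i; have := h1 i.
  by case: eqP => // ->.
have mB' i : measurable (B' i) by rewrite /B'; case: eqP.
have m1 : measurable (box B' : set (rvec R J)) by exact: measurable_box.
rewrite [LHS](product_measure1E (gauss J) (normal_prob 0 s) m1 (mB j)).
rewrite muleC [RHS](bigD1 j)//=; congr (_ * _).
transitivity (\prod_i normal_prob 0 s (B' i)); first exact: gauss_box.
rewrite (bigD1 j)//= {1}/B' eqxx.
have -> : normal_prob 0 s setT = 1 :> \bar R by exact: probability_setT.
rewrite mul1e; apply: eq_bigr => i ij.
by rewrite /B' (negbTE ij).
Qed.

Hypothesis s0 : s != 0%R.

Section cameron_martin.
Variable J : finType.
Implicit Types (a b x : rvec R J).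

(** Logarithm of the density of the translate by a of the Gaussian law. *)
Definition cm_exponent a x : R :=
  (\sum_j (a j * x j - a j ^+ 2 / 2) / s ^+ 2)%R.

Definition translate a x : rvec R J := fun j => (x j + a j)%R.

Lemma measurable_translate a : measurable_fun setT (translate a).
Proof.
by apply: measurable_to_rvec => j; apply: measurable_funD => //; exact: measurable_coord.
Qed.

Lemma measurable_cm_exponent a : measurable_fun setT (cm_exponent a).
Proof.
apply: measurable_sum => j; apply: measurable_funM => //.
by apply: measurable_funB => //; apply: measurable_funM => //; exact: measurable_coord.
Qed.

Lemma measurable_cm a : measurable_fun setT (fun x => (expR (cm_exponent a x))%:E).
Proof. by apply/measurable_EFinP; apply: measurableT_comp => //; exact: measurable_cm_exponent. Qed.

Definition cameron_martin_at (P : {measure set (rvec R J) -> \bar R}) a :=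
  forall f : rvec R J -> \bar R, measurable_fun setT f -> (forall x, 0 <= f x) ->
  \int[P]_x f (translate a x) = \int[P]_x (f x * (expR (cm_exponent a x))%:E).

(** The densities of successive translations multiply, which reduces the formula
to translations along one coordinate. *)
Lemma cameron_martin_add P a b : cameron_martin_at P a -> cameron_martin_at P b ->
  cameron_martin_at P (translate a b).
Proof.
move=> Pa Pb f mf f0.
pose g x := f x * (expR (cm_exponent a (translate (fun j => - b j)%R x)))%:E.
have mg : measurable_fun setT g.
  apply: emeasurable_funM => //; apply: (measurableT_comp (measurable_cm a)).
  exact: measurable_translate.
have g0 x : 0 <= g x by rewrite mule_ge0// lee_fin expR_ge0.
transitivity (\int[P]_x g (translate b x)); last first.
  rewrite (Pb g mg g0); apply: eq_integral => x _; rewrite /g -muleA -EFinM -expRD.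
  congr (_ * (expR _)%:E); rewrite /cm_exponent -big_split/=.
  apply: eq_bigr => j _; rewrite /translate -mulrDl; congr (_ * _)%R; by field.
transitivity (\int[P]_x f (translate b (translate a x))).
  by apply: eq_integral => x _; congr f; apply/funext => j; rewrite /translate addrAC addrA.
transitivity (\int[P]_x (f (translate b x) * (expR (cm_exponent a x))%:E)).
  apply: (Pa (fun x => f (translate b x))) => [|x]; last exact: f0.
  by apply: (measurableT_comp mf); exact: measurable_translate.
apply: eq_integral => x _; rewrite /g; congr (_ * (expR (cm_exponent a _))%:E).
by apply/funext => j; rewrite /translate addrK.
Qed.

Lemma gauss_cameron_martin a : cameron_martin_at (gauss J) a.
Proof.
have -> : a = (\big[translate/(fun=> 0%R)]_(j : J) (fun i => if i == j then a j else 0%R)).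
  apply/funext => i.
  transitivity (\sum_(j : J) if i == j then a j else 0)%R.
    by rewrite (bigD1 i)//= eqxx big1 ?addr0// => j; rewrite eq_sym => /negbTE ->.
  elim/big_rec2: _ => // j y1 y2 _ ->; by rewrite /translate addrC.
apply: (big_ind (cameron_martin_at (gauss J))).
- move=> f mf f0; apply: eq_integral => x _.
  rewrite (_ : translate _ _ = x); last by apply/funext => j; rewrite /translate addr0.
  rewrite /cm_exponent big1 ?expR0 ?mule1// => j _.
  by rewrite mul0r expr0n/= mul0r subrr mul0r.
- by move=> b c; exact: cameron_martin_add.
move=> j _ f mf f0.
set e := fun i => _.
rewrite (ge0_integral_update j); last 2 first.
- by apply: (measurableT_comp mf); exact: measurable_translate.
- by [].
rewrite [RHS](ge0_integral_update j); last 2 first.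
- by apply: emeasurable_funM => //; exact: measurable_cm.
- by move=> x; rewrite mule_ge0// lee_fin expR_ge0.
apply: eq_integral => z _.
have mz : measurable_fun [set: R] (fun t => update j (z, t)).
  exact: (measurableT_comp (measurable_update j) (measurable_pair1 z)).
transitivity (\int[normal_prob 0 s]_t f (update j (z, t + a j)%R)).
  apply: eq_integral => t _; congr f; apply/funext => i; rewrite /translate /update /e/=.
  by case: eqP => // _; rewrite addr0.
transitivity (\int[normal_prob 0 s]_t (f (update j (z, t)) *
    (expR ((a j * t - a j ^+ 2 / 2) / s ^+ 2))%:E)).
  apply: (normal_cameron_martin (f := fun t => f (update j (z, t))) _ s0) => [|t].
    exact: (measurableT_comp mf mz).
  exact: f0.
apply: eq_integral => t _; congr (_ * (expR _)%:E).
rewrite /cm_exponent (bigD1 j)//= big1 ?addr0; first by rewrite /update/= /e eqxx.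
by move=> i /negbTE ij; rewrite /e ij mul0r expr0n/= mul0r subrr mul0r.
Qed.

End cameron_martin.

End gauss_family.

(** * Invariance under isometries *)
Section isometry_invariance.
Local Open Scope ereal_scope.
Context {R : realType} (s : R) (J : finType).
Hypothesis s0 : s != 0%R.
Local Notation gauss := (gauss s).
Local Notation cameron_martin_at := (cameron_martin_at s).
Local Notation cm_exponent := (cm_exponent s).
Implicit Types (a b x y : rvec R J).

Let mpfst j : measurable_fun setT (fun p : rvec R J * rvec R J => p.1 j).
Proof. exact: (measurableT_comp (measurable_coord j) measurable_fst). Qed.

Let mpsnd j : measurable_fun setT (fun p : rvec R J * rvec R J => p.2 j).
Proof. exact: (measurableT_comp (measurable_coord j) measurable_snd). Qed.

(** Integrate 1_S (x + y) exp (- <x, y> - |y|^2 / 2) against gauss in x and P in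
y, with s = 1 to fix ideas. Translating x by y, the inner integral in x is
gauss S for every y. Translating y by x instead, the integrand becomes
1_S (y) exp (<x, y> - |y|^2 / 2), which integrates in x to 1_S (y), so that the
total is P S. *)
Lemma cameron_martin_unique (P : probability (rvec R J) R) :
  (forall a, cameron_martin_at P a) -> forall S, measurable S -> gauss J S = P S.
Proof.
move=> Pcm S mS.
have m1S : measurable_fun setT (fun x : rvec R J => (\1_S x)%:E : \bar R).
  exact/measurable_EFinP.
pose k (p : rvec R J * rvec R J) : \bar R := (\1_S (translate p.2 p.1))%:E *
  (expR (- (\sum_j (p.1 j * p.2 j + p.2 j ^+ 2 / 2) / s ^+ 2)))%:E.
have k0 p : 0 <= k p by rewrite mule_ge0// lee_fin ?expR_ge0.
have mk : measurable_fun setT k.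
  apply: emeasurable_funM.
    apply: (measurableT_comp m1S); apply: measurable_to_rvec => j.
    exact: measurable_funD.
  apply/measurable_EFinP; apply: measurableT_comp => //; apply: measurableT_comp => //.
  apply: measurable_sum => j; apply: measurable_funM => //.
  apply: measurable_funD; first exact: measurable_funM.
  by apply: measurable_funM => //; apply: measurable_funX.
have gamE y : \int[gauss J]_x k (x, y) = gauss J S.
  pose f x := (\1_S x)%:E * (expR (- cm_exponent y x))%:E.
  transitivity (\int[gauss J]_x f (translate y x)).
    apply: eq_integral => x _; rewrite /k/= /f; congr (_ * (expR (- _))%:E).
    by apply: eq_bigr => j _; rewrite /translate; congr (_ / _)%R; field.
  rewrite gauss_cameron_martin//; last 2 first.
  - apply: emeasurable_funM => //; apply/measurable_EFinP; apply: measurableT_comp => //.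
    by apply: measurableT_comp => //; exact: measurable_cm_exponent.
  - by move=> x; rewrite mule_ge0// lee_fin ?expR_ge0.
  transitivity (\int[gauss J]_x (\1_S x)%:E); last by rewrite integral_indic// setIT.
  by apply: eq_integral => x _; rewrite /f -muleA -EFinM -expRD addNr expR0 mulr1.
pose l (p : rvec R J * rvec R J) : \bar R := (\1_S p.2)%:E * (expR (cm_exponent p.2 p.1))%:E.
have l0 p : 0 <= l p by rewrite mule_ge0// lee_fin ?expR_ge0.
have ml : measurable_fun setT l.
  apply: emeasurable_funM; first exact: (measurableT_comp m1S measurable_snd).
  apply/measurable_EFinP; apply: measurableT_comp => //.
  apply: measurable_sum => j; apply: measurable_funM => //.
  apply: measurable_funB; first exact: measurable_funM.
  by apply: measurable_funM => //; apply: measurable_funX.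
transitivity (\int[P]_y \int[gauss J]_x k (x, y)).
  under eq_integral do rewrite gamE.
  by rewrite integral_cst//= probability_setT mule1.
rewrite -(@fubini_tonelli _ _ _ _ _ (gauss J) P k mk k0).
transitivity (\int[gauss J]_x \int[P]_y l (x, y)).
  apply: eq_integral => x _.
  pose h y := (\1_S y)%:E *
    (expR (- (\sum_j (x j * (y j - x j) + (y j - x j) ^+ 2 / 2) / s ^+ 2)))%:E.
  transitivity (\int[P]_y h (translate x y)).
    apply: eq_integral => y _; rewrite /k/= /h.
    have -> : translate y x = translate x y by apply/funext => j; rewrite /translate addrC.
    by congr (_ * (expR (- _))%:E); apply: eq_bigr => j _; rewrite /translate addrK.
  have mh : measurable_fun setT h.
    apply: emeasurable_funM => //; apply/measurable_EFinP; apply: measurableT_comp => //.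
    apply: measurableT_comp => //; apply: measurable_sum => j; apply: measurable_funM => //.
    have mj : measurable_fun setT (fun y : rvec R J => y j - x j)%R.
      by apply: measurable_funB => //; exact: measurable_coord.
    apply: measurable_funD; first exact: measurable_funM.
    by apply: measurable_funM => //; apply: measurable_funX.
  have h0 y : 0 <= h y by rewrite mule_ge0// lee_fin ?expR_ge0.
  rewrite (Pcm x h mh h0).
  apply: eq_integral => y _; rewrite /h /l/= -muleA -!EFinM -expRD.
  congr ((_ * expR _)%:E)%R; rewrite /cm_exponent -sumrN -big_split/=.
  by apply: eq_bigr => j _; field.
rewrite (@fubini_tonelli _ _ _ _ _ (gauss J) P l ml l0).
transitivity (\int[P]_y (\1_S y)%:E); last by rewrite integral_indic// setIT.
apply: eq_integral => y _.
transitivity ((\1_S y)%:E * \int[gauss J]_x (expR (cm_exponent y x))%:E).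
  rewrite -(@ge0_integralZl _ _ _ _ _ measurableT (fun x => (expR (cm_exponent y x))%:E))//.
  exact: measurable_cm.
have cm1 : \int[gauss J]_x (expR (cm_exponent y x))%:E = \int[gauss J]_x 1.
  rewrite [RHS](gauss_cameron_martin s0 y (f := cst 1))//.
  by apply: eq_integral => x _; rewrite mul1e.
rewrite cm1 integral_cst// mul1e -[RHS]mule1; congr (_ * _).
exact: probability_setT.
Qed.

(** Linearity enters only through translations, which is how the Cameron-Martin
formula uses it. *)
Record l2_isometry (L : rvec R J -> rvec R J) : Prop := L2Isometry {
  isometry_measurable : measurable_fun setT L ;
  isometry_add : forall a x, L (translate a x) = translate (L a) (L x) ;
  isometry_norm : forall x, (\sum_j L x j ^+ 2 = \sum_j x j ^+ 2)%R ;
  isometry_onto : forall a, exists b, L b = a }.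

Lemma isometry_dot L : l2_isometry L ->
  forall x y, (\sum_j L x j * L y j = \sum_j x j * y j)%R.
Proof.
have polar (u v : J -> R) : (\sum_j u j * v j =
    (\sum_j (v j + u j) ^+ 2 - \sum_j u j ^+ 2 - \sum_j v j ^+ 2) / 2)%R.
  by rewrite -!sumrB mulr_suml; apply: eq_bigr => j _; field.
move=> iL x y; rewrite (polar (L x) (L y)) (polar x y) !(isometry_norm iL).
have := isometry_norm iL (translate x y).
by rewrite (isometry_add iL) /translate => ->.
Qed.

(** The image of the Gaussian law under an isometry satisfies the Cameron-Martin
formula again, since the exponent depends on inner products only. *)
Lemma ge0_integral_isometry L : l2_isometry L ->
  forall g : rvec R J -> \bar R, measurable_fun setT g -> (forall x, 0 <= g x) ->
  \int[gauss J]_x g x = \int[gauss J]_x g (L x).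
Proof.
move=> iL g mg g0; have mL := isometry_measurable iL.
have [Q QE] := exists_pushforward (gauss J) mL.
have intQ f : measurable_fun setT f -> (forall x, 0 <= f x) ->
    \int[Q]_x f x = \int[gauss J]_x f (L x).
  move=> mf f0.
  rewrite -[RHS]/(\int[gauss J]_(w in L @^-1` setT) (f \o L) w).
  rewrite -(ge0_integral_pushforward mL)//.
  by apply: eq_measure_integral => S mS _; exact: QE.
rewrite -intQ//; apply: eq_measure_integral => S mS _.
apply: cameron_martin_unique => // a f mf f0.
have [b <-] := isometry_onto iL a.
rewrite intQ//; last by apply: (measurableT_comp mf); exact: measurable_translate.
rewrite intQ//; last 2 first.
- by apply: emeasurable_funM => //; exact: measurable_cm.
- by move=> x; rewrite mule_ge0// lee_fin expR_ge0.
under eq_integral do rewrite -(isometry_add iL).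
transitivity (\int[gauss J]_x (f (L x) * (expR (cm_exponent b x))%:E)).
  apply: (gauss_cameron_martin s0 b (f := fun x => f (L x))) => [|x]; last exact: f0.
  exact: (measurableT_comp mf).
apply: eq_integral => x _; congr (_ * (expR _)%:E).
rewrite /cm_exponent -!mulr_suml !sumrB -!mulr_suml; congr (_ / _)%R.
by rewrite (isometry_dot iL) (isometry_norm iL).
Qed.

End isometry_invariance.

(** * Linear functionals of a Gaussian vector *)
Section linear_functional.
Local Open Scope ereal_scope.
Context {R : realType}.

(** The density is at most 1 / (s sqrt (2 pi)) and the interval has length s. *)
Lemma normal_small_ball (s : R) : (0 < s)%R ->
  normal_prob 0 s [set t | (t ^+ 2 < (s / 2) ^+ 2)%R] <= (2^-1)%:E.
Proof.
move=> s0; have s_neq0 : s != 0%R by rewrite gt_eqF.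
have -> : [set t : R | (t ^+ 2 < (s / 2) ^+ 2)%R] = `](- (s / 2))%R, (s / 2)%R[%classic.
  apply/seteqP; split => t /=; rewrite in_itv/= -(ltr_norml t) -(real_normK (num_real t));
    by rewrite ltr_pXn2r// nnegrE divr_ge0// ltW.
rewrite /normal_prob.
apply: (@le_trans _ _ (\int[lebesgue_measure]_(x in
    `](- (s / 2))%R, (s / 2)%R[%classic) (normal_peak s)%:E)).
  apply: ge0_le_integral => //.
  - by move=> x _; rewrite lee_fin normal_pdf_ge0.
  - by apply: measurable_funTS; apply/measurable_EFinP; exact: measurable_normal_pdf.
  - by move=> x _; rewrite lee_fin normal_pdf_ub.
rewrite integral_cst//= lebesgue_measure_itv/= lte_fin.
have -> : (- (s / 2) < s / 2)%R by lra.
rewrite -EFinB -EFinM lee_fin opprK -splitr /normal_peak.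
have pi2 : (2 <= pi :> R)%R by exact: pi_ge2.
have s2 : (2 * s <= Num.sqrt (s ^+ 2 * pi *+ 2))%R.
  have h : (0 <= 2 * s)%R by rewrite mulr_ge0// ltW.
  rewrite -(ger0_norm h) -sqrtr_sqr; apply: ler_wsqrtr.
  by rewrite -mulr_natr; nra.
rewrite mulrC ler_pdivrMr//; last by rewrite (lt_le_trans _ s2)// mulr_gt0.
by rewrite ler_pdivlMl.
Qed.

Variable s : R.
Hypothesis s0 : (0 < s)%R.
Variable J : finType.
Local Notation gauss := (gauss s).

Definition dotv (x y : J -> R) : R := (\sum_j x j * y j)%R.

(** When dotv w w = 0, w vanishes and this is the identity, whatever the value of
the division by zero. *)
Definition householder (w : J -> R) (x : rvec R J) : rvec R J :=
  fun j => (x j - 2 * dotv x w / dotv w w * w j)%R.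

Lemma dotv_eq0 (w : J -> R) : dotv w w = 0%R -> forall j, w j = 0%R.
Proof.
move=> /eqP; rewrite psumr_eq0 => [/allP w0 j|j _]; last by rewrite -expr2 sqr_ge0.
by have := w0 j; rewrite mem_index_enum => /(_ isT) /=; rewrite mulf_eq0 orbb => /eqP.
Qed.

Lemma dotv_householderr (w x y : J -> R) :
  dotv x (householder w y) = (dotv x y - 2 * dotv y w / dotv w w * dotv x w)%R.
Proof.
rewrite /dotv mulr_sumr -sumrB; apply: eq_bigr => j _.
by rewrite /householder -/(dotv y w) -/(dotv w w); ring.
Qed.

Lemma dotvC (x y : J -> R) : dotv x y = dotv y x.
Proof. by apply: eq_bigr => j _; rewrite mulrC. Qed.

Lemma dotv_householder_sym (w x y : J -> R) :
  dotv x (householder w y) = dotv (householder w x) y.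
Proof.
by rewrite [RHS]dotvC !dotv_householderr (dotvC x y); congr (_ - _)%R; ring.
Qed.

Lemma householderK (w x : J -> R) : householder w (householder w x) = x.
Proof.
apply/funext => j; rewrite {1}/householder dotvC dotv_householderr.
have [w0|w0] := eqVneq (dotv w w) 0%R.
  by rewrite /householder (dotv_eq0 w0); ring.
by rewrite /householder (dotvC w x); field.
Qed.

Lemma householder_isometry (w : J -> R) : l2_isometry (householder w).
Proof.
split.
- apply: measurable_to_rvec => j; apply: measurable_funB; first exact: measurable_coord.
  apply: measurable_funM => //; apply: measurable_funM => //; apply: measurable_funM => //.
  by apply: measurable_sum => i; apply: measurable_funM => //; exact: measurable_coord.
- move=> a x; apply/funext => j; rewrite /translate /householder.
  have -> : (dotv (fun j => x j + a j) w = dotv x w + dotv a w)%R.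
    by rewrite /dotv -big_split/=; apply: eq_bigr => i _; rewrite mulrDl.
  by ring.
- move=> x.
  have sq (y : J -> R) : (\sum_j y j ^+ 2 = dotv y y)%R.
    by apply: eq_bigr => j _; rewrite expr2.
  by rewrite !sq dotv_householder_sym householderK.
- by move=> a; exists (householder w a); exact: householderK.
Qed.

(** The reflection that exchanges the unit vector g with a basis vector; it also
provides orthogonal matrices with a prescribed row. *)
Lemma householder_unit (g : J -> R) (j0 : J) : dotv g g = 1%R ->
  householder (fun j => g j - (j == j0)%:R)%R (fun j => (j == j0)%:R)%R = g.
Proof.
move=> g1; set w := (fun j => _); set e : J -> R := (fun j => (j == j0)%:R)%R.
have dote (y : J -> R) : dotv e y = y j0.
  rewrite /dotv (bigD1 j0)//= /e eqxx mul1r big1 ?addr0// => j /negbTE ->.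
  by rewrite mul0r.
have ww : (dotv w w = 2 * (1 - g j0))%R.
  transitivity (dotv g g - 2 * dotv e g + dotv e e)%R.
    rewrite /dotv mulr_sumr -sumrB -big_split/=; apply: eq_bigr => j _.
    by rewrite /w /e; ring.
  by rewrite g1 !dote /e eqxx /=; ring.
apply/funext => j; rewrite /householder dote.
have [w0|w0] := eqVneq (dotv w w) 0%R.
  have := dotv_eq0 w0 j; rewrite /w => /eqP; rewrite subr_eq0 => /eqP gj.
  by rewrite w0 gj invr0; ring.
have g0 : (1 - g j0 != 0)%R by apply: contra_neq w0; rewrite ww => ->; rewrite mulr0.
by rewrite ww /w /e eqxx /=; field.
Qed.

Lemma gauss_isometry (L : rvec R J -> rvec R J) : l2_isometry L ->
  forall S, measurable S -> gauss J S = gauss J (L @^-1` S).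
Proof.
move=> iL S mS; have mL := isometry_measurable iL.
have mLS : measurable (L @^-1` S) by rewrite -[X in measurable X]setTI; exact: mL.
transitivity (\int[gauss J]_x (\1_S x)%:E); first by rewrite integral_indic// setIT.
rewrite (ge0_integral_isometry (lt0r_neq0 s0) iL); last 2 first.
- by apply/measurable_EFinP; exact: measurable_indic.
- by move=> x; rewrite lee_fin.
by rewrite -[in RHS](setIT (L @^-1` S)) -integral_indic.
Qed.

(** A reflection sends l to a multiple of a coordinate, which reduces the claim
to one normal variable. *)
Lemma gauss_linear_anticoncentration (l : J -> R) :
  (2^-1)%:E <= gauss J [set x | ((s / 2) ^+ 2 * dotv l l <= dotv l x ^+ 2)%R].
Proof.
have [l0|l0] := eqVneq (dotv l l) 0%R.
  rewrite (_ : [set x | _] = setT); last first.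
    by apply/seteqP; split => x //= _; rewrite l0 mulr0 sqr_ge0.
  have -> : gauss J setT = 1 by exact: probability_setT.
  by rewrite lee_fin; lra.
have ll : (0 < dotv l l)%R.
  by rewrite lt_def l0/=; apply: sumr_ge0 => j _; rewrite -expr2 sqr_ge0.
have [j0 _] : exists j0 : J, true.
  apply: contrapT => J0; move: l0; rewrite /dotv big1 ?eqxx// => j.
  by exfalso; apply: J0; exists j.
pose n := Num.sqrt (dotv l l).
have n0 : (0 < n)%R by rewrite sqrtr_gt0.
have n2 : (n ^+ 2 = dotv l l)%R by rewrite sqr_sqrtr// ltW.
pose g j := (l j / n)%R.
have g1 : dotv g g = 1%R.
  transitivity (dotv l l / n ^+ 2)%R; last by rewrite n2 divff.
  by rewrite /dotv mulr_suml; apply: eq_bigr => j _; rewrite /g; field; rewrite gt_eqF.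
pose w j := (g j - (j == j0)%:R)%R.
pose B : set R := [set t | ((s / 2) ^+ 2 <= t ^+ 2)%R].
have mB : measurable B.
  rewrite (_ : B = (fun t => t ^+ 2)%R @^-1` `[((s / 2) ^+ 2)%R, +oo[%classic); last first.
    by apply/seteqP; split => t; rewrite /B/= in_itv/= andbT.
  by rewrite -[X in measurable X]setTI; apply: measurable_funX.
have mb : measurable ([set x | B (x j0)] : set (rvec R J)).
  rewrite -[X in measurable X]setTI; exact: measurable_coord.
have coordE (x : rvec R J) : (householder w x j0 = dotv l x / n)%R.
  transitivity (dotv (fun j => (j == j0)%:R)%R (householder w x)).
    rewrite /dotv (bigD1 j0)//= eqxx mul1r big1 ?addr0// => j /negbTE ->.
    by rewrite mul0r.
  rewrite dotv_householder_sym householder_unit// /dotv mulr_suml.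
  by apply: eq_bigr => j _; rewrite /g; ring.
have -> : [set x : rvec R J | ((s / 2) ^+ 2 * dotv l l <= dotv l x ^+ 2)%R] =
    [set x | B (householder w x j0)].
  apply/seteqP; split => x /=; rewrite /B/= coordE [((_ / n) ^+ 2)%R]expr_div_n n2 ler_pdivlMr//.
have -> : gauss J [set x | B (householder w x j0)] = gauss J [set x | B (x j0)].
  by rewrite [RHS](gauss_isometry (householder_isometry w) mb).
have -> : gauss J [set x | B (x j0)] = normal_prob 0 s B.
  rewrite (_ : [set x | _] = box (fun j => if j == j0 then B else setT)); last first.
    apply/seteqP; split => x /=; last by move=> /(_ j0); rewrite eqxx.
    by move=> Bx j; case: eqP => // ->.
  transitivity (\prod_j normal_prob 0 s (if j == j0 then B else setT)).
    by apply: gauss_box => j; case: ifP.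
  rewrite (bigD1 j0)//= eqxx big1 ?mule1// => j /negbTE ->.
  exact: probability_setT.
have : normal_prob 0 s B + normal_prob 0 s (~` B) = 1.
  rewrite -measureU//=; first by rewrite setUv; exact: probability_setT.
  - exact: measurableC.
  - exact: setICr.
have : normal_prob 0 s (~` B) <= (2^-1)%:E.
  rewrite (_ : ~` B = [set t | (t ^+ 2 < (s / 2) ^+ 2)%R]) ?normal_small_ball//.
  by apply/seteqP; split => t; rewrite /B/= ltNge => /negP.
have : normal_prob 0 s B \is a fin_num by rewrite fin_num_measure.
have : normal_prob 0 s (~` B) \is a fin_num.
  by rewrite fin_num_measure//; exact: measurableC.
case: (normal_prob 0 s B) => // p; case: (normal_prob 0 s (~` B)) => // q _ _.
by rewrite !lee_fin -EFinD => q2 [] pq1; lra.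
Qed.

End linear_functional.

(** * Polynomials small relatively to their derivative *)
Section near_root.
Context {C : numClosedFieldType}.
Implicit Types (p : {poly C}) (t z rho delta : C).

(** P' / P is the sum of the 1 / (t - z) over the roots z. *)
Lemma log_derivative_le (r : seq C) t rho : 0 <= rho ->
  (forall z, z \in r -> rho <= `|t - z|) ->
  `|(\prod_(z <- r) ('X - z%:P))^`().[t]| * rho <=
  (size r)%:R * `|(\prod_(z <- r) ('X - z%:P)).[t]|.
Proof.
move=> rho0; elim: r => [|z r IHr] far.
  by rewrite big_nil derivC horner0 normr0 !mul0r.
have {}IHr := IHr (fun u ur => far u (mem_behead (s := z :: r) ur)).
have {}far := far z (mem_head _ _).
rewrite big_cons derivM derivXsubC mul1r !hornerE /=.
set P := (\prod_(_ <- _) _).[t] in IHr *; set P' := (\prod_(_ <- _) _)^`().[t] in IHr *.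
rewrite normrM -[(size r).+1%:R]natr1.
apply: (@le_trans _ _ (`|P| * rho + `|t - z| * (`|P'| * rho))).
  by rewrite mulrA -mulrDl ler_wpM2r// (le_trans (ler_normD _ _))// normrM.
rewrite mulrDl mul1r addrC lerD//.
  by rewrite [leRHS]mulrCA ler_wpM2l.
by rewrite mulrC ler_wpM2r.
Qed.

(** If all roots are at distance rho from t, then |P'| <= deg P / rho |P| at t;
the factor 2 leaves room for a strict inequality. *)
Lemma near_root p t delta : 0 <= delta -> p^`().[t] != 0 ->
  `|p.[t]| <= delta * `|p^`().[t]| ->
  exists2 z, root p z & `|t - z| <= 2 * (size p).-1%:R * delta.
Proof.
move=> delta0 p't small.
have p0 : p != 0 by apply: contraNneq p't => ->; rewrite deriv0 horner0.
have [pt0|pt0] := eqVneq p.[t] 0.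
  by exists t; rewrite ?/root ?pt0// subrr normr0 !mulr_ge0.
have [r pE] := closed_field_poly_normal p.
have lc0 : lead_coef p != 0 by rewrite lead_coef_eq0.
have rootr z : z \in r -> root p z.
  by move=> zr; rewrite pE rootZ// root_prod_XsubC.
have size_r : (size p).-1 = size r.
  by rewrite pE size_scale// size_prod_XsubC.
apply: contrapT => no.
have d0 : 0 < delta.
  rewrite lt_def delta0 andbT; apply: contraNneq pt0 => delta_eq0.
  by move: small; rewrite delta_eq0 mul0r normr_le0.
have rho0 : 0 <= 2 * (size r)%:R * delta by rewrite !mulr_ge0// ltW.
have /(log_derivative_le rho0) : forall z, z \in r ->
    2 * (size r)%:R * delta <= `|t - z|.
  move=> z zr; rewrite real_leNgt ?ger0_real//; apply/negP => tz.
  by apply: no; exists z; [exact: rootr | rewrite size_r ltW].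
move: p't pt0 small; rewrite pE derivZ !hornerZ !normrM.
set P := (\prod_(_ <- _) _).[t]; set P' := (\prod_(_ <- _) _)^`().[t].
rewrite !mulf_eq0 !negb_or lc0/= => P'0 P0.
rewrite mulrCA ler_pM2l ?normr_gt0// => small le.
have sr : (0 < size r)%N.
  by rewrite lt0n; apply: contraNneq P'0 => /size0nil rE; rewrite /P' rE big_nil derivC horner0.
have x0 : 0 < (size r)%:R * `|P| by rewrite mulr_gt0 ?ltr0n// normr_gt0.
suff : 2 * ((size r)%:R * `|P|) <= 1 * ((size r)%:R * `|P|) by rewrite ler_pM2r// lern1.
rewrite mul1r; apply: le_trans le.
rewrite (_ : `|P'| * _ = 2 * (size r)%:R * (delta * `|P'|)); last by ring.
by rewrite mulrA ler_wpM2l// mulr_ge0.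
Qed.

End near_root.

(** By induction on M, together with the bound M - a, which yields L + 1 at the
next step if M itself falls in the interval. *)
Lemma count_grid (R : realFieldType) (M : nat) (a L : R) : 0 <= L ->
  (\sum_(m < M) (a <= m%:R <= a + L)%R)%:R <= L + 1.
Proof.
move=> L0; suff : (\sum_(m < M) (a <= m%:R <= a + L)%R)%:R <= L + 1 /\
    (\sum_(m < M) (a <= m%:R <= a + L)%R)%:R <= Num.max 0 (M%:R - a) by case.
elim: M => [|M [IH1 IH2]]; first by rewrite big_ord0 le_max lexx addr_ge0.
rewrite big_ord_recr/= natrD.
have [/andP[aM MaL]|_] /= := boolP (a <= M%:R <= a + L); last first.
  rewrite addr0; split=> //; apply: (le_trans IH2).
  by rewrite ge_max le_max lexx/= le_max -natr1; apply/orP; right; lra.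
move: IH2; rewrite max_r ?subr_ge0// => IH2.
split; first lra.
by rewrite le_max -natr1; apply/orP; right; lra.
Qed.

(** * A quadratic polynomial along a rotation *)
Section rotating_quadratic.
Context {R : realType}.
Local Notation C := R[i].
Variables (c0 lz ly qz qy b : C).

(** Cosine and sine in terms of the tangent of the half angle, which makes the
trigonometric polynomial below a rational function. *)
Definition half_cos (t : R) : R := (1 - t ^+ 2) / (1 + t ^+ 2).
Definition half_sin (t : R) : R := 2 * t / (1 + t ^+ 2).

Lemma half_cos_sin (t : R) : half_cos t ^+ 2 + half_sin t ^+ 2 = 1.
Proof.
have t0 : 1 + t ^+ 2 != 0 by rewrite gt_eqF// ltr_pwDl// sqr_ge0.
by rewrite /half_cos /half_sin; field.
Qed.

(** Value of c0 + l + q at cos z + sin y, where b is the symmetrized mixed term of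
q, and its derivative with respect to the angle. *)
Definition rot_value (t : R) : C :=
  let c := (half_cos t)%:C%C in let u := (half_sin t)%:C%C in
  c0 + c * lz + u * ly + c ^+ 2 * qz + c * u * b + u ^+ 2 * qy.

Definition rot_deriv (t : R) : C :=
  let c := (half_cos t)%:C%C in let u := (half_sin t)%:C%C in
  - u * lz + c * ly + 2 * (u * c * (qy - qz)) + (c ^+ 2 - u ^+ 2) * b.

(** [rot_value] multiplied by (1 + t^2)^2. *)
Definition rot_poly : {poly C} :=
  Poly [:: c0 + lz + qz; 2 * (ly + b); 2 * (c0 - qz) + 4 * qy; 2 * (ly - b);
    c0 - lz + qz].

Let tC0 (t : R) : 1 + (t%:C%C : C) ^+ 2 != 0.
Proof.
rewrite -rmorphXn -(rmorph1 (real_complex R)) -rmorphD/= fmorph_eq0.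
by rewrite gt_eqF// ltr_pwDl// sqr_ge0.
Qed.

Let half_cosC t : (half_cos t)%:C%C = (1 - (t%:C%C) ^+ 2) / (1 + (t%:C%C : C) ^+ 2).
Proof. by rewrite /half_cos fmorph_div/= rmorphB rmorphD rmorphXn rmorph1. Qed.

Let half_sinC t : (half_sin t)%:C%C = 2 * t%:C%C / (1 + (t%:C%C : C) ^+ 2).
Proof. by rewrite /half_sin fmorph_div/= rmorphD rmorphXn rmorph1 rmorphM rmorph_nat. Qed.

Lemma rot_polyE t : rot_poly.[t%:C%C] = (1 + t%:C%C ^+ 2) ^+ 2 * rot_value t.
Proof.
rewrite horner_Poly /rot_value half_cosC half_sinC /=.
by field; exact: tC0.
Qed.

Lemma deriv_rot_polyE t : rot_poly^`().[t%:C%C] =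
  (1 + t%:C%C ^+ 2) * (4 * t%:C%C * rot_value t + 2 * rot_deriv t).
Proof.
rewrite /rot_poly /= !cons_poly_def !(derivMXaddC, deriv0).
rewrite !(hornerD, hornerMX, hornerC, horner0).
rewrite /rot_value /rot_deriv half_cosC half_sinC.
by field; exact: tC0.
Qed.

Lemma size_rot_poly : (size rot_poly <= 5)%N.
Proof. exact: size_Poly. Qed.

(** The derivative of [rot_poly] is, up to the common factor 1 + t^2, a
combination of [rot_value] and [rot_deriv] in which the second dominates when
4 delta <= 1; [near_root] then applies in degree four. *)
Lemma rot_near_root (t delta : R) : 0 <= t <= 1 -> 0 <= delta -> 4 * delta <= 1 ->
  `|rot_value t| <= delta%:C%C * `|rot_deriv t| -> rot_deriv t != 0 ->
  rot_poly != 0 /\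
  exists2 z, root rot_poly z & `|t - complex.Re z| <= 16 * delta.
Proof.
move=> /andP[t0 t1] d0 d1 small D0.
set F := rot_value t in small *; set D := rot_deriv t in small D0 *.
have tt1 : 0 < 1 + t ^+ 2 by rewrite ltr_pwDl// sqr_ge0.
pose q : C := (1 + t ^+ 2)%:C%C.
have q0 : 0 < q by rewrite ltcR.
have qE : 1 + (t%:C%C : C) ^+ 2 = q by rewrite /q rmorphD rmorphXn rmorph1.
have pE : rot_poly.[t%:C%C] = q ^+ 2 * F by rewrite rot_polyE qE.
have p'E : rot_poly^`().[t%:C%C] = q * (4 * t%:C%C * F + 2 * D).
  by rewrite deriv_rot_polyE qE.
have tC : 0 <= (t%:C%C : C) <= 1 by rewrite ler0c t0 -(rmorph1 (real_complex R)) lecR.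
have dC : 0 <= (delta%:C%C : C) by rewrite ler0c.
have d1C : 4 * (delta%:C%C : C) <= 1.
  by rewrite -[4](rmorph_nat (real_complex R)) -rmorphM -(rmorph1 (real_complex R)) lecR.
have lower : `|D| <= `|4 * t%:C%C * F + 2 * D|.
  rewrite [_ * F + _]addrC; apply: le_trans (lerB_normD (2 * D) (4 * t%:C%C * F)).
  rewrite !normrM [`|2|]ger0_norm// [`|4|]ger0_norm// [`|t%:C%C|]ger0_norm ?(andP tC).1//.
  have : 4 * t%:C%C * `|F| <= `|D|.
    apply: (@le_trans _ _ (4 * (1 * (delta%:C%C * `|D|)))).
      by rewrite -mulrA ler_wpM2l// ler_pM//; case/andP: tC.
    by rewrite mul1r mulrA ler_piMl.
  move=> h; rewrite lerBrDr; apply: (@le_trans _ _ (`|D| + `|D|)); first by rewrite lerD2l.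
  by rewrite mulr_natl mulr2n.
set W := 4 * t%:C%C * F + 2 * D in p'E lower.
have p'0 : rot_poly^`().[t%:C%C] != 0.
  rewrite p'E; apply: mulf_neq0; first by rewrite gt_eqF.
  by rewrite -normr_gt0 (lt_le_trans _ lower)// normr_gt0.
have p0 : rot_poly != 0 by apply: contraNneq p'0 => ->; rewrite deriv0 horner0.
split=> //.
have q2 : q <= 2.
  rewrite /q -[2](rmorph_nat (real_complex R)) lecR; nra.
have near : `|rot_poly.[t%:C%C]| <= (2 * delta)%:C%C * `|rot_poly^`().[t%:C%C]|.
  have FW : `|F| <= delta%:C%C * `|W| by apply: (le_trans small); rewrite ler_wpM2l.
  rewrite pE p'E expr2 !normrM (gtr0_norm q0).
  have -> : (2 * delta)%:C%C * (q * `|W|) = q * (2 * (delta%:C%C * `|W|)).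
    by rewrite rmorphM rmorph_nat; ring.
  by rewrite -mulrA ler_wpM2l ?(ltW q0)// ler_pM// ltW.
have d2 : 0 <= (2 * delta)%:C%C :> C by rewrite ler0c mulr_ge0.
have [z rz tz] := near_root d2 p'0 near.
exists z => //; rewrite -lecR.
apply: (@le_trans _ _ `|t%:C%C - z|); first by have := normc_ge_Re (t%:C%C - z); case: (z).
apply: (le_trans tz).
rewrite !rmorphM/= !rmorph_nat.
rewrite (_ : 16 * _ = 2 * 4 * (2 * delta%:C%C)); last by ring.
rewrite ler_wpM2r ?mulr_ge0// ler_wpM2l// ler_nat -subn1 leq_subLR.
exact: size_rot_poly.
Qed.

(** Each of the at most four roots accounts for the grid points within 16 delta
of its real part. *)
Lemma count_bad_angles (M : nat) (delta : R) (E : pred 'I_M) :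
  0 <= delta -> 4 * delta <= 1 ->
  (forall m, E m -> `|rot_value (m%:R / M%:R)| <= delta%:C%C * `|rot_deriv (m%:R / M%:R)| /\
     rot_deriv (m%:R / M%:R) != 0) ->
  (\sum_(m < M) E m)%:R <= 4 * (32 * delta * M%:R + 1).
Proof.
move=> d0 d1 EP.
have [M0|M0] := posnP M.
  by subst M; rewrite big_ord0 mulr0 add0r mulr1.
have M0R : 0 < M%:R :> R by rewrite ltr0n.
have rhs0 : 0 <= 32 * delta * M%:R + 1 by rewrite addr_ge0// !mulr_ge0.
have Enear (m : 'I_M) : E m -> rot_poly != 0 /\
    exists2 z, root rot_poly z & `|m%:R / M%:R - complex.Re z| <= 16 * delta.
  move=> /EP[small D0]; apply: rot_near_root => //.
  by rewrite divr_ge0//= ler_pdivrMr// mul1r ler_nat ltnW.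
have [p0|p0] := eqVneq rot_poly 0.
  rewrite big1 ?mulr_ge0// => m _; case Em : (E m) => //.
  by have [] := Enear m Em; rewrite p0 eqxx.
have [r pE] := closed_field_poly_normal rot_poly.
have lc0 : lead_coef rot_poly != 0 by rewrite lead_coef_eq0.
have size_r : (size r <= 4)%N.
  by have := size_rot_poly; rewrite pE size_scale// size_prod_XsubC ltnS.
have rootr z : root rot_poly z -> z \in r by rewrite pE rootZ// root_prod_XsubC.
pose hit (z : C) (m : 'I_M) : bool :=
  M%:R * (complex.Re z - 16 * delta) <= m%:R <=
  M%:R * (complex.Re z - 16 * delta) + 32 * delta * M%:R.
apply: (@le_trans _ _ (\sum_(z <- r) \sum_(m < M) hit z m)%:R).
  rewrite ler_nat exchange_big/= leq_sum// => m _.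
  case Em : (E m) => //; have [_ [z /rootr zr near]] := Enear m Em.
  rewrite (big_rem z)//= (leq_trans _ (leq_addr _ _))// lt0b /hit.
  move: near; rewrite ler_norml lerBrDl ler_pdivlMr// lerBlDl ler_pdivrMr//.
  by move=> /andP[h1 h2]; apply/andP; split; [move: h1 | move: h2]; lra.
apply: (@le_trans _ _ (\sum_(z <- r) (32 * delta * M%:R + 1))).
  rewrite natr_sum; apply: ler_sum => z _; apply: count_grid.
  by rewrite !mulr_ge0.
rewrite big_const_seq count_predT iter_addr_0 -[(_ + 1) *+ _]mulr_natl ler_wpM2r//.
by rewrite ler_nat.
Qed.

End rotating_quadratic.

Section nsq.
Context {R : realType}.
Implicit Types a b : R[i].

(** Squared modulus, with values in R rather than in R[i]. *)
Definition nsq a : R := complex.Re a ^+ 2 + complex.Im a ^+ 2.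

Lemma nsqE a : (nsq a)%:C%C = `|a| ^+ 2.
Proof. exact: add_Re2_Im2. Qed.

Lemma nsq_ge0 a : 0 <= nsq a.
Proof. by rewrite addr_ge0// sqr_ge0. Qed.

Lemma nsq_eq0 a : (nsq a == 0) = (a == 0).
Proof. by rewrite -(fmorph_eq0 (real_complex R))/= nsqE sqrf_eq0 normr_eq0. Qed.

Lemma nsqM a b : nsq (a * b) = nsq a * nsq b.
Proof. by apply: complexI; rewrite rmorphM/= !nsqE normrM exprMn. Qed.

Lemma nsq_le (delta : R) a b : 0 <= delta ->
  (nsq a <= delta ^+ 2 * nsq b) = (`|a| <= delta%:C%C * `|b|).
Proof.
move=> d0; rewrite -lecR rmorphM/= rmorphXn/= !nsqE -exprMn.
by rewrite ler_pXn2r// nnegrE mulr_ge0// ler0c.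
Qed.

End nsq.

(** * Small balls for quadratic polynomials of a Gaussian vector *)
Section quadratic_anticoncentration.
Local Open Scope ereal_scope.
Context {R : realType} (s : R) (J : finType).
Hypothesis s0 : (0 < s)%R.
Local Notation gauss := (gauss s).
Local Notation C := R[i].
Variables (c0 : C) (l : rvec R J -> C) (q : rvec R J -> rvec R J -> C).

Definition comb2 (a b : R) (z y : rvec R J) : rvec R J := fun j => (a * z j + b * y j)%R.

Hypothesis lE : forall a b z y, l (comb2 a b z y) = (a%:C%C * l z + b%:C%C * l y)%R.
Hypothesis qlE : forall a b z y x,
  q (comb2 a b z y) x = (a%:C%C * q z x + b%:C%C * q y x)%R.
Hypothesis qrE : forall a b z y x,
  q x (comb2 a b z y) = (a%:C%C * q x z + b%:C%C * q x y)%R.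

Definition quad z : C := (c0 + l z + q z z)%R.
Definition dquad z y : C := (l y + (q z y + q y z))%R.

Local Notation J2 := (J * bool)%type.

(** A pair of vectors is encoded as one vector on J * bool, so that rotating the
pair is an isometry in the sense above. *)
Let slice (b : bool) (w : rvec R J2) : rvec R J := fun j => w (j, b).

Let glue (p : rvec R J * rvec R J) : rvec R J2 :=
  fun jb => if jb.2 then p.2 jb.1 else p.1 jb.1.

Let mglue : measurable_fun setT glue.
Proof.
apply: measurable_to_rvec => -[j [|]]; rewrite /glue/=.
  exact: (measurableT_comp (measurable_coord j) measurable_snd).
exact: (measurableT_comp (measurable_coord j) measurable_fst).
Qed.

Let integral_glue (g : rvec R J2 -> \bar R) : measurable_fun setT g ->
  (forall w, 0 <= g w) ->
  \int[gauss J2]_w g w = \int[gauss J \x gauss J]_p g (glue p).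
Proof.
move=> mg g0; apply: (gauss_transfer mglue) => // B mB.
have -> : glue @^-1` box B =
    box (fun j => B (j, false)) `*` box (fun j => B (j, true)).
  apply/seteqP; split => -[z y] /=; rewrite /box/= /glue/=.
    by move=> h; split => j; [exact: (h (j, false)) | exact: (h (j, true))].
  by move=> [h1 h2] [j [|]].
have m1 : measurable (box (fun j => B (j, false)) : set (rvec R J)) by exact: measurable_box.
have m2 : measurable (box (fun j => B (j, true)) : set (rvec R J)) by exact: measurable_box.
rewrite [LHS](product_measure1E (gauss J) (gauss J) m1 m2).
transitivity ((\prod_j normal_prob 0 s (B (j, false))) *
   \prod_j normal_prob 0 s (B (j, true))).
  by congr (_ * _); apply: gauss_box.
rewrite -big_split/=.
transitivity (\prod_(j : J) \prod_(b : bool) normal_prob 0 s (B (j, b))).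
  by apply: eq_bigr => j _; rewrite big_bool/= muleC.
by rewrite pair_bigA; apply: eq_bigr => -[j b] _.
Qed.

Definition rotate (t : R) (w : rvec R J2) : rvec R J2 :=
  fun jb => if jb.2 then (- half_sin t * w (jb.1, false) + half_cos t * w (jb.1, true))%R
            else (half_cos t * w (jb.1, false) + half_sin t * w (jb.1, true))%R.

Lemma rotate_isometry t : l2_isometry (rotate t).
Proof.
have cs := half_cos_sin t.
have mc (j : J) (b : bool) : measurable_fun setT (fun w : rvec R J2 => w (j, b)).
  exact: measurable_coord.
split.
- apply: measurable_to_rvec => -[j b]; rewrite /rotate/=; case: b;
    by apply: measurable_funD; apply: measurable_funM.
- by move=> a x; apply/funext => -[j []]; rewrite /rotate /translate/=; ring.
- move=> x.
  have pairE (y : J2 -> R) : (\sum_jb y jb ^+ 2 =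
      \sum_(j : J) \sum_(b : bool) y (j, b) ^+ 2)%R.
    by rewrite pair_bigA; apply: eq_bigr => -[].
  rewrite !pairE; apply: eq_bigr => j _; rewrite !big_bool/= /rotate/=.
  rewrite -[RHS]mul1r -cs; ring.
- move=> a.
  exists (fun jb => if jb.2 then half_sin t * a (jb.1, false) + half_cos t * a (jb.1, true)
            else half_cos t * a (jb.1, false) - half_sin t * a (jb.1, true))%R.
  by apply/funext => -[j []]; rewrite /rotate/= -[RHS]mul1r -cs; ring.
Qed.

Let E (delta : R) : set (rvec R J * rvec R J) :=
  [set p | (nsq (quad p.1) <= delta ^+ 2 * nsq (dquad p.1 p.2))%R /\ dquad p.1 p.2 != 0%R].

Let rotate_value t w :
  quad (slice false (rotate t w)) = rot_value c0 (l (slice false w)) (l (slice true w))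
    (q (slice false w) (slice false w)) (q (slice true w) (slice true w))
    (q (slice false w) (slice true w) + q (slice true w) (slice false w))%R t.
Proof.
have -> : slice false (rotate t w) =
  comb2 (half_cos t) (half_sin t) (slice false w) (slice true w) by [].
by rewrite /quad lE qlE !qrE /rot_value; ring.
Qed.

Let rotate_deriv t w :
  dquad (slice false (rotate t w)) (slice true (rotate t w)) =
  rot_deriv (l (slice false w)) (l (slice true w))
    (q (slice false w) (slice false w)) (q (slice true w) (slice true w))
    (q (slice false w) (slice true w) + q (slice true w) (slice false w))%R t.
Proof.
have -> : slice false (rotate t w) =
  comb2 (half_cos t) (half_sin t) (slice false w) (slice true w) by [].
have -> : slice true (rotate t w) =
  comb2 (- half_sin t) (half_cos t) (slice false w) (slice true w) by [].
by rewrite /dquad lE !qlE !qrE /rot_deriv rmorphN; ring.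
Qed.

(** Average over M equally spaced values of the half tangent in [0, 1): every
rotation has the same probability, while for each fixed pair only
O(delta M + 1) of the rotations are bad; let M tend to infinity. *)
Lemma quad_anticoncentration (delta : R) : (0 <= delta)%R -> measurable (E delta) ->
  (gauss J \x gauss J) (E delta) <= (128 * delta)%:E.
Proof.
move=> d0 mE.
have le1 : (gauss J \x gauss J) (E delta) <= 1.
  exact: (probability_le1 ((gauss J \x gauss J)%E : probability _ _) mE).
have [d1|d1] := lerP (4 * delta)%R 1%R; last first.
  by apply: (le_trans le1); rewrite lee_fin; lra.
have fin : (gauss J \x gauss J) (E delta) \is a fin_num.
  by rewrite ge0_fin_numE// (le_lt_trans le1)// ltry.
rewrite -(fineK fin) lee_fin; set P := fine _.
suff bound (M : nat) : (P <= 128 * delta + 4 / M.+1%:R)%R.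
  apply/ler_addgt0Pr => e e0.
  pose M := Num.truncn (4 / e)%R.
  apply: (le_trans (bound M)); rewrite lerD2l ler_pdivrMr//.
  have := truncnS_gt (4 / e)%R; rewrite ltr_pdivrMr// => /ltW; rewrite mulrC.
  exact.
pose g (w : rvec R J2) : \bar R := (\1_(E delta) (slice false w, slice true w))%:E.
have mg : measurable_fun setT g.
  apply/measurable_EFinP; apply: measurableT_comp; first exact: measurable_indic.
  apply: measurable_fun_pair; apply: measurable_to_rvec => j; exact: measurable_coord.
have g0 w : 0 <= g w by rewrite lee_fin.
have Pg (m : 'I_M.+1) : \int[gauss J2]_w g (rotate (m%:R / M.+1%:R) w) = P%:E.
  have := ge0_integral_isometry (lt0r_neq0 s0) (rotate_isometry (m%:R / M.+1%:R)) mg g0.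
  move=> <-; rewrite integral_glue// /P (fineK fin).
  rewrite (eq_integral (fun p => (\1_(E delta) p)%:E)); last first.
    by move=> [z y] _; rewrite /g.
  by rewrite integral_indic// setIT.
have sumP : \sum_(m < M.+1) P%:E <= (4 * (32 * delta * M.+1%:R + 1))%:E.
  rewrite (eq_bigr (fun m : 'I_M.+1 => \int[gauss J2]_w g (rotate (m%:R / M.+1%:R) w))) => [|m _]; last by rewrite Pg.
  have mgr (m : 'I_M.+1) : measurable_fun setT (fun w => g (rotate (m%:R / M.+1%:R) w)).
    apply: (measurableT_comp mg).
    exact: isometry_measurable (rotate_isometry (m%:R / M.+1%:R)).
  rewrite -ge0_integral_sum//.
  apply: (@le_trans _ _ (\int[gauss J2]_w (4 * (32 * delta * M.+1%:R + 1))%:E)).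
    apply: ge0_le_integral => //.
    - by move=> w _; apply: sume_ge0.
    - exact: emeasurable_sum.
    - move=> w _.
      pose Ew (m : 'I_M.+1) := `[< E delta (slice false (rotate (m%:R / M.+1%:R) w),
        slice true (rotate (m%:R / M.+1%:R) w)) >].
      have -> : \sum_(m < M.+1) g (rotate (m%:R / M.+1%:R) w) = ((\sum_(m < M.+1) Ew m)%:R)%:E.
        rewrite natr_sum -sumEFin; apply: eq_bigr => m _.
        by rewrite /g indicE (_ : (_ \in _) = Ew m).
      rewrite lee_fin; apply: (@count_bad_angles _ c0 (l (slice false w)) (l (slice true w))
        (q (slice false w) (slice false w)) (q (slice true w) (slice true w))
        (q (slice false w) (slice true w) + q (slice true w) (slice false w))%R
        M.+1 delta Ew d0 d1) => m /asboolP[].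
      by rewrite nsq_le// rotate_value rotate_deriv => h1 h2; split; [exact: h1|exact: h2].
  rewrite integral_cst// -[leRHS]mule1; apply: lee_wpmul2l.
    by rewrite lee_fin !mulr_ge0// addr_ge0// !mulr_ge0.
  exact: (probability_le1 (gauss J2) measurableT).
move: sumP; rewrite sumEFin lee_fin sumr_const card_ord -[(P *+ _)%R]mulr_natr => sumP.
have M0 : (0 < M.+1%:R :> R)%R by rewrite ltr0n.
rewrite -(ler_pM2r M0) (le_trans sumP)// le_eqVlt; apply/orP; left; apply/eqP.
by field; rewrite gt_eqF.
Qed.

(** For each bad z, at least half of the y satisfy |k . y| >= s / 2 |k|, and
then (z, y) belongs to the event of [quad_anticoncentration]. *)
Lemma quad_small_ball (delta : R) (H : rvec R J -> R) : (0 <= delta)%R ->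
  measurable (E delta) -> measurable [set z : rvec R J | (nsq (quad z) <= H z)%R] ->
  (forall z, exists k : J -> R, [/\ forall y, complex.Re (dquad z y) = dotv k y,
     (0 < dotv k k)%R & (H z <= delta ^+ 2 * ((s / 2) ^+ 2 * dotv k k))%R]) ->
  gauss J [set z | (nsq (quad z) <= H z)%R] <= (256 * delta)%:E.
Proof.
move=> d0 mE mB kP; set B := [set z | _] in mB *.
have -> : (256 * delta)%:E = 2%:E * (128 * delta)%:E by rewrite -EFinM; congr EFin; ring.
apply: (@le_trans _ _ (2%:E * (gauss J \x gauss J) (E delta))); last first.
  by apply: lee_wpmul2l => //; exact: quad_anticoncentration.
have -> : gauss J B = \int[gauss J]_z (\1_B z)%:E by rewrite integral_indic// setIT.
rewrite /product_measure1 -ge0_integralZl//; last exact: measurable_fun_xsection.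
apply: ge0_le_integral => //.
- by apply/measurable_EFinP; exact: measurable_indic.
- by apply: measurable_funeM; exact: measurable_fun_xsection.
move=> z _; rewrite indicE; have [zB|_] := boolP (z \in B); last by rewrite mule_ge0.
have {}zB : (nsq (quad z) <= H z)%R by move: zB; rewrite in_setE.
have [k [kE k0 Hk]] := kP z.
have := gauss_linear_anticoncentration s0 k => half.
rewrite /= -[leLHS](_ : 2%:E * (2^-1)%:E = 1%:E); last by rewrite -EFinM divff.
apply: lee_wpmul2l => //; apply: (le_trans half); apply: le_measure.
- rewrite inE.
  rewrite (_ : [set x | _] = (dotv k) @^-1` [set t | ((s / 2) ^+ 2 * dotv k k <= t ^+ 2)%R])//.
  have mk : measurable_fun setT (dotv k : rvec R J -> R).
    by apply: measurable_sum => j; apply: measurable_funM => //; exact: measurable_coord.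
  rewrite -[X in measurable X]setTI; apply: mk => //.
  rewrite (_ : [set t | _] = (fun t : R => t ^+ 2)%R @^-1`
    `[((s / 2) ^+ 2 * dotv k k)%R, +oo[%classic); last first.
    by apply/seteqP; split => t; rewrite /= in_itv/= andbT.
  by rewrite -[X in measurable X]setTI; apply: measurable_funX.
- by rewrite inE; exact: measurable_xsection.
move=> y /= ky; rewrite /xsection/= inE /E/=.
have Dk : (dotv k y ^+ 2 <= nsq (dquad z y))%R by rewrite /nsq kE lerDl sqr_ge0.
split.
  apply: (le_trans zB); apply: (le_trans Hk); rewrite ler_wpM2l ?sqr_ge0//.
  exact: le_trans Dk.
rewrite -nsq_eq0 gt_eqF//; apply: lt_le_trans Dk; apply: lt_le_trans ky.
by rewrite mulr_gt0// exprn_gt0// divr_gt0.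
Qed.

End quadratic_anticoncentration.

(** * Eigenvalues of self-adjoint matrices *)
Section eigenvalue_counting.
Local Open Scope sesquilinear_scope.
Context {R : realType}.
Local Notation C := R[i].

Definition selfadjoint n (H : 'M[C]_n) : Prop := H ^t* = H.

Lemma selfadjoint_hermsymmx n (H : 'M[C]_n) : selfadjoint H -> H \is hermsymmx.
Proof. by move=> hH; apply/is_hermitianmxP; rewrite expr0 scale1r -[LHS]hH. Qed.

Definition sqnorm n (u : 'rV[C]_n) : R := \sum_j nsq (u 0 j).

Lemma sqnorm_ge0 n (u : 'rV[C]_n) : 0 <= sqnorm u.
Proof. by apply: sumr_ge0 => j _; exact: nsq_ge0. Qed.

Lemma sqnormE n (u : 'rV[C]_n) : (sqnorm u)%:C%C = (u *m u ^t*) 0 0.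
Proof.
rewrite rmorph_sum mxE; apply: eq_bigr => j _.
by rewrite /= nsqE !mxE normCK.
Qed.

Lemma sqnorm_gt0 n (u : 'rV[C]_n) : (0 < sqnorm u) = (u != 0).
Proof.
rewrite lt_def sqnorm_ge0 andbT psumr_eq0 => [|j _]; last exact: nsq_ge0.
congr (~~ _); apply/allP/eqP => [u0|-> j _]; last by rewrite /= mxE nsq_eq0.
apply/rowP => j; rewrite mxE; apply/eqP; rewrite -nsq_eq0.
by have := u0 j; rewrite mem_index_enum => /(_ isT).
Qed.

Lemma sqnorm_unitary n (U : 'M[C]_n) (u : 'rV[C]_n) :
  U *m U ^t* = 1%:M -> sqnorm (u *m U) = sqnorm u.
Proof.
move=> UU; apply: complexI; rewrite !sqnormE trmx_mul map_mxM.
by rewrite mulmxA -[X in X *m _]mulmxA UU mulmx1.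
Qed.

Lemma char_poly_conj n (P A : 'M[C]_n) : P \in unitmx ->
  char_poly (invmx P *m A *m P) = char_poly A.
Proof.
move=> Pu; rewrite /char_poly /char_poly_mx.
have PP : map_mx polyC (invmx P) *m map_mx polyC P = 1%:M.
  by rewrite -map_mxM mulVmx// map_mx1.
have -> : 'X%:M - map_mx polyC (invmx P *m A *m P) =
    map_mx polyC (invmx P) *m ('X%:M - map_mx polyC A) *m map_mx polyC P.
  rewrite mulmxBr mulmxBl !map_mxM; congr (_ - _).
  by rewrite scalar_mxC -mulmxA PP mulmx1.
by rewrite !det_mulmx mulrAC -det_mulmx PP det1 mul1r.
Qed.

Lemma selfadjoint_diagonalization n (H : 'M[C]_n) : selfadjoint H ->
  exists (P : 'M[C]_n) (d : 'I_n -> R), [/\ P *m P ^t* = 1%:M, P ^t* *m P = 1%:M &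
    H = P ^t* *m diag_mx (\row_i (d i)%:C%C) *m P].
Proof.
move=> /selfadjoint_hermsymmx hH.
have /orthomx_spectralP HE := hermitian_normalmx hH.
have Pu := spectral_unitarymx H.
exists (spectralmx H), (fun i => complex.Re (spectral_diag H 0 i)); split.
- exact/unitarymxP.
- by rewrite -invmx_unitary// mulVmx// spectral_unit.
apply: (etrans HE); congr (_ *m diag_mx _ *m _); first exact: invmx_unitary.
apply/rowP => i; rewrite mxE RRe_real//.
by have /mxOverP := hermitian_spectral_diag_real hH; apply.
Qed.

(** Bridges the finitely supported sum over B that counts eigenvalues and the
list of roots of the characteristic polynomial. *)
Lemma fsbig_count_mem (B : set R) (s : seq R) :
  \big[addn/0%N]_(x \in B) count_mem x s = count (fun x => `[< B x >]) s.
Proof.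
pose r := [seq x <- undup s | `[< B x >]].
have rE : [set` r] = B `&` [set` s].
  apply/seteqP; split => x /=; rewrite mem_filter mem_undup.
    by move=> /andP[/asboolP].
  by move=> [Bx ->]; rewrite andbT; apply/asboolP.
transitivity (\big[addn/0%N]_(x \in [set` r]) count_mem x s).
  symmetry; apply: fsbig_widen; rewrite rE; first by move=> x [].
  move=> x [Bx]/= ns; apply: contrapT => /eqP; rewrite -lt0n -has_count => /hasP[y ys].
  by move=> /= /eqP xy; apply: ns; split => //; rewrite -xy.
rewrite -fsbig_seq ?filter_uniq ?undup_uniq// big_filter.
rewrite -sum1_count -[RHS]big_undup_iterop_count; apply: eq_bigr => x _.
by rewrite Monoid.iteropE iter_addn addn0 mul1n.
Qed.

Lemma eigenvalue_countE n (P : 'M[C]_n) (d : 'I_n -> R) (B : set R) : P *m P ^t* = 1%:M ->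
  eigenvalue_count (P ^t* *m diag_mx (\row_i (d i)%:C%C) *m P) B =
  (\sum_(i < n) `[< B (d i) >])%N.
Proof.
move=> PP; rewrite /eigenvalue_count.
have [Pu PV] : P \in unitmx /\ P ^t* = invmx P.
  have Pu : P \is unitarymx by apply/unitarymxP.
  by rewrite invmx_unitary//; split => //; exact: unitarymx_unit.
rewrite PV char_poly_conj// char_poly_trig ?diag_mx_is_trig//.
under eq_fsbigr => x _.
  rewrite (eq_bigr (fun i => 'X - (d i)%:C%C%:P)); last first.
    by move=> i _; rewrite !mxE eqxx mulr1n.
  rewrite -(big_map (fun i => (d i)%:C%C) xpredT (fun z => 'X - z%:P)).
  rewrite mu_prod_XsubC count_map.
  rewrite (eq_count (a2 := preim d (pred1 x))); last first.
    by move=> i /=; rewrite (inj_eq (@complexI R)).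
  rewrite -count_map.
  over.
rewrite fsbig_count_mem count_map -sum1_count.
by rewrite big_mkcond/=; apply: eq_bigr => i _; case: `[< _ >].
Qed.

End eigenvalue_counting.

Section counting_variational.
Local Open Scope sesquilinear_scope.
Context {R : realType}.
Local Notation C := R[i].

(** Counts in closed windows, given by centre and half width: being closed makes
the variational characterization below exact, and e = 0 is allowed. *)
Definition cnt n (H : 'M[C]_n) (E e : R) : nat :=
  eigenvalue_count H [set x | `|x - E| <= e].

Lemma sqnorm_shift n (P : 'M[C]_n) (d : 'I_n -> R) (E : R) (c : 'rV[C]_n) :
  P *m P ^t* = 1%:M ->
  sqnorm (c *m P *m (P ^t* *m diag_mx (\row_i (d i)%:C%C) *m P - (E%:C%C)%:M)) =
  \sum_i (d i - E) ^+ 2 * nsq (c 0 i).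
Proof.
move=> PP; rewrite mulmxBr !mulmxA -[c *m P *m P ^t*]mulmxA PP mulmx1.
rewrite mul_mx_scalar scalemxAl -mulmxBl sqnorm_unitary//.
apply: eq_bigr => i _.
have -> : (c *m diag_mx (\row_i0 (d i0)%:C%C) - (E%:C%C) *: c) 0 i = (d i - E)%:C%C * c 0 i.
  by rewrite mul_mx_diag !mxE rmorphB/=; ring.
by rewrite nsqM /nsq/= expr0n/= addr0.
Qed.

Lemma cnt_card n (P : 'M[C]_n) (d : 'I_n -> R) (E e : R) : P *m P ^t* = 1%:M ->
  cnt (P ^t* *m diag_mx (\row_i (d i)%:C%C) *m P) E e = #|[pred i | `|d i - E| <= e]|.
Proof.
move=> PP; rewrite /cnt eigenvalue_countE// -sum1_card [RHS]big_mkcond/=.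
apply: eq_bigr => i _; rewrite unfold_in/=.
by case: asboolP => /=; [move=> ->|move=> /negP/negbTE ->].
Qed.

(** The span of the eigenvectors of the window has dimension larger than m, and
therefore meets the kernel of T. *)
Lemma cnt_test_space n (H : 'M[C]_n) (E e : R) m (T : 'M[C]_(n, m)) : selfadjoint H ->
  (m < cnt H E e)%N -> exists v : 'rV[C]_n,
  [/\ v != 0, v *m T = 0 & sqnorm (v *m (H - (E%:C%C)%:M)) <= e ^+ 2 * sqnorm v].
Proof.
move=> /selfadjoint_diagonalization[P [d [PP PP' ->]]]; rewrite cnt_card//.
set S := [pred i | _]; move=> mS.
pose W : 'M[C]_(#|S|, n) := rowsub enum_val 1%:M.
pose TT := W *m P *m T.
have kN0 : kermx TT != 0.
  rewrite -mxrank_eq0 mxrank_ker subn_eq0 -ltnNge.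
  exact: leq_ltn_trans (rank_leq_col TT) mS.
pose x := nz_row (kermx TT).
have x0 : x != 0 by rewrite nz_row_eq0.
have xTT : x *m TT = 0 by apply/sub_kermxP; exact: nz_row_sub.
pose c := x *m W.
have cE i : c 0 i = \sum_(k < #|S|) x 0 k * (enum_val k == i)%:R.
  by rewrite mxE; apply: eq_bigr => k _; rewrite !mxE.
have cS i : ~~ S i -> c 0 i = 0.
  move=> iS; rewrite cE big1// => k _; case: eqP => [ki|_]; last by rewrite mulr0.
  by case/negP: iS; rewrite -ki; exact: (enum_valP k).
have c0 : c != 0.
  apply: contra_neq x0 => c0; apply/rowP => k; rewrite [RHS]mxE.
  have := cE (enum_val k); rewrite c0 mxE (bigD1 k)//= eqxx mulr1 big1 ?addr0 => [-> //|].
  by move=> j /negbTE jk; rewrite (inj_eq enum_val_inj) jk mulr0.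
exists (c *m P); split.
- by rewrite -sqnorm_gt0 sqnorm_unitary// sqnorm_gt0.
- by rewrite /c -[RHS]xTT /TT !mulmxA.
rewrite sqnorm_shift// sqnorm_unitary// mulr_sumr; apply: ler_sum => i _.
have [iS|iS] := boolP (S i); last by rewrite cS// /nsq/= expr0n/= addr0 !mulr0.
rewrite ler_wpM2r ?nsq_ge0// -[leLHS]real_normK ?num_real//.
have e0 : 0 <= e by apply: le_trans iS.
by rewrite ler_pXn2r ?nnegrE.
Qed.

(** Conversely, orthogonality to the eigenvectors of the window leaves only
eigenvalues at distance larger than e. *)
Lemma cnt_test_constraints n (H : 'M[C]_n) (E e : R) : selfadjoint H -> 0 <= e ->
  exists T : 'M[C]_(n, cnt H E e), forall v : 'rV[C]_n, v != 0 -> v *m T = 0 ->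
  e ^+ 2 * sqnorm v < sqnorm (v *m (H - (E%:C%C)%:M)).
Proof.
move=> /selfadjoint_diagonalization[P [d [PP PP' ->]]] e0; rewrite cnt_card//.
set S := [pred i | _].
exists (colsub enum_val (P ^t*)) => v v0 vT.
pose c := v *m P ^t*.
have vE : v = c *m P by rewrite /c -mulmxA PP' mulmx1.
have cS i : S i -> c 0 i = 0.
  move=> iS; have iS' : i \in S by [].
  move/rowP: vT => /(_ (enum_rank_in iS' i)); rewrite !mxE => vT.
  rewrite -[RHS]vT; apply: eq_bigr => k _.
  by rewrite [in RHS]mxE enum_rankK_in.
have c0 : c != 0 by apply: contra_neq v0 => c0; rewrite vE c0 mul0mx.
have [i ci] : exists i, c 0 i != 0.
  apply: contrapT => nc; case/negP: c0; apply/eqP/rowP => i; rewrite [RHS]mxE.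
  by apply/eqP/negPn/negP => ci; apply: nc; exists i.
have sqe j : ~~ S j -> e ^+ 2 < (d j - E) ^+ 2.
  rewrite inE -ltNge => jS; rewrite -[ltRHS]real_normK ?num_real//.
  by rewrite ltr_pXn2r ?nnegrE.
rewrite vE sqnorm_shift// sqnorm_unitary// mulr_sumr.
rewrite (bigD1 i)//= [ltRHS](bigD1 i)//= ltr_leD//.
  have iS : ~~ S i by apply: contra ci => /cS ->.
  by rewrite ltr_pM2r ?sqe// lt_def nsq_ge0 nsq_eq0 ci.
apply: ler_sum => j _.
have [jS|jS] := boolP (S j); first by rewrite cS// /nsq/= expr0n/= addr0 !mulr0.
by rewrite ler_wpM2r ?nsq_ge0// ltW// sqe.
Qed.

Lemma sqnorm_row_mx n1 n2 (u : 'rV[C]_n1) (v : 'rV[C]_n2) :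
  sqnorm (row_mx u v) = sqnorm u + sqnorm v.
Proof.
rewrite /sqnorm big_split_ord/=; congr (_ + _); apply: eq_bigr => j _.
  by rewrite row_mxEl.
by rewrite row_mxEr.
Qed.

Lemma sqnorm0 n : sqnorm (0 : 'rV[C]_n) = 0.
Proof. by rewrite /sqnorm big1// => j _; rewrite mxE /nsq/= expr0n/= addr0. Qed.

Lemma selfadjoint_drsubmx n (H : 'M[C]_(1 + n)) : selfadjoint H -> selfadjoint (drsubmx H).
Proof.
move=> hH; rewrite /selfadjoint -[in RHS]hH.
by apply/matrixP => i j; rewrite !mxE.
Qed.

(** Cauchy interlacing: if the window of H contained two eigenvalues more than
that of the minor, some quasi-mode of H would vanish in the first coordinate and
satisfy the constraints of the minor. *)
Lemma cnt_minor n (H : 'M[C]_(1 + n)) (E e : R) : selfadjoint H -> 0 <= e ->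
  (cnt H E e <= (cnt (drsubmx H) E e).+1)%N.
Proof.
move=> hH e0; rewrite leqNgt; apply/negP => lt.
have [T Tlt] := cnt_test_constraints E (selfadjoint_drsubmx hH) e0.
pose T' : 'M[C]_(1 + n, 1 + cnt (drsubmx H) E e) := block_mx 1%:M 0 0 T.
have [v [v0 vT vle]] := cnt_test_space T' hH lt.
have vE : v = row_mx (lsubmx v) (rsubmx v) by rewrite hsubmxK.
move: vT; rewrite vE mul_row_block !mulmx0 addr0 add0r mulmx1.
rewrite -[0](@row_mx0 _ 1 1) => /eq_row_mx[l0 rT].
have r0 : rsubmx v != 0 by apply: contra_neq v0 => r0; rewrite vE l0 r0 row_mx0.
have := Tlt _ r0 rT; apply/negP; rewrite -leNgt.
have {vE} : v = row_mx 0 (rsubmx v) by rewrite -[X in row_mx X]l0.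
move: (rsubmx v) => u vE; move: vle; rewrite {}vE sqnorm_row_mx sqnorm0 add0r; apply: le_trans.
have -> : row_mx 0 u *m (H - (E%:C%C)%:M) =
    row_mx (u *m dlsubmx H) (u *m (drsubmx H - (E%:C%C)%:M)).
  rewrite -{1}[H]submxK (scalar_mx_block 1 n) opp_block_mx add_block_mx.
  by rewrite mul_row_block !mul0mx !add0r subr0.
by rewrite sqnorm_row_mx lerDr sqnorm_ge0.
Qed.

End counting_variational.

(** * Sums with random signs *)
Section random_signs.
Context {R : realType} (n : nat).
Local Notation signs := {ffun 'I_n -> bool}.
Implicit Types (g : signs) (r : seq 'I_n) (v : 'I_n -> R).

Definition flip (i : 'I_n) g : signs := [ffun j => if j == i then ~~ g j else g j].

Lemma flipK i : involutive (flip i).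
Proof. by move=> g; apply/ffunP => j; rewrite !ffunE; case: eqP => // _; rewrite negbK. Qed.

Lemma sum_sign_odd (i : 'I_n) (Phi : signs -> R) : (forall g, Phi (flip i g) = Phi g) ->
  \sum_(g : signs) (-1) ^+ g i * Phi g = 0.
Proof.
move=> PhiE; set x := \sum_(g : signs) _.
have : x = - x.
  rewrite {1}/x (reindex_inj (inv_inj (flipK i)))/= /x -sumrN; apply: eq_bigr => g _.
  by rewrite PhiE ffunE eqxx signrN mulNr.
by move=> /eqP; rewrite -subr_eq0 opprK -mulr2n mulrn_eq0/= => /eqP.
Qed.

Definition signed_sum r v g : R := \sum_(i <- r) (-1) ^+ g i * v i.

Lemma signed_sum_flip i r v g : i \notin r -> signed_sum r v (flip i g) = signed_sum r v g.
Proof.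
move=> ir; apply: eq_big_seq => j jr; rewrite ffunE; case: eqP => // ji.
by rewrite -ji jr in ir.
Qed.

Let K : R := #|{: signs}|%:R.

Lemma sum_signed_sum2 r v : uniq r ->
  \sum_(g : signs) signed_sum r v g ^+ 2 = K * \sum_(i <- r) v i ^+ 2.
Proof.
elim: r => [|i r IHr] /=.
  by rewrite big_nil mulr0 big1// => g _; rewrite /signed_sum big_nil expr0n.
move=> /andP[ir /IHr {}IHr]; rewrite big_cons.
rewrite (eq_bigr (fun g => (v i ^+ 2 + signed_sum r v g ^+ 2) +
    (-1) ^+ g i * (2 * v i * signed_sum r v g))); last first.
  move=> g _; rewrite /signed_sum big_cons -/(signed_sum r v g).
  by case: (g i); rewrite ?expr0 ?expr1; ring.
rewrite big_split/= sum_sign_odd => [|g]; last by rewrite signed_sum_flip.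
by rewrite addr0 big_split/= IHr sumr_const /K -mulr_natl; ring.
Qed.

Lemma sum_signed_sum4 r v : uniq r ->
  \sum_(g : signs) signed_sum r v g ^+ 4 <= 3 * K * (\sum_(i <- r) v i ^+ 2) ^+ 2.
Proof.
elim: r => [|i r IHr] /=.
  by rewrite big_nil expr0n/= mulr0 big1// => g _; rewrite /signed_sum big_nil expr0n.
move=> /andP[ir ur]; rewrite big_cons.
(* the last two terms are odd in the sign of index i and sum to zero *)
rewrite (eq_bigr (fun g => (v i ^+ 4 + 6 * v i ^+ 2 * signed_sum r v g ^+ 2 +
    signed_sum r v g ^+ 4) +
    (-1) ^+ g i * (4 * v i ^+ 3 * signed_sum r v g + 4 * v i * signed_sum r v g ^+ 3))).
  rewrite big_split/= sum_sign_odd => [|g]; last by rewrite signed_sum_flip.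
  rewrite addr0; under eq_bigr do rewrite -addrA.
  rewrite big_split/= big_split/= -[X in _ + (X + _)]mulr_sumr (sum_signed_sum2 v ur) sumr_const -[_ *+ _]mulr_natl -/K.
  have := IHr ur; set S4 := \sum_(g : signs) signed_sum r v g ^+ 4; set V := \sum_(_ <- _) _ => h.
  have K0 : 0 <= K by exact: ler0n.
  have : 0 <= K * v i ^+ 4 by rewrite mulr_ge0// exprn_even_ge0.
  by rewrite [v i ^+ 4](_ : _ = (v i ^+ 2) ^+ 2) -?exprM//; nra.
move=> g _; rewrite /signed_sum big_cons -/(signed_sum r v g).
by case: (g i); rewrite ?expr0 ?expr1; ring.
Qed.

(** Paley-Zygmund. With x the square of the signed sum divided by its mean, the
polynomial 5 (x - 1/2) - x^2 / 2 is negative for x < 1/2 and at most 10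
everywhere, and its mean is at least 1 by [sum_signed_sum4]. *)
Lemma signed_sum_anticoncentration v :
  #|{: signs}|%:R <= 10 * (\sum_(g : signs)
    ((\sum_i v i ^+ 2) / 2 <= (\sum_i (-1) ^+ g i * v i) ^+ 2)%R)%:R :> R.
Proof.
set V := \sum_i v i ^+ 2.
have V0 : 0 <= V by apply: sumr_ge0 => i _; exact: sqr_ge0.
have [V_eq0|V_neq0] := eqVneq V 0.
  rewrite (eq_bigr (fun=> 1%N)) => [|g _]; last by rewrite V_eq0 mul0r sqr_ge0.
  by rewrite sum1_card ler_peMl// ler1n.
have {V_neq0}Vp : 0 < V by rewrite lt_def V_neq0.
pose S g := signed_sum (index_enum 'I_n) v g.
have M2 : \sum_(g : signs) S g ^+ 2 = K * V by apply: sum_signed_sum2; exact: index_enum_uniq.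
have M4 : \sum_(g : signs) S g ^+ 4 <= 3 * K * V ^+ 2.
  by apply: sum_signed_sum4; exact: index_enum_uniq.
rewrite natr_sum mulr_sumr.
apply: (@le_trans _ _ (\sum_(g : signs) (5 * (S g ^+ 2 / V - 1 / 2) - S g ^+ 4 / V ^+ 2 / 2))).
  rewrite sumrB -mulr_sumr sumrB -!mulr_suml M2 sumr_const -[_ *+ _]mulr_natl -/K.
  have : (\sum_(g : signs) S g ^+ 4) / V ^+ 2 <= 3 * K by rewrite ler_pdivrMr ?exprn_gt0.
  rewrite mulfK ?gt_eqF//; lra.
apply: ler_sum => g _; rewrite -/(signed_sum _ v g) -/(S g).
rewrite (_ : S g ^+ 4 / V ^+ 2 = (S g ^+ 2 / V) ^+ 2); last first.
  by rewrite expr_div_n -exprM.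
have -> : (V / 2 <= S g ^+ 2) = (1 / 2 <= S g ^+ 2 / V).
  by rewrite ler_pdivlMr// mulrAC mul1r.
set x := S g ^+ 2 / V.
have x0 : 0 <= x by rewrite divr_ge0// sqr_ge0.
have := sqr_ge0 (x - 5).
have [h|h] /= := leP (1 / 2) x; rewrite ?mulr1n ?mulr0n ?mulr0 ?mulr1 => h5; nra.
Qed.

(** Use the real or the imaginary parts of u, whichever have the larger norm. *)
Lemma signed_sumC_anticoncentration (u : 'rV[R[i]]_n) :
  #|{: signs}|%:R <= 10 * (\sum_(g : signs)
    (sqnorm u <= 4 * nsq (\sum_i u 0 i * ((-1) ^+ g i)%:C%C))%R)%:R :> R.
Proof.
have ReE g : complex.Re (\sum_i u 0 i * ((-1) ^+ g i)%:C%C) =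
    \sum_i (-1) ^+ g i * complex.Re (u 0 i).
  rewrite (raddf_sum (@complex.Re R : {additive Rcomplex R -> R})).
  by apply: eq_bigr => i _; case: (u 0 i) => a b /=; rewrite mulr0 subr0 mulrC.
have ImE g : complex.Im (\sum_i u 0 i * ((-1) ^+ g i)%:C%C) =
    \sum_i (-1) ^+ g i * complex.Im (u 0 i).
  rewrite (raddf_sum (@complex.Im R : {additive Rcomplex R -> R})).
  by apply: eq_bigr => i _; case: (u 0 i) => a b /=; rewrite mulr0 add0r mulrC.
have uE : sqnorm u = \sum_i complex.Re (u 0 i) ^+ 2 + \sum_i complex.Im (u 0 i) ^+ 2.
  by rewrite /sqnorm /nsq big_split.
have [le|/ltW le] := leP (\sum_i complex.Im (u 0 i) ^+ 2) (\sum_i complex.Re (u 0 i) ^+ 2).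
  apply: (le_trans (signed_sum_anticoncentration (fun i => complex.Re (u 0 i)))).
  rewrite ler_pM2l// ler_nat leq_sum// => g _.
  case: (leP (_ / 2)) => // h; rewrite lt0b uE /nsq ReE ImE.
  have := sqr_ge0 (\sum_i (-1) ^+ g i * complex.Im (u 0 i)); lra.
apply: (le_trans (signed_sum_anticoncentration (fun i => complex.Im (u 0 i)))).
rewrite ler_pM2l// ler_nat leq_sum// => g _.
case: (leP (_ / 2)) => // h; rewrite lt0b uE /nsq ReE ImE.
have := sqr_ge0 (\sum_i (-1) ^+ g i * complex.Re (u 0 i)); lra.
Qed.

End random_signs.

(** * The matrix ensembles *)
Section matrix_ensemble.
Local Open Scope sesquilinear_scope.
Context {R : realType}.
Local Notation C := R[i].

Notation entries n := ('I_n * 'I_n * bool)%type.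

Definition cmx m n (O : 'M[R]_(m, n)) : 'M[C]_(m, n) := map_mx (fun t : R => t%:C%C) O.

Lemma cmxM m n p (O : 'M[R]_(m, n)) (O' : 'M[R]_(n, p)) : cmx (O *m O') = cmx O *m cmx O'.
Proof. exact: (map_mxM (real_complex R)). Qed.

Lemma cmx_adjoint m n (O : 'M[R]_(m, n)) : (cmx O) ^t* = cmx O^T.
Proof. by apply/matrixP => i j; rewrite !mxE; exact: conjc_real. Qed.

Definition rotmx n (O : 'M[R]_n) (H : 'M[C]_n) : 'M[C]_n := cmx O *m H *m cmx O^T.

Lemma rotmx_adjoint n (O : 'M[R]_n) (H : 'M[C]_n) : (rotmx O H) ^t* = rotmx O (H ^t*).
Proof.
rewrite /rotmx trmx_mul map_mxM trmx_mul map_mxM !cmx_adjoint trmxK.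
by rewrite mulmxA.
Qed.

Lemma cmx_orthogonal n (O : 'M[R]_n) : O *m O^T = 1%:M -> cmx O *m cmx O^T = 1%:M.
Proof. by move=> OO; rewrite -cmxM OO; exact: (map_mx1 (real_complex R)). Qed.

Lemma cnt_rotmx n (O : 'M[R]_n) (H : 'M[C]_n) (E e : R) : O *m O^T = 1%:M ->
  cnt (rotmx O H) E e = cnt H E e.
Proof.
move=> /cmx_orthogonal OO; rewrite /cnt /eigenvalue_count /rotmx.
have OO' := mulmx1C OO.
have [Pu _] := mulmx1_unit OO'.
have <- : invmx (cmx O^T) = cmx O.
  by rewrite -[LHS]mulmx1 -OO' mulKmx.
by rewrite char_poly_conj.
Qed.

Definition slab n (x : rvec R (entries n)) (b : bool) : 'M[R]_n := \matrix_(i, j) x (i, j, b).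

(** Conjugation of the noise, acting separately on real and imaginary parts. *)
Definition rotate_entries n (O : 'M[R]_n) (x : rvec R (entries n)) : rvec R (entries n) :=
  fun p => (O *m slab x p.2 *m O^T) p.1.1 p.1.2.

Lemma slab_rotate n (O : 'M[R]_n) (x : rvec R (entries n)) b :
  slab (rotate_entries O x) b = O *m slab x b *m O^T.
Proof. by apply/matrixP => i j; rewrite mxE. Qed.

Lemma sum_entries n (x : rvec R (entries n)) :
  \sum_p x p ^+ 2 = \sum_(b : bool) \tr (slab x b *m (slab x b)^T).
Proof.
transitivity (\sum_p \sum_b x (p, b) ^+ 2).
  by rewrite pair_big; apply: eq_bigr => -[].
rewrite exchange_big; apply: eq_bigr => b _.
transitivity (\sum_i \sum_j x (i, j, b) ^+ 2).
  by rewrite pair_big; apply: eq_bigr => -[].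
by apply: eq_bigr => i _; rewrite mxE; apply: eq_bigr => j _; rewrite !mxE expr2.
Qed.

Lemma rotate_entries_isometry n (O : 'M[R]_n) : O *m O^T = 1%:M ->
  l2_isometry (rotate_entries O).
Proof.
move=> OO; have OO' := mulmx1C OO; split.
- apply: measurable_to_rvec => -[[i j] b].
  rewrite (_ : (fun w => _) = (fun w : rvec R (entries n) =>
     \sum_l (\sum_k O i k * w (k, l, b)) * O j l)); last first.
    apply/funext => w; rewrite /rotate_entries/= mxE; apply: eq_bigr => l _.
    by rewrite !mxE; congr (_ * _); apply: eq_bigr => k _; rewrite mxE.
  apply: measurable_sum => l; apply: measurable_funM => //.
  apply: measurable_sum => k; apply: measurable_funM => //; exact: measurable_coord.
- move=> a x; apply/funext => -[[i j] b].
  rewrite /translate /rotate_entries/= (_ : slab _ b = slab x b + slab a b).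
    by rewrite mulmxDr mulmxDl mxE.
  by apply/matrixP => k l; rewrite !mxE.
- move=> x; rewrite !sum_entries; apply: eq_bigr => b _; rewrite slab_rotate.
  rewrite !trmx_mul trmxK !mulmxA -[_ *m O^T *m O]mulmxA OO' mulmx1.
  by rewrite mxtrace_mulC !mulmxA OO' mul1mx.
- move=> a; exists (rotate_entries O^T a); apply/funext => -[[i j] b].
  rewrite /rotate_entries/= (_ : slab _ b = O^T *m slab a b *m O).
    by rewrite !mulmxA OO mul1mx -mulmxA OO mulmx1 mxE.
  by apply/matrixP => k l; rewrite mxE/= trmxK.
Qed.

Variables (S : bool) (kap : R).

(** S tells whether imaginary parts are present: the same space of entries
carries the GOE (S = false, imaginary coordinates ignored) and the GUE. *)
Definition mat n (x : rvec R (entries n)) : 'M[C]_n :=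
  cmx (slab x false) + (0 +i* S%:R)%C *: cmx (slab x true).

(** The scale kap is independent of n, so that minors of ham are again of the
same form ([drsubmx_ham]). *)
Definition ham n (H0 : 'M[C]_n) (x : rvec R (entries n)) : 'M[C]_n :=
  H0 + kap%:C%C *: (mat x + (mat x) ^t*).

(** For the GOE, H0 has to be real: otherwise the vector b = M h would have
imaginary parts to which the real border is not sensitive. *)
Definition admissible n (H0 : 'M[C]_n) : Prop :=
  selfadjoint H0 /\ (~~ S -> H0 \is a realmx).

Lemma matE n (x : rvec R (entries n)) i j :
  mat x i j = (x (i, j, false) +i* (S%:R * x (i, j, true)))%C.
Proof.
by rewrite !mxE; apply/eqP; rewrite eq_complex/=; apply/andP; split; apply/eqP; ring.
Qed.

Lemma hamE n (H0 : 'M[C]_n) (x : rvec R (entries n)) i j :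
  ham H0 x i j = H0 i j + ((kap * (x (i, j, false) + x (j, i, false))) +i*
     (kap * S%:R * (x (i, j, true) - x (j, i, true))))%C.
Proof.
rewrite mxE [X in _ + X]mxE; congr (_ + _); rewrite mxE [X in _ + X]mxE [X in (_ + X^*)]mxE !matE.
by apply/eqP; rewrite eq_complex/=; apply/andP; split; apply/eqP; ring.
Qed.

Lemma ham_selfadjoint n (H0 : 'M[C]_n) x : selfadjoint H0 -> selfadjoint (ham H0 x).
Proof.
move=> hH; apply/matrixP => i j; rewrite mxE [_^T _ _]mxE !hamE rmorphD/=.
have -> : H0 i j = (H0 j i)^* by rewrite -[in LHS]hH !mxE.
congr (_ + _).
by apply/eqP; rewrite eq_complex/=; apply/andP; split; apply/eqP; ring.
Qed.

Lemma ham_real n (H0 : 'M[C]_n) x : admissible H0 -> ~~ S -> ham H0 x \is a realmx.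
Proof.
move=> [_ rH] /[dup] nS /rH/mxOverP Hr; apply/mxOverP => i j.
rewrite hamE rpredD// (negbTE nS) mulr0 mul0r; by rewrite complex_real.
Qed.

Lemma mat_rotate n (O : 'M[R]_n) x : mat (rotate_entries O x) = rotmx O (mat x).
Proof. by rewrite /mat !slab_rotate !cmxM /rotmx mulmxDr mulmxDl -scalemxAr -scalemxAl. Qed.

Lemma ham_rotate n (O : 'M[R]_n) H0 x :
  ham (rotmx O H0) (rotate_entries O x) = rotmx O (ham H0 x).
Proof.
have rotD (B1 B2 : 'M[C]_n) : rotmx O (B1 + B2) = rotmx O B1 + rotmx O B2.
  by rewrite /rotmx mulmxDr mulmxDl.
have rotZ a (B1 : 'M[C]_n) : rotmx O (a *: B1) = a *: rotmx O B1.
  by rewrite /rotmx -scalemxAr -scalemxAl.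
by rewrite /ham mat_rotate rotmx_adjoint [RHS]rotD rotZ (rotD (mat x)).
Qed.

Lemma admissible_rotmx n (O : 'M[R]_n) H0 : admissible H0 -> admissible (rotmx O H0).
Proof.
move=> [hH rH]; split; first by rewrite /selfadjoint rotmx_adjoint hH.
move=> /rH/mxOverP Hr; apply: mxOverM; first apply: mxOverM.
- by apply/mxOverP => i j; rewrite mxE; by rewrite complex_real.
- exact/mxOverP.
- by apply/mxOverP => i j; rewrite mxE; by rewrite complex_real.
Qed.

Definition minor_entry n (q : entries n) : entries (1 + n) :=
  (rshift 1 q.1.1, rshift 1 q.1.2, q.2).

Lemma minor_entry_inj n : injective (@minor_entry n).
Proof. by move=> [[i j] b] [[k l] c] [] /= /addnI /val_inj -> /addnI /val_inj -> ->. Qed.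

Lemma drsubmx_ham n (H0 : 'M[C]_(1 + n)) x :
  drsubmx (ham H0 x) = ham (drsubmx H0) (fun q => x (minor_entry q)).
Proof.
apply/matrixP => i j; rewrite hamE (_ : drsubmx _ i j = ham H0 x (rshift 1 i) (rshift 1 j)).
  by rewrite hamE; congr (_ + _); rewrite !mxE.
by rewrite !mxE.
Qed.

Lemma admissible_drsubmx n (H0 : 'M[C]_(1 + n)) : admissible H0 -> admissible (drsubmx H0).
Proof.
move=> [hH rH]; split; first exact: selfadjoint_drsubmx.
by move=> /rH/mxOverP Hr; apply/mxOverP => i j; rewrite !mxE.
Qed.

End matrix_ensemble.

Notation entries n := ('I_n * 'I_n * bool)%type.

(** * The Schur complement without inverses *)
Section schur_complement.
Local Open Scope sesquilinear_scope.
Context {R : realType}.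
Local Notation C := R[i].

(** Expand the nonnegative sum of the |B a_i - c conj (b_i)|^2, where c is the left
sum and B the sum of the |b_i|^2. *)
Lemma nsq_cauchy_schwarz (I : finType) (a b : I -> C) :
  nsq (\sum_i a i * b i) <= (\sum_i nsq (a i)) * (\sum_i nsq (b i)).
Proof.
set c := \sum_i _; set A := \sum_i _; set B := \sum_i _.
have B0 : 0 <= B by apply: sumr_ge0 => i _; exact: nsq_ge0.
have [B_eq0|B_neq0] := eqVneq B 0.
  have b0 i : b i = 0.
    apply/eqP; rewrite -nsq_eq0; move/eqP: B_eq0; rewrite psumr_eq0 => [/allP|j _].
      by move=> /(_ i); rewrite mem_index_enum => /(_ isT).
    exact: nsq_ge0.
  rewrite B_eq0 mulr0 /c big1 => [|i _]; last by rewrite b0 mulr0.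
  by rewrite /nsq/= expr0n/= addr0.
have Bp : 0 < B by rewrite lt_def B_neq0.
have key : \sum_i nsq (B%:C%C * a i - c * (b i)^*) = B * (B * A - nsq c).
  transitivity (B ^+ 2 * A + nsq c * B - 2 * B * complex.Re (c * c^*)).
    have -> : complex.Re (c * c^*) = \sum_i complex.Re (a i * b i * c^*).
      rewrite {1}/c mulr_suml.
      by rewrite (raddf_sum (@complex.Re R : {additive Rcomplex R -> R})).
    rewrite (eq_bigr (fun i => B ^+ 2 * nsq (a i) + nsq c * nsq (b i) -
        2 * B * complex.Re (a i * b i * c^*))) => [|i _].
      rewrite sumrB big_split/= -[X in _ - X]mulr_sumr.
      by rewrite -[X in X + _ - _]mulr_sumr -[X in _ + X - _]mulr_sumr.
    rewrite /nsq; case: (a i) (b i) c => [a1 a2] [b1 b2] [c1 c2] /=; ring.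
  have -> : complex.Re (c * c^*) = nsq c by rewrite /nsq; case: c => [c1 c2] /=; ring.
  by ring.
have : 0 <= B * (B * A - nsq c).
  by rewrite -key; apply: sumr_ge0 => i _; exact: nsq_ge0.
by rewrite pmulr_rge0// subr_ge0 mulrC.
Qed.

Section pivot.
Variables (n : nat) (H : 'M[C]_(1 + n)) (E : R).

(** The Schur complement multiplied by det (B - E), with the adjugate in place of
the inverse: everything is polynomial in the entries and no invertibility is
required. *)
Definition schur_det : C := \det (drsubmx H - (E%:C%C)%:M).
Definition schur_vec : 'cV[C]_n := \adj (drsubmx H - (E%:C%C)%:M) *m dlsubmx H.
Definition schur_pivot : C := (H 0 0 - E%:C%C) * schur_det - (ursubmx H *m schur_vec) 0 0.
Definition schur_weight : R := nsq schur_det + \sum_i nsq (schur_vec i 0).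

Lemma schur_elimination :
  (H - (E%:C%C)%:M) *m col_mx (schur_det%:M) (- schur_vec) = col_mx (schur_pivot%:M) 0.
Proof.
rewrite -{1}[H]submxK (scalar_mx_block 1 n) opp_block_mx add_block_mx mul_block_col.
rewrite !oppr0 !addr0; congr col_mx; last first.
  rewrite mulmxN /schur_vec mulmxA mul_mx_adj -/schur_det.
  by rewrite mul_mx_scalar mul_scalar_mx subrr.
rewrite mul_mx_scalar mulmxN; apply/matrixP => i j; rewrite !ord1 /schur_pivot.
rewrite [RHS]mxE eqxx mulr1n [LHS]mxE [X in X + _]mxE [X in _ + X]mxE; congr (_ - _).
rewrite mulrC [X in X * _]mxE [X in _ + X]mxE [X in _ - X]mxE eqxx mulr1n !mxE.
by congr ((H _ _ - _) * _); apply/val_inj.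
Qed.

(** Since v (H - E) (d, - b) = v_0 F by [schur_elimination], Cauchy-Schwarz turns
a quasi-mode that is visible in the first coordinate into a small pivot. *)
Lemma schur_pivot_small (e K : R) (v : 'rV[C]_(1 + n)) : v != 0 ->
  sqnorm (v *m (H - (E%:C%C)%:M)) <= e ^+ 2 * sqnorm v ->
  sqnorm v <= K * nsq (v 0 0) -> nsq schur_pivot <= K * e ^+ 2 * schur_weight.
Proof.
move=> v0 ve vK; set w := col_mx (schur_det%:M) (- schur_vec).
have FE : v 0 0 * schur_pivot = \sum_i (v *m (H - (E%:C%C)%:M)) 0 i * w i 0.
  transitivity ((v *m (H - (E%:C%C)%:M) *m w) 0 0); last by rewrite mxE.
  rewrite -mulmxA schur_elimination -[v in RHS]hsubmxK mul_row_col mulmx0 addr0.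
  rewrite mul_mx_scalar !mxE mulrC; congr (_ * v _ _); exact/val_inj.
have wE : \sum_i nsq (w i 0) = schur_weight.
  rewrite big_split_ord/= big_ord1 /schur_weight; congr (_ + _).
    by rewrite /w col_mxEu mxE eqxx mulr1n.
  by apply: eq_bigr => i _; rewrite /w col_mxEd mxE /nsq; case: (schur_vec i 0) => a b /=; ring.
have vp : 0 < nsq (v 0 0).
  have : 0 < sqnorm v by rewrite sqnorm_gt0.
  rewrite [0 < nsq _]lt_def nsq_ge0 andbT; apply: contraTneq => v00.
  by rewrite -leNgt (le_trans vK)// v00 mulr0.
have W0 : 0 <= schur_weight by rewrite addr_ge0 ?nsq_ge0// sumr_ge0// => i _; exact: nsq_ge0.
rewrite -(ler_pM2l vp) -nsqM FE; apply: le_trans (nsq_cauchy_schwarz _ _) _.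
rewrite wE -/(sqnorm _).
have -> : nsq (v 0 0) * (K * e ^+ 2 * schur_weight) = e ^+ 2 * (K * nsq (v 0 0)) * schur_weight.
  by ring.
by rewrite ler_wpM2r// (le_trans ve)// ler_wpM2l// sqr_ge0.
Qed.

End pivot.

Lemma exists_sign_rotation n (g : {ffun 'I_(1 + n) -> bool}) : exists O : 'M[R]_(1 + n),
  O *m O^T = 1%:M /\ forall i, O 0 i = (-1) ^+ g i / Num.sqrt (1 + n)%:R.
Proof.
pose u (i : 'I_(1 + n)) : R := (-1) ^+ g i / Num.sqrt (1 + n)%:R.
have u1 : dotv u u = 1.
  rewrite /dotv (eq_bigr (fun=> (1 + n)%:R^-1)) => [|i _].
    by rewrite sumr_const card_ord -[_ *+ _]mulr_natl divff// pnatr_eq0.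
  rewrite /u mulrACA -signr_addb addbb mul1r -expr2 exprVn sqr_sqrtr ?ler0n //.
pose w (j : 'I_(1 + n)) : R := u j - (j == 0)%:R.
pose dl i (j : 'I_(1 + n)) : R := (j == i)%:R.
exists (\matrix_(i, j) householder w (dl i) j); split; last first.
  by move=> i; rewrite mxE (householder_unit 0 u1).
apply/matrixP => i j; rewrite !mxE.
rewrite (eq_bigr (fun k => householder w (dl i) k * householder w (dl j) k)) => [|k _].
  rewrite (isometry_dot (householder_isometry w)) (bigD1 i)//= big1 => [|k /negbTE ki].
    by rewrite /dl eqxx mul1r addr0.
  by rewrite /dl ki mul0r.
by rewrite !mxE.
Qed.

End schur_complement.

(** * Measurability of eigenvalue counts *)
Section complex_measurability.
Local Open Scope sesquilinear_scope.
Context {R : realType} d (T : measurableType d).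
Local Notation C := R[i].

(** Measurability through real and imaginary parts avoids a sigma-algebra on the
complex numbers. *)
Definition cmeas (f : T -> C) : Prop :=
  measurable_fun setT (fun t => complex.Re (f t)) /\
  measurable_fun setT (fun t => complex.Im (f t)).

Lemma eq_cmeas f g : f =1 g -> cmeas f -> cmeas g.
Proof. by move=> /funext ->. Qed.

Lemma cmeas_cst c : cmeas (fun=> c).
Proof. by split; exact: measurable_cst. Qed.

Lemma cmeasD f g : cmeas f -> cmeas g -> cmeas (fun t => f t + g t).
Proof.
move=> [f1 f2] [g1 g2]; split.
- rewrite (_ : (fun t => _) = fun t => complex.Re (f t) + complex.Re (g t)).
    exact: measurable_funD.
  by apply/funext => t; case: (f t) (g t) => [? ?] [? ?].
- rewrite (_ : (fun t => _) = fun t => complex.Im (f t) + complex.Im (g t)).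
    exact: measurable_funD.
  by apply/funext => t; case: (f t) (g t) => [? ?] [? ?].
Qed.

Lemma cmeasM f g : cmeas f -> cmeas g -> cmeas (fun t => f t * g t).
Proof.
move=> [f1 f2] [g1 g2]; split.
- rewrite (_ : (fun t => _) = fun t => complex.Re (f t) * complex.Re (g t) -
                                       complex.Im (f t) * complex.Im (g t)).
    by apply: measurable_funB; apply: measurable_funM.
  by apply/funext => t; case: (f t) (g t) => [? ?] [? ?].
- rewrite (_ : (fun t => _) = fun t => complex.Re (f t) * complex.Im (g t) +
                                       complex.Im (f t) * complex.Re (g t)).
    by apply: measurable_funD; apply: measurable_funM.
  by apply/funext => t; case: (f t) (g t) => [? ?] [? ?].
Qed.

Lemma cmeasN f : cmeas f -> cmeas (fun t => - f t).
Proof.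
move=> mf; apply: (@eq_cmeas (fun t => -1 * f t)) => [t|]; first by rewrite mulN1r.
by apply: cmeasM => //; exact: cmeas_cst.
Qed.

Lemma cmeasB f g : cmeas f -> cmeas g -> cmeas (fun t => f t - g t).
Proof. by move=> mf mg; apply: cmeasD => //; exact: cmeasN. Qed.

Lemma cmeas_sum (I : Type) (r : seq I) (f : I -> T -> C) : (forall i, cmeas (f i)) ->
  cmeas (fun t => \sum_(i <- r) f i t).
Proof.
move=> mf; elim: r => [|i r IHr].
  by apply: (@eq_cmeas (fun=> 0)) => [t|]; [rewrite big_nil | exact: cmeas_cst].
apply: (@eq_cmeas (fun t => f i t + \sum_(j <- r) f j t)) => [t|].
  by rewrite big_cons.
exact: cmeasD.
Qed.

Lemma cmeas_prod (I : Type) (r : seq I) (f : I -> T -> C) : (forall i, cmeas (f i)) ->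
  cmeas (fun t => \prod_(i <- r) f i t).
Proof.
move=> mf; elim: r => [|i r IHr].
  by apply: (@eq_cmeas (fun=> 1)) => [t|]; [rewrite big_nil | exact: cmeas_cst].
apply: (@eq_cmeas (fun t => f i t * \prod_(j <- r) f j t)) => [t|].
  by rewrite big_cons.
exact: cmeasM.
Qed.

Definition mxmeas m n (F : T -> 'M[C]_(m, n)) : Prop := forall i j, cmeas (fun t => F t i j).

Lemma eq_mxmeas m n (F G : T -> 'M[C]_(m, n)) : (forall t i j, F t i j = G t i j) ->
  mxmeas F -> mxmeas G.
Proof. by move=> FG mF i j; apply: eq_cmeas (mF i j) => t. Qed.

Lemma mxmeas_cst m n (M : 'M[C]_(m, n)) : mxmeas (fun=> M).
Proof. by move=> i j; exact: cmeas_cst. Qed.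

Lemma mxmeasD m n (F G : T -> 'M[C]_(m, n)) : mxmeas F -> mxmeas G ->
  mxmeas (fun t => F t + G t).
Proof.
move=> mF mG i j; apply: (@eq_cmeas (fun t => F t i j + G t i j)) => [t|].
  by rewrite mxE.
exact: cmeasD.
Qed.

Lemma mxmeasZ m n (c : C) (F : T -> 'M[C]_(m, n)) : mxmeas F -> mxmeas (fun t => c *: F t).
Proof.
move=> mF i j; apply: (@eq_cmeas (fun t => c * F t i j)) => [t|]; first by rewrite mxE.
by apply: cmeasM => //; exact: cmeas_cst.
Qed.

Lemma mxmeasM m n p (F : T -> 'M[C]_(m, n)) (G : T -> 'M[C]_(n, p)) :
  mxmeas F -> mxmeas G -> mxmeas (fun t => F t *m G t).
Proof.
move=> mF mG i j; apply: (@eq_cmeas (fun t => \sum_k F t i k * G t k j)) => [t|].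
  by rewrite mxE.
by apply: cmeas_sum => k; exact: cmeasM.
Qed.

Lemma cmeas_det n (F : T -> 'M[C]_n) : mxmeas F -> cmeas (fun t => \det (F t)).
Proof.
move=> mF; apply: cmeas_sum => s; apply: cmeasM; first exact: cmeas_cst.
by apply: cmeas_prod.
Qed.

Lemma mxmeas_adj n (F : T -> 'M[C]_n) : mxmeas F -> mxmeas (fun t => \adj (F t)).
Proof.
move=> mF i j; apply: (@eq_cmeas (fun t => (-1) ^+ (j + i) * \det (row' j (col' i (F t))))) => [t|].
  by rewrite mxE.
apply: cmeasM; first exact: cmeas_cst.
apply: cmeas_det => k l; apply: (@eq_cmeas (fun t => F t (lift j k) (lift i l))) => // t.
by rewrite !mxE.
Qed.

Lemma measurable_nsq f : cmeas f -> measurable_fun setT (fun t => nsq (f t)).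
Proof. by move=> [f1 f2]; apply: measurable_funD; apply: measurable_funX. Qed.

Fixpoint mxpow n (M : 'M[C]_n) k : 'M[C]_n := if k is k'.+1 then M *m mxpow M k' else 1%:M.

Lemma mxmeas_pow n (F : T -> 'M[C]_n) k : mxmeas F -> mxmeas (fun t => mxpow (F t) k).
Proof. by move=> mF; elim: k => [|k IHk] /=; [exact: mxmeas_cst | exact: mxmeasM]. Qed.

Lemma conj_mulmx n (P Q D D' : 'M[C]_n) : P *m Q = 1%:M ->
  (Q *m D *m P) *m (Q *m D' *m P) = Q *m (D *m D') *m P.
Proof.
move=> PQ; rewrite -!mulmxA; congr (_ *m (_ *m _)).
by rewrite !mulmxA PQ mul1mx.
Qed.

Lemma mxpow_diag n (P : 'M[C]_n) (f : 'I_n -> R) k : P *m P ^t* = 1%:M -> P ^t* *m P = 1%:M ->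
  mxpow (P ^t* *m diag_mx (\row_i (f i)%:C%C) *m P) k =
  P ^t* *m diag_mx (\row_i (f i ^+ k)%:C%C) *m P.
Proof.
move=> PP PP'; elim: k => [|k /= ->].
  rewrite /= (_ : diag_mx _ = 1%:M) ?mulmx1 ?PP'//.
  by apply/matrixP => i j; rewrite !mxE expr0 rmorph1.
have -> : diag_mx (\row_i (f i ^+ k.+1)%:C%C) =
    diag_mx (\row_i (f i)%:C%C) *m diag_mx (\row_i (f i ^+ k)%:C%C).
  apply/esym; apply: (etrans (mulmx_diag _ _)); congr diag_mx.
  by apply/rowP => i; rewrite !mxE exprS rmorphM.
exact: conj_mulmx.
Qed.

End complex_measurability.

Section counting_measurability.
Local Open Scope sesquilinear_scope.
Context {R : realType}.
Local Notation C := R[i].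

Lemma det_shift_diag n (P : 'M[C]_n) (f : 'I_n -> R) (c : R) : P *m P ^t* = 1%:M ->
  P ^t* *m P = 1%:M ->
  \det (P ^t* *m diag_mx (\row_i (f i)%:C%C) *m P + (c%:C%C)%:M) = (\prod_i (c + f i))%:C%C.
Proof.
move=> PP PP'.
have -> : P ^t* *m diag_mx (\row_i (f i)%:C%C) *m P + (c%:C%C)%:M =
    P ^t* *m diag_mx (\row_i (c + f i)%:C%C) *m P.
  rewrite (_ : diag_mx (\row_i (c + f i)%:C%C) = diag_mx (\row_i (f i)%:C%C) + (c%:C%C)%:M).
    rewrite mulmxDr mulmxDl; congr (_ + _).
    by rewrite mul_mx_scalar -scalemxAl PP' scalemx1.
  by apply/matrixP => i j; rewrite !mxE -mulrnDl rmorphD addrC.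
rewrite !det_mulmx mulrAC -det_mulmx PP' det1 mul1r det_diag rmorph_prod.
by apply: eq_bigr => i _; rewrite mxE.
Qed.

(** At most 1 for |t| <= e, whatever p, because the threshold e + 1 / (p + 1)
stays above e; exponentially large in p for |t| > e. *)
Definition level (e t : R) (p : nat) : R := (t / (e + p.+1%:R^-1)) ^+ (2 * p.+1).

(** Inside the window the level is at most 1 and negligible before p; outside, it
is at least (p a)^2 for some a > 0, by the Bernoulli inequality, and p is
negligible. *)
Lemma level_cvg (e t : R) : 0 <= e ->
  (fun p => (p.+1%:R + level e t p) / (2 * p.+1%:R + level e t p)) @ \oo -->
  (if `|t| <= e then 2^-1 else 1 : R).
Proof.
move=> e0.
have lev0 p : 0 <= level e t p by rewrite /level exprM exprn_ge0// sqr_ge0.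
have p0 (p : nat) : 0 < p.+1%:R :> R by [].
have harm : (fun p => p.+1%:R^-1 : R) @ \oo --> (0 : R) by exact: cvg_harmonic.
case: ifPn => te.
  have lev1 p : level e t p <= 1.
    rewrite /level exprM exprn_ile1// ?sqr_ge0//.
    rewrite -real_normK ?num_real// expr_le1//.
    have ep : 0 < e + p.+1%:R^-1 by rewrite ltr_wpDl ?invr_gt0.
    rewrite normrM normfV (ger0_norm (ltW ep)) ler_pdivrMr// mul1r (le_trans te)//.
    by rewrite lerDl invr_ge0.
  apply: (@squeeze_cvgr _ _ _ _ (fun=> 2^-1) (fun p => 2^-1 + p.+1%:R^-1)).
  - apply: nearW => p; have := lev0 p; have := lev1 p; have := p0 p.
    set q := level _ _ _; set x : R := p.+1%:R => x0 q1 q0.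
    apply/andP; split; first by rewrite ler_pdivlMr ?ltr_wpDr ?mulr_gt0//; lra.
    rewrite ler_pdivrMr ?ltr_wpDr ?mulr_gt0//.
    have -> : (2^-1 + x^-1) * (2 * x + q) = x + q / 2 + 2 + q / x by field; rewrite gt_eqF.
    have : 0 <= q / x by rewrite divr_ge0// ltW.
    by move: (q / x) => y y0; clearbody q x; lra.
  - exact: cvg_cst.
  - by rewrite -[X in _ --> X]addr0; apply: cvgD => //; exact: cvg_cst.
rewrite -ltNge in te.
pose a := (`|t| - e) / (2 * (e + 1)).
have a0 : 0 < a by rewrite divr_gt0 ?subr_gt0// mulr_gt0// ltr_wpDl.
have lower : \forall p \near \oo, (p.+1%:R * a) ^+ 2 <= level e t p.
  have : \forall p \near \oo, p.+1%:R^-1 < (`|t| - e) / 2.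
    have := harm; move/cvgrPdist_lt => /(_ ((`|t| - e) / 2)).
    rewrite divr_gt0 ?subr_gt0// => /(_ isT).
    by apply: filterS => p; rewrite sub0r normrN ger0_norm// invr_ge0.
  apply: filterS => p hp.
  have ep : 0 < e + p.+1%:R^-1 by rewrite ltr_wpDl ?invr_gt0.
  have ep1 : e + p.+1%:R^-1 <= e + 1 by rewrite lerD2l invf_le1// ler1n.
  have base : 1 + a <= `|t| / (e + p.+1%:R^-1).
    rewrite ler_pdivlMr//.
    have : a * (e + p.+1%:R^-1) <= a * (e + 1) by rewrite ler_pM2l.
    have -> : a * (e + 1) = (`|t| - e) / 2 by rewrite /a; field; rewrite gt_eqF// ltr_wpDl.
    by move: (p.+1%:R^-1) hp => y hp; rewrite [_ * _ in X in _ -> X]mulrDl mul1r; lra.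
  have b0 : 0 <= `|t| / (e + p.+1%:R^-1) by rewrite divr_ge0// ltW.
  have a1 : 0 <= 1 + a by rewrite addr_ge0// ltW.
  have pa : p.+1%:R * a <= (`|t| / (e + p.+1%:R^-1)) ^+ p.+1.
    apply: (@le_trans _ _ ((1 + a) ^+ p.+1)); last by rewrite ler_pXn2r.
    elim: p.+1 => [|k IHk]; first by rewrite mul0r expr0.
    rewrite exprS mulrDl mul1r -natr1 mulrDl mul1r lerD// ler_peMr ?(ltW a0)//.
    by rewrite exprn_ege1// lerDl ltW.
  rewrite /level mulnC exprM -[leRHS]real_normK ?num_real// normrX normrM normfV.
  rewrite (ger0_norm (ltW ep)) ler_pXn2r// nnegrE; last exact: exprn_ge0.
  by rewrite mulr_ge0// ltW.
apply: (@squeeze_cvgr _ _ _ _ (fun p => 1 - p.+1%:R^-1 / a ^+ 2) (fun=> 1)).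
- near=> p.
  have hp : (p.+1%:R * a) ^+ 2 <= level e t p by near: p.
  have x0 := p0 p; set q := level _ _ _ in hp *; set x : R := p.+1%:R in x0 hp *.
  have q0 : 0 < q by apply: lt_le_trans hp; rewrite exprn_gt0// mulr_gt0.
  have den : 0 < 2 * x + q by clearbody q x; lra.
  apply/andP; split; last by rewrite ler_pdivrMr// mul1r; clearbody q x; lra.
  have -> : (x + q) / (2 * x + q) = 1 - x / (2 * x + q).
    by have dn0 := lt0r_neq0 den; clearbody q x; field.
  rewrite lerD2l lerN2 ler_pdivrMr//.
  have -> : x^-1 / a ^+ 2 * (2 * x + q) = 2 / a ^+ 2 + q / (x * a ^+ 2).
    by have x1 := lt0r_neq0 x0; have a1 := lt0r_neq0 a0; clearbody q x a; field; rewrite ?a1 ?x1.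
  have a2 : 0 <= 2 / a ^+ 2 by rewrite divr_ge0// sqr_ge0.
  apply: (@le_trans _ _ (q / (x * a ^+ 2))); last by rewrite lerDr.
  have xa : 0 < x * a ^+ 2 by rewrite mulr_gt0// exprn_gt0.
  by rewrite ler_pdivlMr// mulrA -expr2 -exprMn.
- rewrite -[X in _ --> X]subr0; apply: cvgB; first exact: cvg_cst.
  by rewrite -[X in _ --> X](mul0r (a ^+ 2)^-1); apply: cvgM => //; exact: cvg_cst.
- exact: cvg_cst.
Unshelve. all: by end_near. Qed.

Definition level_mx n (E e : R) (H : 'M[C]_n) p : 'M[C]_n :=
  mxpow (((e + p.+1%:R^-1)^-1)%:C%C *: (H + ((- E)%:C%C)%:M)) (2 * p.+1).

(** A real power stands for the inverse, with which it agrees on the nonnegative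
denominators that occur: powers are at hand as measurable functions. *)
Definition level_ratio n (E e : R) (H : 'M[C]_n) p : R :=
  complex.Re (\det (level_mx E e H p + ((p.+1%:R)%:C%C)%:M)) *
  complex.Re (\det (level_mx E e H p + ((2 * p.+1%:R)%:C%C)%:M)) `^ (-1).

(** Each eigenvalue contributes a factor tending to 1/2 or 1. *)
Lemma level_ratio_cvg n (H : 'M[C]_n) (E e : R) : selfadjoint H -> 0 <= e ->
  level_ratio E e H @ \oo --> (2^-1 : R) ^+ cnt H E e.
Proof.
move=> /selfadjoint_diagonalization[P [f [PP PP' ->]]] e0; rewrite cnt_card//.
have LE p : level_mx E e (P ^t* *m diag_mx (\row_i (f i)%:C%C) *m P) p =
    P ^t* *m diag_mx (\row_i (level e (f i - E) p)%:C%C) *m P.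
  rewrite /level_mx (_ : _ *: _ = P ^t* *m
      diag_mx (\row_i ((f i - E) / (e + p.+1%:R^-1))%:C%C) *m P) ?mxpow_diag//.
  rewrite (_ : diag_mx (\row_i ((f i - E) / (e + p.+1%:R^-1))%:C%C) =
     ((e + p.+1%:R^-1)^-1)%:C%C *: (diag_mx (\row_i (f i)%:C%C) + ((- E)%:C%C)%:M)).
    rewrite -scalemxAr -scalemxAl mulmxDr mulmxDl; congr (_ *: (_ + _)).
    by rewrite mul_mx_scalar -scalemxAl PP' scalemx1.
  apply/matrixP => i j; rewrite !mxE -mulrnDl -rmorphD mulrnAr; congr (_ *+ _).
  by rewrite mulrC rmorphM.
rewrite (_ : level_ratio E e _ = fun p => \prod_i ((p.+1%:R + level e (f i - E) p) /
    (2 * p.+1%:R + level e (f i - E) p))); last first.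
  apply/funext => p; rewrite /level_ratio LE !det_shift_diag//= powR_inv1 ?prodf_div//.
  apply: prodr_ge0 => i _; rewrite addr_ge0 ?mulr_ge0//.
  by rewrite /level exprM exprn_ge0// sqr_ge0.
rewrite (_ : _ ^+ _ = \prod_i (if `|f i - E| <= e then 2^-1 else 1)); last first.
  by rewrite -big_mkcond/= prodr_const.
apply: cvg_big => //; first exact: mul_continuous.
by move=> i _; exact: level_cvg.
Qed.

Lemma measurable_cnt_ge d (T : measurableType d) n (F : T -> 'M[C]_n) (E e : R) k :
  mxmeas F -> (forall t, selfadjoint (F t)) -> 0 <= e ->
  measurable [set t | (k <= cnt (F t) E e)%N].
Proof.
move=> mF hF e0.
have mg : measurable_fun setT (fun t => (2^-1 : R) ^+ cnt (F t) E e).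
  apply: (@measurable_fun_cvg _ _ _ _ (fun p t => level_ratio E e (F t) p)); last first.
    by move=> t _; exact: level_ratio_cvg.
  move=> p.
  have mL : mxmeas (fun t => level_mx E e (F t) p).
    by apply: mxmeas_pow; apply: mxmeasZ; apply: mxmeasD => //; exact: mxmeas_cst.
  have mdet c : measurable_fun setT (fun t =>
      complex.Re (\det (level_mx E e (F t) p + (c%:C%C)%:M))).
    by apply: (cmeas_det _).1; apply: mxmeasD => //; exact: mxmeas_cst.
  apply: measurable_funM; first exact: mdet.
  exact: (measurableT_comp (measurable_powR (-1)) (mdet _)).
rewrite (_ : [set t | _] = (fun t => (2^-1 : R) ^+ cnt (F t) E e) @^-1`
    `]-oo, (2^-1 ^+ k)]%classic); last first.
  apply/seteqP; split => t /=; rewrite in_itv/= ler_iXn2l ?invr_gt0 ?invf_lt1 ?ltr1n//.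
by rewrite -[X in measurable X]setTI; exact: mg.
Qed.

End counting_measurability.

(** * Small ball estimate for the pivot *)
Section pivot_small_ball.
Local Open Scope sesquilinear_scope.
Context {R : realType}.
Local Notation C := R[i].

Lemma measurable_set_ler d (T : measurableType d) (f g : T -> R) :
  measurable_fun setT f -> measurable_fun setT g -> measurable [set t | f t <= g t].
Proof.
move=> mf mg; have := measurable_fun_ler mf mg.
have m1 : measurable [set true] by [].
move=> /(_ measurableT _ m1); rewrite setTI.
by congr measurable; apply/seteqP; split => t.
Qed.

Lemma cmeas_real d (T : measurableType d) (f : T -> R) :
  measurable_fun setT f -> cmeas (fun t => (f t)%:C%C).
Proof. by move=> mf; split => //=; exact: measurable_cst. Qed.

Lemma mxmeas_ham S kap d (T : measurableType d) n (H0 : 'M[C]_n) (f : T -> rvec R (entries n)) :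
  (forall p, measurable_fun setT (fun t => f t p)) -> mxmeas (fun t => ham S kap H0 (f t)).
Proof.
move=> mf i j; apply: (eq_cmeas (fun t => esym (hamE _ _ _ _ _ _))).
apply: cmeasD; first exact: cmeas_cst.
split => /=; apply: measurable_funM => //.
  by apply: measurable_funD; exact: mf.
by apply: measurable_funB; exact: mf.
Qed.

Section schur_measurability.
Context d (T : measurableType d) n (F : T -> 'M[C]_(1 + n)) (E : R).
Hypothesis mF : mxmeas F.

Let mshift : mxmeas (fun t => drsubmx (F t) - (E%:C%C)%:M).
Proof.
apply: mxmeasD; last exact: mxmeas_cst.
by move=> i j; apply: eq_cmeas (mF (rshift 1 i) (rshift 1 j)) => t; rewrite !mxE.
Qed.

Lemma cmeas_schur_det : cmeas (fun t => schur_det (F t) E).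
Proof. exact: cmeas_det. Qed.

Lemma mxmeas_schur_vec : mxmeas (fun t => schur_vec (F t) E).
Proof.
apply: mxmeasM; first exact: mxmeas_adj.
by move=> i j; apply: eq_cmeas (mF (rshift 1 i) (lshift n j)) => t; rewrite !mxE.
Qed.

Lemma cmeas_schur_pivot : cmeas (fun t => schur_pivot (F t) E).
Proof.
apply: cmeasB; first apply: cmeasM.
- by apply: cmeasB; [exact: mF | exact: cmeas_cst].
- exact: cmeas_schur_det.
apply: mxmeasM; last exact: mxmeas_schur_vec.
by move=> i j; apply: eq_cmeas (mF (lshift n i) (rshift 1 j)) => t; rewrite !mxE.
Qed.

Lemma measurable_schur_weight : measurable_fun setT (fun t => schur_weight (F t) E).
Proof.
apply: measurable_funD; first exact: measurable_nsq cmeas_schur_det.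
by apply: measurable_sum => i; exact: measurable_nsq (mxmeas_schur_vec _ _).
Qed.

End schur_measurability.

Definition pivot_is_small n (E e : R) (H : 'M[C]_(1 + n)) : Prop :=
  nsq (schur_pivot H E) <= (4 * (1 + n)%:R) * e ^+ 2 * schur_weight H E.

Lemma measurable_pivot_is_small d (T : measurableType d) n (F : T -> 'M[C]_(1 + n)) (E e : R) :
  mxmeas F -> measurable [set t | pivot_is_small E e (F t)].
Proof.
move=> mF; apply: measurable_set_ler; first exact: measurable_nsq (cmeas_schur_pivot _ mF).
by apply: measurable_funM => //; exact: measurable_schur_weight.
Qed.

Lemma det_real n (M : 'M[C]_n) : M \is a realmx -> \det M \is Num.real.
Proof.
move=> /mxOverP rM; apply: rpred_sum => s _; rewrite rpredMsign.
by apply: rpred_prod => i _; exact: rM.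
Qed.

Lemma schur_vec_real n (H : 'M[C]_(1 + n)) E i : H \is a realmx ->
  complex.Im (schur_vec H E i 0) = 0.
Proof.
move=> /mxOverP rH; have : schur_vec H E i 0 \is Num.real.
  rewrite mxE; apply: rpred_sum => j _; apply: rpredM; last by rewrite !mxE; exact: rH.
  rewrite mxE rpredMsign.
  apply: det_real; apply/mxOverP => k l; rewrite !mxE rpredB//.
  by apply: rpredMn; rewrite complex_real.
by case/complex_realP => x ->.
Qed.

Lemma schur_det_real n (H : 'M[C]_(1 + n)) E : selfadjoint H -> complex.Im (schur_det H E) = 0.
Proof.
move=> hH; have : (schur_det H E)^* = schur_det H E.
  rewrite /schur_det -[RHS]det_tr -(det_map_mx (Num.conj : {rmorphism C -> C})).
  congr (\det _); apply/matrixP => i j; rewrite !mxE rmorphB rmorphMn/= [j == i]eq_sym.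
  by rewrite -[in LHS]hH !mxE conjCK; congr (_ - _ *+ _); exact: conjc_real.
by rewrite /schur_det; case: (\det _) => a b [] /eqP; rewrite eq_sym -addr_eq0 -mulr2n mulrn_eq0/= => /eqP.
Qed.

Lemma schur_vec_adjoint n (H : 'M[C]_(1 + n)) E : selfadjoint H ->
  (schur_vec H E) ^t* = ursubmx H *m \adj (drsubmx H - (E%:C%C)%:M).
Proof.
move=> hH; rewrite /schur_vec trmx_mul map_mxM trmx_adj map_mx_adj; congr (_ *m \adj _).
  by apply/matrixP => i j; rewrite !mxE -[in RHS]hH !mxE.
apply/matrixP => i j; rewrite !mxE rmorphB rmorphMn/= [j == i]eq_sym.
by rewrite -[in RHS]hH !mxE; congr (_ - _ *+ _); exact: conjc_real.
Qed.

Lemma sum_entries_split n (u : entries (1 + n) -> R) :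
  \sum_p u p = \sum_(b : bool) (u (0, 0, b) + \sum_j u (0, rshift 1 j, b) +
    \sum_i (u (rshift 1 i, 0, b) + \sum_j u (rshift 1 i, rshift 1 j, b))).
Proof.
transitivity (\sum_p \sum_b u (p, b)); first by rewrite pair_big; apply: eq_bigr => -[].
rewrite exchange_big; apply: eq_bigr => b _.
transitivity (\sum_i \sum_j u (i, j, b)); first by rewrite pair_big; apply: eq_bigr => -[].
have l0 : lshift n (0 : 'I_1) = 0 by apply/val_inj.
rewrite big_split_ord/= big_ord1 l0 big_split_ord/= big_ord1 l0; congr (_ + _).
by apply: eq_bigr => i _; rewrite big_split_ord/= big_ord1 l0.
Qed.

End pivot_small_ball.

Section sesquilinear_form.
Local Open Scope sesquilinear_scope.
Context {R : realType} (n : nat).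
Local Notation C := R[i].
Implicit Types (M : 'M[C]_n) (u v w : 'rV[C]_n).

Definition sesq M u v : C := (u *m M *m v ^t*) 0 0.

Lemma sesqDl M u v w : sesq M (u + v) w = sesq M u w + sesq M v w.
Proof. by rewrite /sesq !mulmxDl mxE. Qed.

Lemma sesqZl M c u w : sesq M (c *: u) w = c * sesq M u w.
Proof. by rewrite /sesq -!scalemxAl mxE. Qed.

Lemma sesqDr M w u v : sesq M w (u + v) = sesq M w u + sesq M w v.
Proof.
rewrite /sesq (_ : (u + v) ^t* = u ^t* + v ^t*) ?mulmxDr ?mxE//.
by apply/matrixP => i j; rewrite !mxE rmorphD.
Qed.

Lemma sesqZr M (a : R) w u : sesq M w (a%:C%C *: u) = a%:C%C * sesq M w u.
Proof.
rewrite /sesq (_ : (a%:C%C *: u) ^t* = a%:C%C *: u ^t*) -?scalemxAr ?mxE//.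
by apply/matrixP => i j; rewrite !mxE rmorphM/=; congr (_ * _); exact: conjc_real.
Qed.

End sesquilinear_form.

Section border.
Local Open Scope sesquilinear_scope.
Local Open Scope ereal_scope.
Context {R : realType} (S : bool) (kap tau : R) (n : nat).
Local Notation C := R[i].
Local Notation ham := (ham S kap).
Hypothesis (kap0 : (0 < kap)%R) (tau0 : (0 < tau)%R).
Implicit Types (x : rvec R (entries n)) (y z : rvec R (entries (1 + n))).

Definition minor_of (p : entries (1 + n)) : option (entries n) :=
  [pick q | p == minor_entry q].

Lemma minor_ofE p q : (minor_of p == Some q) = (p == minor_entry q).
Proof.
rewrite /minor_of; case: pickP => [q' /eqP ->|-> //].
by rewrite (inj_eq (@minor_entry_inj n)).
Qed.

Lemma overwrite_minor x z q : overwrite minor_of (x, z) (minor_entry q) = x q.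
Proof. by rewrite /overwrite (_ : minor_of _ = Some q)//; apply/eqP; rewrite minor_ofE. Qed.

Lemma overwrite_border x z p : (p.1.1 == 0%R) || (p.1.2 == 0%R) ->
  overwrite minor_of (x, z) p = z p.
Proof.
move=> p0; rewrite /overwrite; case E: (minor_of p) => [q|//].
by move/eqP: E p0; rewrite minor_ofE => /eqP ->.
Qed.

Lemma overwrite_borderl x z j b : overwrite minor_of (x, z) (0%R, j, b) = z (0%R, j, b).
Proof. by rewrite overwrite_border//= eqxx. Qed.

Lemma overwrite_borderr x z i b : overwrite minor_of (x, z) (i, 0%R, b) = z (i, 0%R, b).
Proof. by rewrite overwrite_border//= eqxx orbT. Qed.

Definition border_row z : 'rV[C]_n := (\row_j
  (((kap * (z (0, rshift 1 j, false) + z (rshift 1 j, 0, false))) +i*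
    (kap * S%:R * (z (0, rshift 1 j, true) - z (rshift 1 j, 0, true))))%C))%R.

Lemma border_row_comb2 a b z y : (border_row (comb2 a b z y) =
  a%:C%C *: border_row z + b%:C%C *: border_row y)%R.
Proof.
apply/rowP => j; rewrite !mxE /comb2; apply/eqP; rewrite eq_complex/=.
by apply/andP; split; apply/eqP; ring.
Qed.

Variables (H0 : 'M[C]_(1 + n)) (E : R) (x : rvec R (entries n)).
Hypothesis aH : admissible S H0.

Local Notation H z := (ham H0 (overwrite minor_of (x, z))).
Local Notation r0 := (ursubmx H0).
Let B : 'M[C]_n := ham (drsubmx H0) x.
Let d : C := (\det (B - (E%:C%C)%:M))%R.
Let M : 'M[C]_n := (\adj (B - (E%:C%C)%:M))%R.

Let drH z : drsubmx (H z) = B.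
Proof. by rewrite drsubmx_ham; congr ham; apply/funext => q; exact: overwrite_minor. Qed.

Let urH z : ursubmx (H z) = (r0 + border_row z)%R.
Proof.
apply/rowP => j; have l0 : lshift n (0%R : 'I_1) = 0%R by apply/val_inj.
rewrite mxE mxE hamE l0 !overwrite_borderl !overwrite_borderr [RHS]mxE.
by rewrite [X in _ = (X + _)%R]mxE [X in _ = (X + _)%R]mxE l0 [X in _ = (_ + X)%R]mxE.
Qed.

Let dlH z : dlsubmx (H z) = ((r0 + border_row z) ^t*)%R.
Proof.
rewrite -urH; have hH := ham_selfadjoint S kap (overwrite minor_of (x, z)) aH.1.
move: (H z) hH => G hG; apply/matrixP => i j.
by rewrite -[in LHS]hG !mxE.
Qed.

(** The pivot as a polynomial in the border z, the minor being fixed. *)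
Definition pivot_const : C := ((H0 0 0 - E%:C%C) * d - sesq M r0 r0)%R.
Definition pivot_linear z : C := ((2 * kap * z (0, 0, false))%:C%C * d -
  (sesq M (border_row z) r0 + sesq M r0 (border_row z)))%R.
Definition pivot_bilinear z y : C := (- sesq M (border_row z) (border_row y))%R.

Lemma pivot_quad z :
  schur_pivot (H z) E = quad pivot_const pivot_linear pivot_bilinear z.
Proof.
rewrite /schur_pivot /schur_vec /schur_det drH urH dlH -/d -/M hamE.
rewrite !overwrite_borderl mulmxA -/(sesq M _ _) !sesqDl !sesqDr.
have -> : ((kap * (z (0, 0, false) + z (0, 0, false)) +i*
   (kap * S%:R * (z (0, 0, true) - z (0, 0, true))))%C = (2 * kap * z (0, 0, false))%:C%C)%R.
  by apply/eqP; rewrite eq_complex/=; apply/andP; split; apply/eqP; ring.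
rewrite /quad /pivot_const /pivot_linear /pivot_bilinear; clearbody M d; ring.
Qed.

Lemma pivot_dquad z y : (dquad pivot_linear pivot_bilinear z y =
  (2 * kap * y (0, 0, false))%:C%C * d - ((border_row y *m schur_vec (H z) E) 0 0 +
   ((border_row y *m schur_vec (H z) E) 0 0)^*))%R.
Proof.
have conjE : ((((border_row y *m schur_vec (H z) E) 0 0)^*) =
    ((r0 + border_row z) *m M *m (border_row y) ^t*) 0 0)%R.
  transitivity ((((border_row y *m schur_vec (H z) E) ^t*) 0 0)%R); first by rewrite !mxE.
  rewrite trmx_mul map_mxM schur_vec_adjoint ?drH ?urH//.
  exact: ham_selfadjoint aH.1.
rewrite conjE /schur_vec drH dlH -/M mulmxA -/(sesq M _ _) -/(sesq M _ _) sesqDl sesqDr.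
by rewrite /dquad /pivot_linear /pivot_bilinear; clearbody M d; ring.
Qed.

(** Coefficients of the real linear form y |-> Re (DF(z) y). In the first row and
column the real coordinates have the sensitivity - 2 kap Re b_j and the imaginary
ones +- 2 kap Im b_j; those of the minor do not act. *)
Definition pivot_gradient (b : 'cV[C]_n) (p : entries (1 + n)) : R :=
  (block_mx ((~~ p.2)%:R * (2 * kap * complex.Re d))%:M
    (\row_j (if p.2 then 2 * kap * S%:R * complex.Im (b j 0) else - (2 * kap * complex.Re (b j 0))))
    (\col_j (if p.2 then - (2 * kap * S%:R * complex.Im (b j 0))
             else - (2 * kap * complex.Re (b j 0))))
    (0 : 'M[R]_n) p.1.1 p.1.2)%R.

Lemma dotv_pivot_gradient b (y : entries (1 + n) -> R) : (dotv (pivot_gradient b) y =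
  2 * kap * complex.Re d * y (0, 0, false) + \sum_j (
    2 * kap * S%:R * complex.Im (b j 0) * (y (0, rshift 1 j, true) - y (rshift 1 j, 0, true))
    - 2 * kap * complex.Re (b j 0) * (y (0, rshift 1 j, false) + y (rshift 1 j, 0, false))))%R.
Proof.
have l0 : (0 : 'I_(1 + n))%R = lshift n (0%R : 'I_1) by apply/val_inj.
rewrite /dotv sum_entries_split big_bool/= /pivot_gradient/=.
rewrite [in LHS]l0 !block_mxEul.
under eq_bigr do rewrite block_mxEur mxE.
under [X in (_ + _ + X + _)%R]eq_bigr do
  (rewrite block_mxEdl mxE big1; last by move=> k _; rewrite block_mxEdr mxE mul0r).
under [X in (_ + (_ + X + _))%R]eq_bigr do rewrite block_mxEur mxE.
under [X in (_ + (_ + X))%R]eq_bigr do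
  (rewrite block_mxEdl mxE big1; last by move=> k _; rewrite block_mxEdr mxE mul0r).
rewrite !mxE/= !mulr1n mul0r mul0r add0r mul1r addrCA -!addrA -!l0; congr (_ + _)%R.
by rewrite -!big_split/=; apply: eq_bigr => j _; ring.
Qed.

Lemma Re_pivot_dquad z y : complex.Re (dquad pivot_linear pivot_bilinear z y) =
  dotv (pivot_gradient (schur_vec (H z) E)) y.
Proof.
rewrite pivot_dquad dotv_pivot_gradient; set b := schur_vec _ _.
have -> : (complex.Re ((2 * kap * y (0, 0, false))%:C%C * d -
    ((border_row y *m b) 0 0 + ((border_row y *m b) 0 0)^*)) =
    2 * kap * complex.Re d * y (0, 0, false) - 2 * complex.Re ((border_row y *m b) 0 0))%R.
  by case: d ((border_row y *m b) 0 0)%R => [? ?] [? ?] /=; ring.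
congr (_ + _)%R; rewrite mxE (raddf_sum (@complex.Re R : {additive Rcomplex R -> R}))/=.
rewrite mulr_sumr -sumrN; apply: eq_bigr => j _; rewrite mxE; case: (b j 0%R) => b1 b2 /=.
by ring.
Qed.

Lemma pivot_gradient_norm z : (4 * kap ^+ 2 * schur_weight (H z) E <=
  dotv (pivot_gradient (schur_vec (H z) E)) (pivot_gradient (schur_vec (H z) E)))%R.
Proof.
have l0 : (0 : 'I_(1 + n))%R = lshift n (0%R : 'I_1) by apply/val_inj.
have hH := ham_selfadjoint S kap (overwrite minor_of (x, z)) aH.1.
have d0 := schur_det_real E hH.
rewrite dotv_pivot_gradient /schur_weight; set b := schur_vec _ _.
have dE : schur_det (H z) E = d by rewrite /schur_det drH.
rewrite dE in d0 *; rewrite mulrDr lerD//.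
  rewrite /pivot_gradient/= l0 block_mxEul mxE/= mulr1n mul1r /nsq d0 expr0n/= addr0.
  by rewrite le_eqVlt; apply/orP; left; apply/eqP; ring.
rewrite mulr_sumr; apply: ler_sum => j _.
have b0 : ~~ S -> complex.Im (b j 0%R) = 0%R.
  by move=> nS; apply: schur_vec_real; exact: ham_real.
clearbody b; rewrite /pivot_gradient/= l0 !block_mxEur !block_mxEdl !mxE /nsq.
case: S b0 => [_|/(_ isT) ->] /=.
  have := sqr_ge0 (kap * complex.Re (b j 0%R)); have := sqr_ge0 (kap * complex.Im (b j 0%R)).
  by rewrite !exprMn; nra.
by have := sqr_ge0 (kap * complex.Re (b j 0%R)); rewrite !exprMn; nra.
Qed.

Let pivot_linear_comb2 a b z y : (pivot_linear (comb2 a b z y) =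
  a%:C%C * pivot_linear z + b%:C%C * pivot_linear y)%R.
Proof.
rewrite /pivot_linear; clearbody M d.
have -> : ((2 * kap * comb2 a b z y (0, 0, false))%:C%C =
    a%:C%C * (2 * kap * z (0, 0, false))%:C%C + b%:C%C * (2 * kap * y (0, 0, false))%:C%C)%R.
  by rewrite /comb2; apply/eqP; rewrite eq_complex/=; apply/andP; split; apply/eqP; ring.
by rewrite border_row_comb2 sesqDl sesqDr !sesqZl !sesqZr; ring.
Qed.

Let pivot_bilinear_combl a b z y w : (pivot_bilinear (comb2 a b z y) w =
  a%:C%C * pivot_bilinear z w + b%:C%C * pivot_bilinear y w)%R.
Proof.
by rewrite /pivot_bilinear border_row_comb2 sesqDl !sesqZl opprD !mulrN.
Qed.

Let pivot_bilinear_combr a b z y w : (pivot_bilinear w (comb2 a b z y) =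
  a%:C%C * pivot_bilinear w z + b%:C%C * pivot_bilinear w y)%R.
Proof.
by rewrite /pivot_bilinear border_row_comb2 sesqDr !sesqZr opprD !mulrN.
Qed.

Let mxmeas_border d' (T : measurableType d') (f : T -> rvec R (entries (1 + n))) :
  (forall p, measurable_fun setT (fun t => f t p)) -> mxmeas (fun t => H (f t)).
Proof.
move=> mf; apply: mxmeas_ham => p; rewrite /overwrite/=.
by case: (minor_of p) => [q|]; [exact: measurable_cst | exact: mf].
Qed.

Let rpair := (rvec R (entries (1 + n)) * rvec R (entries (1 + n)))%type.

Let mfst p : measurable_fun setT (fun t : rpair => t.1 p).
Proof. exact: (measurableT_comp (measurable_coord p) measurable_fst). Qed.

Let msnd p : measurable_fun setT (fun t : rpair => t.2 p).
Proof. exact: (measurableT_comp (measurable_coord p) measurable_snd). Qed.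

Let cmeas_quad : cmeas (fun t : rpair => quad pivot_const pivot_linear pivot_bilinear t.1).
Proof.
apply: (eq_cmeas (fun t => pivot_quad t.1)).
by apply: cmeas_schur_pivot; exact: mxmeas_border.
Qed.

Let cmeas_dquad : cmeas (fun t : rpair => dquad pivot_linear pivot_bilinear t.1 t.2).
Proof.
apply: (eq_cmeas (fun t => esym (pivot_dquad t.1 t.2))).
have mX : cmeas (fun t : rpair => (border_row t.2 *m schur_vec (H t.1) E) 0 0)%R.
  apply: mxmeasM; last by apply: mxmeas_schur_vec; exact: mxmeas_border.
  move=> i j; split.
    apply: (eq_measurable_fun (fun t : rpair =>
      kap * (t.2 (0, rshift 1 j, false) + t.2 (rshift 1 j, 0, false)))%R).
      by move=> t _; rewrite !mxE.
    by apply: measurable_funM => //; apply: measurable_funD; exact: msnd.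
  apply: (eq_measurable_fun (fun t : rpair =>
    kap * S%:R * (t.2 (0, rshift 1 j, true) - t.2 (rshift 1 j, 0, true)))%R).
    by move=> t _; rewrite !mxE.
  by apply: measurable_funM => //; apply: measurable_funB; exact: msnd.
apply: cmeasB.
  apply: cmeasM; last exact: cmeas_cst.
  by apply: cmeas_real; apply: measurable_funM => //; exact: msnd.
apply: cmeasD => //; case: mX => mRe mIm; split.
  apply: (eq_measurable_fun _ _ mRe) => t _ /=.
  by case: ((_ *m _) 0 0)%R.
apply: (eq_measurable_fun _ _ (measurable_funN mIm)) => t _ /=.
by case: ((_ *m _) 0 0)%R.
Qed.

(** [quad_small_ball] with delta = 2 sqrt N e / (tau kap). *)
Lemma pivot_small_ball (N : nat) (e : R) : (0 <= e)%R -> (1 + n <= N)%N -> d != 0%R ->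
  gauss tau (entries (1 + n)) [set z | pivot_is_small E e (H z)] <=
  (512 * Num.sqrt N%:R * e / (tau * kap))%:E.
Proof.
move=> e0 nN dn0; set delta := (2 * Num.sqrt N%:R * e / (tau * kap))%R.
have -> : (512 * Num.sqrt N%:R * e / (tau * kap) = 256 * delta)%R by rewrite /delta; ring.
have delta0 : (0 <= delta)%R.
  rewrite /delta divr_ge0//; last by rewrite ltW// mulr_gt0.
  by rewrite mulr_ge0// mulr_ge0// sqrtr_ge0.
have -> : [set z | pivot_is_small E e (H z)] =
    [set z | (nsq (quad pivot_const pivot_linear pivot_bilinear z) <=
      (4 * (1 + n)%:R) * e ^+ 2 * schur_weight (H z) E)%R].
  by apply/seteqP; split => z /=; rewrite /pivot_is_small pivot_quad.
have mHid : mxmeas (fun z : rvec R (entries (1 + n)) => H z).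
  by apply: (mxmeas_border (f := id)) => p; exact: measurable_coord.
apply: quad_small_ball => //.
- set f := (fun t : rpair => quad pivot_const pivot_linear pivot_bilinear t.1).
  set g := (fun t : rpair => dquad pivot_linear pivot_bilinear t.1 t.2).
  rewrite (_ : [set p | _] = [set t | (nsq (f t) <= delta ^+ 2 * nsq (g t))%R] `&`
      ~` [set t | (nsq (g t) <= 0)%R]).
    apply: measurableI.
      apply: measurable_set_ler; first exact: measurable_nsq.
      by apply: measurable_funM => //; exact: measurable_nsq.
    by apply: measurableC; apply: measurable_set_ler => //; exact: measurable_nsq.
  apply/seteqP; split => t /= [h1]; last first.
    move=> h2; split => //; apply/eqP => g0; apply: h2.
    by rewrite /g g0 /nsq/= expr0n/= addr0.
  by move=> h2; split => // h3; move/negP: h2; apply; rewrite -nsq_eq0 eq_le h3 nsq_ge0.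
- rewrite (_ : [set z | _] = [set z | pivot_is_small E e (H z)]).
    exact: measurable_pivot_is_small.
  by apply/seteqP; split => z /=; rewrite /pivot_is_small pivot_quad.
- move=> z; exists (pivot_gradient (schur_vec (H z) E)).
  have gn := pivot_gradient_norm z.
  have Wd : (nsq d <= schur_weight (H z) E)%R.
    rewrite /schur_weight /schur_det drH lerDl; apply: sumr_ge0 => i _; exact: nsq_ge0.
  have dp : (0 < nsq d)%R by rewrite lt_def nsq_ge0 nsq_eq0 dn0.
  have W0 : (0 < schur_weight (H z) E)%R by exact: lt_le_trans Wd.
  split; first exact: Re_pivot_dquad.
    by apply: lt_le_trans gn; rewrite mulr_gt0// mulr_gt0// exprn_gt0.
  apply: (@le_trans _ _ (delta ^+ 2 * ((tau / 2) ^+ 2 * (4 * kap ^+ 2 * schur_weight (H z) E))))%R.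
    have -> : (delta ^+ 2 * ((tau / 2) ^+ 2 * (4 * kap ^+ 2 * schur_weight (H z) E)) =
        4 * Num.sqrt N%:R ^+ 2 * e ^+ 2 * schur_weight (H z) E)%R.
      rewrite /delta; field; rewrite !gt_eqF//.
    rewrite sqr_sqrtr ?ler0n// ler_wpM2r ?(ltW W0)// ler_wpM2r ?sqr_ge0// ler_wpM2l//.
    by rewrite ler_nat.
  by rewrite ler_wpM2l ?sqr_ge0// ler_wpM2l ?sqr_ge0.
Qed.

End border.

(** * Cutting windows into pieces *)
Section splitting.
Local Open Scope sesquilinear_scope.
Context {R : realType}.
Local Notation C := R[i].

Lemma cnt_le_dim n (H : 'M[C]_n) (E e : R) : selfadjoint H -> (cnt H E e <= n)%N.
Proof.
move=> /selfadjoint_diagonalization[P [f [PP PP' ->]]].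
by rewrite cnt_card// (leq_trans (max_card _))// card_ord.
Qed.

Lemma exists_piece (t h : R) m : (0 < m)%N -> 0 <= t <= 2 * m%:R * h ->
  exists2 i : 'I_m, 0 <= t - 2 * i%:R * h & t - 2 * i%:R * h <= 2 * h.
Proof.
move=> m0 /andP[t0 tm].
have ex : exists i, t <= 2 * i.+1%:R * h by exists m.-1; rewrite prednK.
case: (ex_minnP ex) => i ti imin.
have im : (i < m)%N by rewrite -(prednK m0) ltnS imin// prednK.
exists (Ordinal im) => /=; last by move: ti; rewrite -natr1; lra.
rewrite subr_ge0; case: i ti imin {im} => [|i] ti imin; first by rewrite mulr0 mul0r.
rewrite leNgt; apply/negP => /ltW /imin; by rewrite ltnn.
Qed.

Definition piece_centre (E e : R) m i : R := E - e + (2 * i%:R + 1) * (e / m%:R).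

Lemma cnt_split n (H : 'M[C]_n) (E e : R) m : selfadjoint H -> 0 <= e -> (0 < m)%N ->
  (cnt H E e <= \sum_(i < m) cnt H (piece_centre E e m i) (e / m%:R))%N.
Proof.
move=> /selfadjoint_diagonalization[P [f [PP PP' ->]]] e0 m0; rewrite cnt_card//.
under eq_bigr do rewrite cnt_card// -sum1_card big_mkcond.
rewrite exchange_big/= -sum1_card big_mkcond; apply: leq_sum => j _.
case: ifP => // jE.
have m_neq0 : m%:R != 0 :> R by rewrite pnatr_eq0 -lt0n.
have [|i i1 i2] := @exists_piece (f j - E + e) (e / m%:R) m m0.
  by move: jE; rewrite inE ler_norml -mulrA [(m%:R * _)%R]mulrC divfK//; lra.
rewrite (bigD1 i)//= ifT// inE ler_norml /piece_centre.
by move: i1 i2; move: (e / m%:R) => h; lra.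
Qed.

Lemma measurable_cnt d (T : measurableType d) n (F : T -> 'M[C]_n) (E e : R) (phi : nat -> R) :
  mxmeas F -> (forall t, selfadjoint (F t)) -> 0 <= e ->
  measurable_fun setT (fun t => phi (cnt (F t) E e)).
Proof.
move=> mF hF e0.
have ge k : measurable [set t | (k <= cnt (F t) E e)%N] by exact: measurable_cnt_ge.
(* counts are bounded by n, so that phi is a finite combination of indicators *)
pose at_ k := [set t | (k <= cnt (F t) E e)%N] `\` [set t | (k.+1 <= cnt (F t) E e)%N].
apply: (eq_measurable_fun (fun t => \sum_(k < n.+1) phi k * \1_(at_ k) t)) => [t _|].
  have cn : (cnt (F t) E e < n.+1)%N by rewrite ltnS cnt_le_dim.
  rewrite (bigD1 (Ordinal cn))//= indicE mem_set ?mulr1; last first.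
    by split => //=; rewrite ltnn.
  rewrite big1 ?addr0// => k kc; rewrite indicE memNset ?mulr0// => -[/= h1 /negP].
  rewrite -leqNgt => h2; case/negP: kc; apply/eqP/val_inj => /=.
  by apply/eqP; rewrite eqn_leq h1 h2.
apply: measurable_sum => k; apply: measurable_funM => //.
by apply: measurable_indic; exact: measurableD.
Qed.

End splitting.

(** * The cost of one eigenvalue *)
Section one_eigenvalue.
Local Open Scope sesquilinear_scope.
Local Open Scope ereal_scope.
Context {R : realType} (S : bool) (kap tau : R) (N : nat).
Local Notation C := R[i].
Local Notation ham := (ham S kap).
Local Notation gauss n := (gauss tau (entries n)).
Hypothesis (kap0 : (0 < kap)%R) (tau0 : (0 < tau)%R).

Lemma small_ball_const_ge0 (e : R) : (0 <= e)%R ->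
  (0 <= 512 * Num.sqrt N%:R * e / (tau * kap))%R.
Proof.
move=> e0; apply: divr_ge0; last by apply: ltW; exact: mulr_gt0.
apply: mulr_ge0; last by [].
by apply: mulr_ge0; [exact: (ler0n R 512) | exact: sqrtr_ge0].
Qed.

Lemma cnt_gt0_singular n (M : 'M[C]_n) (E : R) : selfadjoint M ->
  (\det (M - (E%:C%C)%:M) = 0)%R -> (0 < cnt M E 0)%N.
Proof.
move=> /selfadjoint_diagonalization[P [f [PP PP' ->]]].
have -> : (- (E%:C%C)%:M = ((- E)%:C%C)%:M :> 'M[C]_n)%R.
  by rewrite rmorphN/= raddfN.
rewrite det_shift_diag// cnt_card// => /complexI/eqP.
rewrite prodf_seq_eq0 => /hasP[i _ /= fi]; apply/card_gt0P; exists i.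
by rewrite inE normr_le0 addrC.
Qed.

Variables (n : nat) (E e : R).
Hypotheses (e0 : (0 <= e)%R) (nN : (1 + n <= N)%N).
(** Where det (B - E) vanishes the pivot carries no information; the induction
hypothesis, applied to the window of half width 0, makes this negligible. *)
Hypothesis minor_null : forall H1 : 'M[C]_n, admissible S H1 ->
  gauss n [set x | (0 < cnt (ham H1 x) E 0)%N] = 0.

Local Notation small H1 := [set y | pivot_is_small E e (ham H1 y)].

Let measurable_small (H1 : 'M[C]_(1 + n)) : measurable (small H1 : set (rvec R (entries (1 + n)))).
Proof.
by apply: measurable_pivot_is_small; apply: mxmeas_ham => p; exact: measurable_coord.
Qed.

Let minor_coords (y : rvec R (entries (1 + n))) : rvec R (entries n) :=
  fun q => y (minor_entry q).

Let measurable_minor_coords : measurable_fun setT minor_coords.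
Proof. by apply: measurable_to_rvec => q; exact: measurable_coord. Qed.

Let c : R := (512 * Num.sqrt N%:R * e / (tau * kap))%R.

Let c_ge0 : (0 <= c)%R.
Proof.
exact: small_ball_const_ge0.
Qed.

(** Fubini in the minor and the border, with [pivot_small_ball] on the inside. *)
Lemma integral_pivot_is_small (H1 : 'M[C]_(1 + n)) (G : rvec R (entries n) -> R) :
  admissible S H1 -> measurable_fun setT G -> (forall x, (0 <= G x)%R) ->
  \int[gauss (1 + n)]_y (\1_(small H1) y * G (minor_coords y))%:E <=
  c%:E * \int[gauss n]_x (G x)%:E.
Proof.
move=> aH mG G0.
pose f (y : rvec R (entries (1 + n))) : \bar R := (\1_(small H1) y * G (minor_coords y))%:E.
have mf : measurable_fun setT f.
  apply/measurable_EFinP; apply: measurable_funM; first exact: measurable_indic.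
  exact: measurableT_comp.
have f0 y : 0 <= f y by rewrite lee_fin mulr_ge0.
rewrite (ge0_integral_overwrite tau (@minor_ofE n) mf f0).
have mfo : measurable_fun setT (f \o overwrite (@minor_of n)).
  by apply: measurableT_comp => //; exact: measurable_overwrite.
have -> : c%:E * \int[gauss n]_x (G x)%:E = \int[gauss n]_x (c%:E * (G x)%:E).
  apply/esym; apply: ge0_integralZl_EFin => //; last exact/measurable_EFinP.
  by move=> x _; rewrite lee_fin.
apply: ae_ge0_le_integral => //.
- by move=> x _; apply: integral_ge0.
- apply: (measurable_fun_fubini_tonelli_F (f \o overwrite (@minor_of n))) => //.
  by move=> p; exact: f0.
- by move=> x _; rewrite mule_ge0 ?lee_fin.
- by apply: measurable_funeM; exact/measurable_EFinP.
pose B x := (ham (drsubmx H1) x - (E%:C%C)%:M)%R.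
exists [set x | (0 < cnt (ham (drsubmx H1) x) E 0)%N]; split.
- apply: measurable_cnt_ge => //; first by apply: mxmeas_ham => p; exact: measurable_coord.
  by move=> x; exact: ham_selfadjoint (admissible_drsubmx aH).1.
- exact/minor_null/admissible_drsubmx.
move=> x /= nle; apply: contrapT => nc; apply: nle => _.
have Bn0 : (\det (B x) != 0)%R.
  apply/eqP => B0; apply: nc; apply: cnt_gt0_singular => //.
  exact: ham_selfadjoint (admissible_drsubmx aH).1.
pose Sx := [set z | pivot_is_small E e (ham H1 (overwrite (@minor_of n) (x, z)))].
have mSx : measurable (Sx : set (rvec R (entries (1 + n)))).
  apply: measurable_pivot_is_small; apply: mxmeas_ham => p; rewrite /overwrite/=.
  by case: (minor_of p) => [q|]; [exact: measurable_cst | exact: measurable_coord].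
have -> : \int[gauss (1 + n)]_z f (overwrite (@minor_of n) (x, z)) =
    \int[gauss (1 + n)]_z ((G x)%:E * (\1_Sx z)%:E).
  apply: eq_integral => z _; rewrite /f /minor_coords.
  have -> : (fun q => overwrite (@minor_of n) (x, z) (minor_entry q)) = x.
    by apply/funext => q; exact: overwrite_minor.
  by rewrite -EFinM mulrC.
rewrite ge0_integralZl_EFin//; last exact/measurable_EFinP/measurable_indic.
rewrite integral_indic// setIT muleC lee_wpmul2r ?lee_fin//.
exact: (pivot_small_ball kap0 tau0).
Qed.

(** If a window contains an eigenvalue, a tenth of the rotated matrices have a
small pivot. The function F must be dominated by a function of the minor of each
rotated matrix, as functions of the spectrum are by interlacing. *)
Lemma one_eigenvalue_cost (H0 : 'M[C]_(1 + n)) (F : rvec R (entries (1 + n)) -> R) (r : \bar R) :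
  admissible S H0 -> measurable_fun setT F -> (forall x, (0 <= F x)%R) ->
  (forall O : 'M[R]_(1 + n), (O *m O^T = 1%:M)%R -> exists G : rvec R (entries n) -> R,
    [/\ measurable_fun setT G, forall x, (0 <= G x)%R, \int[gauss n]_x (G x)%:E <= r &
      forall x, (F x <= G (fun q => rotate_entries O x (minor_entry q)))%R]) ->
  \int[gauss (1 + n)]_x ((0 < cnt (ham H0 x) E e)%:R * F x)%:E <=
  (10 * c)%:E * r.
Proof.
move=> aH mF F0 FG.
pose signs := {ffun 'I_(1 + n) -> bool}.
have [Q QP] := choice (@exists_sign_rotation R n).
have OO g : (Q g *m (Q g)^T = 1%:M)%R by case: (QP g).
have [G GP] := choice (fun g => FG _ (OO g)).
have mG g : measurable_fun setT (G g) by case: (GP g).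
have G0 g x : (0 <= G g x)%R by case: (GP g).
have Gr g : \int[gauss n]_x (G g x)%:E <= r by case: (GP g).
have FGg g x : (F x <= G g (minor_coords (rotate_entries (Q g) x)))%R by case: (GP g).
pose Hg g := rotmx (Q g) H0.
have aHg g : admissible S (Hg g) by exact: admissible_rotmx.
pose f g y : R := (\1_(small (Hg g)) y * G g (minor_coords y))%R.
have f0 g y : (0 <= f g y)%R by rewrite mulr_ge0.
have mf g : measurable_fun setT (f g).
  apply: measurable_funM; first exact: measurable_indic.
  exact: measurableT_comp.
have mrot g : measurable_fun setT (rotate_entries (Q g)).
  exact: isometry_measurable (rotate_entries_isometry (OO g)).
pose m : R := #|{: signs}|%:R%R.
have m0 : (0 < m)%R by rewrite ltr0n; apply/card_gt0P; exists [ffun=> false].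
have ptw x : ((0 < cnt (ham H0 x) E e)%:R * F x <=
    10 / m * \sum_(g : signs) f g (rotate_entries (Q g) x))%R.
  have rhs0 : (0 <= 10 / m * \sum_(g : signs) f g (rotate_entries (Q g) x))%R.
    by rewrite mulr_ge0 ?divr_ge0 ?(ltW m0)// sumr_ge0.
  case: ltnP => [cp|_]; last by rewrite mul0r.
  have hH := ham_selfadjoint S kap x aH.1.
  (* a quasi-mode subject to no linear constraint *)
  have [v [v0 _ vle]] := cnt_test_space (0 : 'M[C]_(1 + n, 0))%R hH cp.
  have sg := signed_sumC_anticoncentration v.
  rewrite mul1r -(ler_pM2l m0) mulrA mulrCA divff ?gt_eqF// mulr1.
  apply: (@le_trans _ _ (10 * (\sum_(g : signs)
    (sqnorm v <= 4 * nsq (\sum_i v 0 i * ((-1) ^+ g i)%:C%C))%R)%:R * F x)%R).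
    by rewrite ler_wpM2r.
  rewrite -mulrA ler_wpM2l// natr_sum mulr_suml; apply: ler_sum => g _.
  case: (leP (sqnorm v)) => hg; last by rewrite mul0r.
  rewrite mul1r /f; suff : small (Hg g) (rotate_entries (Q g) x).
    by move=> sm; rewrite indicE mem_set// mul1r.
  rewrite /= /Hg ham_rotate /pivot_is_small.
  have OOc := cmx_orthogonal (OO g); have OOc' := mulmx1C OOc.
  have vO (u : 'rV[C]_(1 + n)) : sqnorm (u *m cmx (Q g)^T)%R = sqnorm u.
    by apply: sqnorm_unitary; rewrite cmx_adjoint trmxK.
  apply: (@schur_pivot_small _ _ _ _ _ _ (v *m cmx (Q g)^T)%R).
  - by rewrite -sqnorm_gt0 vO sqnorm_gt0.
  - rewrite (_ : _ *m _ = v *m (ham H0 x - (E%:C%C)%:M) *m cmx (Q g)^T)%R ?vO//.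
    rewrite /rotmx mulmxBr mul_mx_scalar !mulmxA -[in LHS](mulmxA v) OOc' mulmx1.
    by rewrite mulmxBr mul_mx_scalar mulmxBl scalemxAl.
  rewrite vO; apply: (le_trans hg); rewrite -mulrA ler_wpM2l//.
  have -> : ((v *m cmx (Q g)^T) 0 0 =
      (\sum_i v 0 i * ((-1) ^+ g i)%:C%C) * ((Num.sqrt (1 + n)%:R)^-1)%:C%C)%R.
    rewrite mxE mulr_suml; apply: eq_bigr => i _; rewrite !mxE (QP g).2.
    by rewrite -mulrA -rmorphM.
  have nsqR (a : R) : (nsq a%:C%C = a ^+ 2)%R by rewrite /nsq/= expr0n/= addr0.
  rewrite nsqM nsqR exprVn sqr_sqrtr ?ler0n// mulrCA divff ?mulr1//.
apply: (@le_trans _ _ (\int[gauss (1 + n)]_x ((10 / m)%:E *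
    \sum_(g : signs) (f g (rotate_entries (Q g) x))%:E))).
  apply: ge0_le_integral => //.
  - by move=> x _; rewrite lee_fin mulr_ge0.
  - apply/measurable_EFinP; apply: measurable_funM => //.
    apply: (@measurable_cnt _ _ (rvec R (entries (1 + n))) _ (fun x => ham H0 x) E e
      (fun c => (0 < c)%N%:R)) => //; last by move=> x; exact: ham_selfadjoint aH.1.
    by apply: mxmeas_ham => p; exact: measurable_coord.
  - apply: measurable_funeM; apply: emeasurable_sum => g.
    by apply/measurable_EFinP; exact: measurableT_comp.
  - by move=> x _; rewrite sumEFin -EFinM lee_fin.
rewrite ge0_integralZl_EFin//; last 3 first.
- by move=> x _; apply: sume_ge0 => g _; rewrite lee_fin.
- by apply: emeasurable_sum => g; apply/measurable_EFinP; exact: measurableT_comp.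
- by rewrite divr_ge0// ltW.
rewrite ge0_integral_sum//; last 2 first.
- by move=> g; apply/measurable_EFinP; exact: measurableT_comp.
- by move=> g x _; rewrite lee_fin.
have intf g : \int[gauss (1 + n)]_x (f g (rotate_entries (Q g) x))%:E <= c%:E * r.
  have := ge0_integral_isometry (lt0r_neq0 tau0) (rotate_entries_isometry (OO g)).
  move=> /(_ (EFin \o f g)) /= <-.
  - apply: (le_trans (integral_pivot_is_small (aHg g) (mG g) (G0 g))).
    by rewrite lee_wpmul2l ?lee_fin.
  - exact/measurable_EFinP.
  - by move=> x; rewrite lee_fin.
apply: (@le_trans _ _ ((10 / m)%:E * \sum_(g : signs) (c%:E * r))).
  by rewrite lee_wpmul2l ?lee_fin ?divr_ge0 ?(ltW m0)//; apply: lee_sum.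
have -> : \sum_(g : signs) (c%:E * r) = m%:E * (c%:E * r).
  transitivity (\sum_(g : signs) (1 * (c%:E * r))); first by under [RHS]eq_bigr do rewrite mul1e.
  by rewrite -ge0_sume_distrl// sumEFin sumr_const.
have m_neq0 : (m != 0)%R by exact: lt0r_neq0.
by rewrite !muleA -!EFinM (_ : 10 / m * m * c = 10 * c)%R// divfK.
Qed.

End one_eigenvalue.

(** * Joint counts: induction on the size *)
Section joint_counts.
Local Open Scope sesquilinear_scope.
Local Open Scope ereal_scope.
Context {R : realType} (S : bool) (kap tau : R) (N : nat).
Local Notation C := R[i].
Local Notation ham := (ham S kap).
Local Notation gauss n := (gauss tau (entries n)).
Hypothesis (kap0 : (0 < kap)%R) (tau0 : (0 < tau)%R).

(** Truncated subtraction of natural numbers is the positive part. *)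
Definition joint_count n k (w : nat -> R * R) (H : 'M[C]_n) : nat :=
  (\prod_(j < k) (cnt H (w j).1 (w j).2 - j))%N.

(** The factor 10 of the sign argument times the constant of [pivot_small_ball]. *)
Definition wegner_const : R := (5120 * Num.sqrt N%:R / (tau * kap))%R.

(** Windows are indexed by nat so that the induction can drop the first one by a
shift. *)
Definition wegner_bound n : Prop := forall (H0 : 'M[C]_n) k (w : nat -> R * R),
  admissible S H0 -> (forall j, (0 <= (w j).2)%R) ->
  \int[gauss n]_x (joint_count k w (ham H0 x))%:R%:E <=
  (\prod_(j < k) (wegner_const * (w j).2))%:E.

Lemma measurable_joint n k (w : nat -> R * R) (H0 : 'M[C]_n) (s : nat) : admissible S H0 ->
  (forall j, (0 <= (w j).2)%R) ->
  measurable_fun setT (fun x : rvec R (entries n) =>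
    ((\prod_(j < k) (cnt (ham H0 x) (w j).1 (w j).2 - (j + s)))%N)%:R : R).
Proof.
move=> aH w0.
rewrite (_ : (fun x => _) = (fun x : rvec R (entries n) => (\prod_(j < k)
    (cnt (ham H0 x) (w j).1 (w j).2 - (j + s))%N%:R)%R)); last first.
  by apply/funext => x; rewrite natr_prod.
apply: measurable_prod => j _.
apply: (@measurable_cnt _ _ (rvec R (entries n)) _ (fun x => ham H0 x) (w j).1 (w j).2
  (fun c => (c - (j + s))%N%:R)).
- by apply: mxmeas_ham => p; exact: measurable_coord.
- by move=> x; exact: ham_selfadjoint aH.1.
- exact: w0.
Qed.

Lemma measurable_joint_count n k (w : nat -> R * R) (H0 : 'M[C]_n) : admissible S H0 ->
  (forall j, (0 <= (w j).2)%R) ->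
  measurable_fun setT (fun x : rvec R (entries n) => (joint_count k w (ham H0 x))%:R : R).
Proof.
move=> aH w0; rewrite (_ : (fun x => _) = (fun x : rvec R (entries n) =>
    ((\prod_(j < k) (cnt (ham H0 x) (w j).1 (w j).2 - (j + 0)))%N)%:R : R)).
  exact: measurable_joint.
by apply/funext => x; congr (_%:R)%R; apply: eq_bigr => j _; rewrite addn0.
Qed.

Lemma wegner_const_ge0 : (0 <= wegner_const)%R.
Proof.
apply: divr_ge0; last by apply: ltW; exact: mulr_gt0.
by apply: mulr_ge0; [exact: (ler0n R 5120) | exact: sqrtr_ge0].
Qed.

Let integral_gam1 n : \int[gauss n]_x (1%:R)%:E = 1.
Proof. by rewrite integral_cst// mul1e; exact: probability_setT. Qed.

Lemma wegner_bound0 : wegner_bound 0.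
Proof.
move=> H0 [|k] w aH w0.
  under eq_integral do rewrite /joint_count big_ord0.
  by rewrite integral_gam1 big_ord0.
rewrite integral0_eq ?lee_fin ?prodr_ge0// => [j _|x _].
  by rewrite mulr_ge0// wegner_const_ge0.
rewrite /joint_count big_ord_recl.
have := cnt_le_dim (w 0%N).1 (w 0%N).2 (ham_selfadjoint S kap x aH.1).
by rewrite leqn0 => /eqP ->.
Qed.

Section step.
Variable n : nat.
Hypotheses (nN : (1 + n <= N)%N) (IH : wegner_bound n).

Let minor_null (E : R) (H1 : 'M[C]_n) : admissible S H1 ->
  gauss n [set x | (0 < cnt (ham H1 x) E 0%R)%N] = 0.
Proof.
move=> aH.
have m1 : measurable ([set x | (0 < cnt (ham H1 x) E 0%R)%N] : set (rvec R (entries n))).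
  apply: measurable_cnt_ge => //; first by apply: mxmeas_ham => p; exact: measurable_coord.
  by move=> x; exact: ham_selfadjoint aH.1.
apply/eqP; rewrite -measure_le0.
have w0 (j : nat) : (0 <= ((fun=> (E, 0) : R * R) j).2)%R by exact: lexx.
have := IH 1%N aH w0.
rewrite big_ord1/= mulr0; apply: le_trans.
set B := [set x | _] in m1 *.
have -> : gauss n B = \int[gauss n]_x (\1_B x)%:E by rewrite integral_indic// setIT.
apply: ge0_le_integral => //.
- by apply/measurable_EFinP; exact: measurable_indic.
- apply/measurable_EFinP.
  exact: measurable_joint_count.
- move=> x _; rewrite lee_fin indicE /joint_count big_ord1 subn0/=.
  case: (boolP (x \in _)) => // /set_mem/=.
  by rewrite ler1n.
Qed.

(** [one_eigenvalue_cost] fed with the induction hypothesis. *)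
Let first_cost (E e : R) (H0 : 'M[C]_(1 + n)) (F : rvec R (entries (1 + n)) -> R) k
    (w : nat -> R * R) : (0 <= e)%R -> (forall j, (0 <= (w j).2)%R) ->
  admissible S H0 -> measurable_fun setT F -> (forall x, (0 <= F x)%R) ->
  (forall (H1 : 'M[C]_(1 + n)) x, selfadjoint H1 -> (forall E' e', cnt (ham H0 x) E' e' =
     cnt H1 E' e') -> (F x <= (joint_count k w (drsubmx H1))%:R)%R) ->
  \int[gauss (1 + n)]_x ((0 < cnt (ham H0 x) E e)%:R * F x)%:E <=
  (wegner_const * e * \prod_(j < k) (wegner_const * (w j).2))%:E.
Proof.
move=> e0 w0 aH mF F0 FJ.
have -> : (wegner_const * e = 10 * (512 * Num.sqrt N%:R * e / (tau * kap)))%R.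
  by rewrite /wegner_const; ring.
rewrite EFinM; apply: one_eigenvalue_cost => //; first exact: minor_null.
move=> O OO.
exists (fun y => (joint_count k w (ham (drsubmx (rotmx O H0)) y))%:R); split.
- exact: measurable_joint_count (admissible_drsubmx (admissible_rotmx O aH)) w0.
- by move=> x; exact: ler0n.
- exact/IH/w0/admissible_drsubmx/admissible_rotmx.
move=> x.
have := FJ (ham (rotmx O H0) (rotate_entries O x)) x; rewrite drsubmx_ham; apply.
- exact: ham_selfadjoint (admissible_rotmx O aH).1.
- by move=> E' e'; rewrite ham_rotate cnt_rotmx.
Qed.

(** Where a piece contains at most one eigenvalue its count is an indicator, to
which [first_cost] applies. Elsewhere the trivial bound (1 + n)^(k + 1) on the
product is affordable, since two eigenvalues in one piece bring a second factor
1 / m. *)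
Let pieces_cost (H0 : 'M[C]_(1 + n)) k (w : nat -> R * R) m : (0 < m)%N -> admissible S H0 ->
  (forall j, (0 <= (w j).2)%R) ->
  \int[gauss (1 + n)]_x (joint_count k.+1 w (ham H0 x))%:R%:E <=
  (\prod_(j < k.+1) (wegner_const * (w j).2) +
   (1 + n)%:R ^+ k.+1 * (wegner_const * (w 0%N).2) ^+ 2 / m%:R)%:E.
Proof.
move=> m0 aH w0; set E := (w 0%N).1; set e := (w 0%N).2.
pose w' j := w j.+1.
have w'0 j : (0 <= (w' j).2)%R by exact: w0.
pose rest x : R := ((\prod_(j < k) (cnt (ham H0 x) (w' j).1 (w' j).2 - (j + 1)))%N)%:R%R.
have mrest : measurable_fun setT rest by exact: measurable_joint.
have rest0 x : (0 <= rest x)%R by exact: ler0n.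
have hH x : selfadjoint (ham H0 x) by exact: ham_selfadjoint aH.1.
pose c i x : nat := cnt (ham H0 x) (piece_centre E e m i) (e / m%:R).
have em : (0 <= e / m%:R)%R by apply: divr_ge0; [exact: w0 | exact: ler0n].
have mc i (phi : nat -> R) : measurable_fun setT (fun x : rvec R (entries (1 + n)) => phi (c i x)).
  apply: (@measurable_cnt _ _ (rvec R (entries (1 + n))) _ (fun x => ham H0 x)) => //.
  by apply: mxmeas_ham => p; exact: measurable_coord.
pose D : R := ((1 + n)%:R ^+ k.+1)%R.
have D0 : (0 <= D)%R by rewrite exprn_ge0.
pose g i x : R := ((0 < c i x)%:R * rest x + D * ((0 < c i x)%:R * (1 < c i x)%:R))%R.
have g0 i x : (0 <= g i x)%R.
  by apply: addr_ge0; apply: mulr_ge0 => //; apply: mulr_ge0.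
have mg1 i : measurable_fun setT (fun x => (0 < c i x)%:R * rest x)%R.
  by apply: measurable_funM => //; exact: (mc i (fun c => (0 < c)%:R%R)).
have mg2 i : measurable_fun setT (fun x => (0 < c i x)%:R * (1 < c i x)%:R : R)%R.
  by exact: (mc i (fun c => (0 < c)%:R * (1 < c)%:R)%R).
have mg i : measurable_fun setT (g i).
  by apply: measurable_funD => //; apply: measurable_funM.
have ptw x : ((joint_count k.+1 w (ham H0 x))%:R <= \sum_(i < m) g i x)%R.
  have -> : (joint_count k.+1 w (ham H0 x))%:R = ((cnt (ham H0 x) E e)%:R * rest x)%R.
    rewrite /joint_count big_ord_recl subn0 natrM; congr (_ * _%:R)%R.
    by apply: eq_bigr => j _; rewrite addn1.
  apply: (@le_trans _ _ ((\sum_(i < m) c i x)%N%:R * rest x)%R).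
    by rewrite ler_wpM2r// ler_nat cnt_split// w0.
  rewrite natr_sum mulr_suml; apply: ler_sum => i _; rewrite /g.
  case E1 : (c i x) => [|[|q]] /=.
  - by rewrite !mul0r mulr0 addr0.
  - by rewrite mulr0 mulr0 addr0.
  rewrite !mul1r mulr1 ler_wpDl// /D exprS; apply: ler_pM => //.
    by rewrite ler_nat -E1 cnt_le_dim.
  rewrite /rest -natrX ler_nat -[X in (_ <= _ ^ X)%N]card_ord -prod_nat_const.
  by apply: leq_prod => j _; rewrite (leq_trans (leq_subr _ _))// cnt_le_dim.
have int1 (i : 'I_m) : \int[gauss (1 + n)]_x ((0 < c i x)%:R * rest x)%:E <=
    (wegner_const * (e / m%:R) * \prod_(j < k) (wegner_const * (w' j).2))%:E.
  apply: first_cost => // H1 x hH1 cE; rewrite ler_nat; apply: leq_prod => j _.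
  rewrite cE addn1 -(subSS j (cnt (drsubmx H1) _ _)).
  by apply: leq_sub2r; exact: cnt_minor.
have int2 (i : 'I_m) : \int[gauss (1 + n)]_x ((0 < c i x)%:R * (1 < c i x)%:R)%:E <=
    ((wegner_const * (e / m%:R)) ^+ 2)%:E.
  pose w2 (_ : nat) := (piece_centre E e m i, e / m%:R)%R.
  have -> : ((wegner_const * (e / m%:R)) ^+ 2 = wegner_const * (e / m%:R) *
      \prod_(j < 1) (wegner_const * (w2 j).2))%R by rewrite big_ord1 expr2.
  apply: first_cost => //; first exact: (mc i (fun c => (1 < c)%:R%R)).
  move=> H1 x hH1 cE; rewrite ler_nat /joint_count big_ord1 subn0.
  case: ltnP => //= c1; have := cnt_minor (piece_centre E e m i) hH1 em.
  by rewrite -cE => /(leq_trans c1).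
apply: (@le_trans _ _ (\int[gauss (1 + n)]_x \sum_(i < m) (g i x)%:E)).
  apply: ge0_le_integral => //.
  - by apply/measurable_EFinP; exact: measurable_joint_count.
  - by apply: emeasurable_sum => i; exact/measurable_EFinP.
  - by move=> x _; rewrite sumEFin lee_fin.
rewrite ge0_integral_sum//; last first.
- by move=> i x _; rewrite lee_fin.
- by move=> i; exact/measurable_EFinP.
apply: (@le_trans _ _ (\sum_(i < m) ((wegner_const * (e / m%:R) *
    \prod_(j < k) (wegner_const * (w' j).2)) + D * (wegner_const * (e / m%:R)) ^+ 2)%:E)).
  apply: lee_sum => i _.
  under eq_integral do rewrite EFinD [X in _ + X]EFinM.
  rewrite ge0_integralD//; last 4 first.
  - by move=> x _; rewrite lee_fin mulr_ge0.
  - exact/measurable_EFinP.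
  - by move=> x _; rewrite -EFinM lee_fin mulr_ge0// mulr_ge0.
  - by apply: measurable_funeM; exact/measurable_EFinP.
  rewrite ge0_integralZl_EFin//; last exact/measurable_EFinP.
  rewrite [leRHS]EFinD; apply: leeD; first exact: int1.
  by rewrite [leRHS]EFinM; apply: lee_wpmul2l => //; exact: int2.
rewrite sumEFin sumr_const card_ord lee_fin big_ord_recl -/e -/w'.
rewrite -[(_ *+ m)%R]mulr_natl /D le_eqVlt; apply/orP; left; apply/eqP.
by field; rewrite pnatr_eq0 -lt0n.
Qed.

Lemma wegner_boundS : wegner_bound (1 + n).
Proof.
move=> H0 [|k] w aH w0.
  under eq_integral do rewrite /joint_count big_ord0.
  by rewrite integral_gam1 big_ord0.
apply/lee_addgt0Pr => eps eps0.
set D : R := ((1 + n)%:R ^+ k.+1 * (wegner_const * (w 0%N).2) ^+ 2)%R.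
have D0 : (0 <= D)%R by rewrite mulr_ge0 ?sqr_ge0// exprn_ge0.
pose m := (Num.bound (D / eps)).+1.
have m0 : (0 < m)%N by [].
apply: (le_trans (pieces_cost k m0 aH w0)).
rewrite -EFinD lee_fin lerD2l -/D ler_pdivrMr ?ltr0n// mulrC -ler_pdivrMr//.
have := archi_boundP (divr_ge0 D0 (ltW eps0)) => /ltW/le_trans; apply.
by rewrite ler_nat.
Qed.

End step.

Lemma wegner_bound_le n : (n <= N)%N -> wegner_bound n.
Proof.
elim: n => [_|n IHn nN]; first exact: wegner_bound0.
by apply: wegner_boundS => //; apply: IHn; exact: ltnW.
Qed.

End joint_counts.

(** * From closed windows to intervals *)
Section counting_in_intervals.
Local Open Scope sesquilinear_scope.
Context {R : realType}.
Local Notation C := R[i].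
Local Notation mu := (@lebesgue_measure R).

Lemma exists_eigenvalues n (H : 'M[C]_n) : selfadjoint H -> exists f : 'I_n -> R,
  forall B, eigenvalue_count H B = (\sum_i `[< B (f i) >])%N.
Proof.
move=> /selfadjoint_diagonalization[P [f [PP _ ->]]]; exists f => B.
exact: eigenvalue_countE.
Qed.

Lemma eigenvalue_count_le n (H : 'M[C]_n) (B B' : set R) : selfadjoint H -> B `<=` B' ->
  (eigenvalue_count H B <= eigenvalue_count H B')%N.
Proof.
move=> /exists_eigenvalues[f fE] BB'; rewrite !fE; apply: leq_sum => i _.
by case: asboolP => // /BB' Bi; rewrite asboolT.
Qed.

Lemma itv_window (I : interval R) : (mu [set` I] < +oo)%E ->
  exists E, forall x, x \in I -> `|x - E| <= fine (mu [set` I]) / 2.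
Proof.
rewrite lebesgue_measure_itv; case: I => [[b1 a|[]] [b2 c|[]]] /=; rewrite ?lte_fin.
- move=> _; have inI x : x \in Interval (BSide b1 a) (BSide b2 c) -> a <= x <= c.
    by rewrite in_itv/= => /andP[/lteifW -> /lteifW ->].
  case: ltP => ac; [exists ((a + c) / 2)|exists a] => x /inI /andP[ax xc] /=.
    by rewrite ler_norml; apply/andP; split; lra.
  by rewrite mul0r normr_le0 subr_eq0 eq_le ax (le_trans xc ac).
all: try by move=> _; exists 0 => x; rewrite in_itv/= ?andbF.
all: by rewrite ?ltry ?ltNyr ?ltNyy /= ?ltxx.
Qed.

(** Up to the eigenvalues at the excluded endpoints, the count is that of the
closure. *)
Lemma measurable_count_ge d (T : measurableType d) n (F : T -> 'M[C]_n) (I : interval R) k :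
  (mu [set` I] < +oo)%E -> mxmeas F -> (forall t, selfadjoint (F t)) ->
  measurable [set t | (k <= eigenvalue_count (F t) [set` I])%N].
Proof.
move=> Ioo mF hF.
have mc E e (phi : nat -> R) : 0 <= e -> measurable_fun setT (fun t => phi (cnt (F t) E e)).
  by move=> e0; exact: measurable_cnt.
have sum_ge (b1 b2 : bool) E e a c : 0 <= e ->
    (forall t, (eigenvalue_count (F t) [set` I] + b1 * cnt (F t) a 0 + b2 * cnt (F t) c 0 =
       cnt (F t) E e)%N) ->
    measurable [set t | (k <= eigenvalue_count (F t) [set` I])%N].
  move=> e0 FE.
  rewrite (_ : [set t | _] = [set t | k%:R + b1%:R * (cnt (F t) a 0)%:R +
      b2%:R * (cnt (F t) c 0)%:R <= (cnt (F t) E e)%:R :> R]); last first.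
    by apply/seteqP; split => t /=; rewrite -FE -!natrM -!natrD ler_nat !leq_add2r.
  apply: measurable_set_ler; last exact: (mc _ _ (fun c => c%:R)).
  by apply: measurable_funD; [apply: measurable_funD => //|];
    apply: measurable_funM => //; apply: (mc _ _ (fun c => c%:R)).
have empty : (forall x, x \notin I) ->
    measurable [set t | (k <= eigenvalue_count (F t) [set` I])%N].
  move=> I0; apply: (sum_ge true false 0 0 0 0) => // t.
  have [f fE] := exists_eigenvalues (hF t); rewrite /cnt !fE mul1n mul0n addn0.
  rewrite big1 => [|i _]; first by rewrite add0n.
  by rewrite asboolF//=; exact/negP/I0.
have singleton a : a \in I -> (forall x, x \in I -> x = a) ->
    measurable [set t | (k <= eigenvalue_count (F t) [set` I])%N].
  move=> aI Ia; apply: (sum_ge false false a 0 0 0) => // t.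
  rewrite !mul0n !addn0 /cnt; congr eigenvalue_count; apply/seteqP; split => x /=.
    by move=> /Ia ->; rewrite subrr normr0.
  by rewrite normr_le0 subr_eq0 => /eqP ->.
case: I Ioo sum_ge empty singleton => [[b1 a|[]] [b2 c|[]]] Ioo sum_ge empty singleton.
- have inI x : x \in Interval (BSide b1 a) (BSide b2 c) -> a <= x <= c.
    by rewrite in_itv/= => /andP[/lteifW -> /lteifW ->].
  have [ca|ac] := leP c a.
    have [aI|aI] := boolP (a \in Interval (BSide b1 a) (BSide b2 c)).
      by apply: (singleton a) => // x /inI /andP[ax xc]; apply/le_anti; rewrite ax (le_trans xc ca).
    apply: empty => x; apply: contra aI => xI; have /andP[ax xc] := inI _ xI.
    have xa : x = a by apply/le_anti; rewrite ax (le_trans xc ca).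
    by rewrite xa in xI.
  apply: (sum_ge (~~ b1) b2 ((a + c) / 2) ((c - a) / 2) a c) => [|t]; first by lra.
  have [f fE] := exists_eigenvalues (hF t); rewrite /cnt !fE !big_distrr/= -!big_split/=.
  apply: eq_bigr => i _; rewrite !asboolb in_itv/= !normr_le0 !subr_eq0.
  have -> : `|f i - (a + c) / 2| <= (c - a) / 2 = (a <= f i <= c).
    by apply/idP/idP; rewrite ler_norml => /andP[h1 h2]; apply/andP; split; lra.
  case: b1 b2 {Ioo sum_ge empty singleton inI} => [] [] /=;
    case: (ltgtP a (f i)) => h1; case: (ltgtP (f i) c) => h2 //=; exfalso; lra.
all: try by apply: empty => x; rewrite in_itv/= ?andbF.
all: by move: Ioo; rewrite lebesgue_measure_itv/= ?ltry ?ltNyr ?ltNyy /= ?ltxx.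
Qed.

End counting_in_intervals.

(** * From the Gaussian space to the given ensemble *)
Section transfer.
Local Open Scope sesquilinear_scope.
Local Open Scope ereal_scope.
Context {R : realType}.
Local Notation C := R[i].

(** Monotonicity holds without measurability, by the definition of the integral as
a supremum; it spares the measurability of the integrand of the theorem. *)
Lemma ge0_le_integral_any d (T : measurableType d) (mu : {measure set T -> \bar R})
    (f g : T -> \bar R) : (forall x, 0 <= f x) -> (forall x, f x <= g x) ->
  \int[mu]_x f x <= \int[mu]_x g x.
Proof.
move=> f0 fg; have g0 x : 0 <= g x by exact: le_trans (fg x).
rewrite !ge0_integralTE//; apply: le_ereal_sup => _ [h hf <-]; exists h => // x.
exact: le_trans (fg x).
Qed.

Lemma independent_normal_box d (T : measurableType d) (P : probability T R) (J : finType)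
    (Y : J -> {RV P >-> R}) (s : R) :
  mutually_independent Y -> (forall p, has_normal_law 0 s (Y p)) ->
  forall B : J -> set R, (forall j, measurable (B j)) ->
  P ((fun w j => Y j w) @^-1` box B) = \prod_(j : J) normal_prob 0 s (B j).
Proof.
move=> indY lawY B mB.
have -> : (fun w j => Y j w) @^-1` box B = \bigcap_(j in [set` finset.setTfor J]) (Y j @^-1` B j).
  by apply/seteqP; split => w /= h j; [move=> _; exact: h | apply: h; exact: finset.in_setT].
rewrite indY//; apply: eq_big => [j|j _]; first exact: finset.in_setT.
exact: (lawY j (B j) (mB j)).
Qed.

Definition ensemble_scale (N : nat) : R := (Num.sqrt (2 * N%:R))^-1%R.

(** In the real case the imaginary coordinates are absent from the given variables;
they are integrated out by reindexing. Here tau^2 >= 1/2 is all that matters of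
the standard deviation: it is 1 for the GOE and sqrt (1/2) for the GUE. *)
Lemma ensemble_law d (T : measurableType d) (P : probability T R) N (A : 'M[C]_N)
    (V : T -> 'M[C]_N) :
  (A \is a realmx /\ A \is symmetricmx /\ GOE P V) \/ (A \is hermsymmx /\ GUE P V) ->
  exists (S : bool) (tau : R), [/\ (0 < tau)%R, (2^-1 <= tau ^+ 2)%R, admissible S A,
    exists2 f : T -> rvec R (entries N), (forall p, measurable_fun setT (fun w => f w p)) &
      (forall w, A + V w = ham S (ensemble_scale N) A (f w))%R &
    forall phi : 'M[C]_N -> \bar R, (forall M, 0 <= phi M) ->
      measurable_fun setT (fun x : rvec R (entries N) => phi (ham S (ensemble_scale N) A x)) ->
      \int[P]_w phi (A + V w)%R =
      \int[gauss tau (entries N)]_x phi (ham S (ensemble_scale N) A x)].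
Proof.
move=> AV; have hE (M : 'M[C]_N) : (hermitize M = (ensemble_scale N)%:C%C *: (M + M ^t*))%R by [].
move: (ensemble_scale N) hE => kap hE.
have sa : A \is hermsymmx -> selfadjoint A.
  by move=> /is_hermitianmxP; rewrite expr0 scale1r => AE; rewrite /selfadjoint -AE.
case: AV => [[rA [symA [X [Y [indY lawY XE]] VE]]]|[hA [X [Y [indY lawY XE]] VE]]].
  pose ext (y : rvec R ('I_N * 'I_N)%type) : rvec R (entries N) := fun p => y p.1.
  pose y w : rvec R ('I_N * 'I_N)%type := fun p => Y p w.
  have my : measurable_fun setT y by apply: measurable_to_rvec => p; exact: measurable_funP.
  have VyE w : (A + V w = ham false kap A (ext (y w)))%R.
    rewrite VE hE /ham; congr (A + _ *: (_ + _ ^t*))%R; apply/matrixP => i j;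
      by rewrite XE matE mxE mul0r.
  have hamE0 x : ham false kap A x = ham false kap A (ext (fun p => x (p, false))).
    have zero (a b : R) : (kap * false%:R * a = kap * false%:R * b)%R.
      by rewrite (mulr0 kap) !mul0r.
    apply/matrixP => i j; apply: (etrans (hamE false kap A x i j)).
    apply: (etrans _ (esym (hamE false kap A _ i j))).
    by congr (_ + (_ +i* _)%C)%R; exact: zero.
  exists false, 1%R; split.
  - exact: ltr01.
  - by rewrite expr1n invf_le1// ler1n.
  - by split; [exact/sa/realsym_hermsym | move=> _].
  - by exists (fun w => ext (y w)); [move=> p; exact: measurable_funP | exact: VyE].
  move=> phi phi0 mphi.
  have mh : measurable_fun setT (fun y => phi (ham false kap A (ext y))).
    apply: (measurableT_comp mphi); apply: measurable_to_rvec => p; exact: measurable_coord.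
  have iI : injective (fun p : 'I_N * 'I_N => (p, false)) by move=> p q [].
  under [RHS]eq_integral do rewrite hamE0.
  rewrite -(ge0_integral_reindex 1 iI mh (fun y => phi0 _)).
  rewrite (gauss_transfer (P := P) my _ mh (fun y => phi0 _)); last exact: independent_normal_box.
  by apply: eq_integral => w _; rewrite VyE.
pose y w : rvec R (entries N) := fun p => Y p w.
have my : measurable_fun setT y by apply: measurable_to_rvec => p; exact: measurable_funP.
have VyE w : (A + V w = ham true kap A (y w))%R.
  rewrite VE hE /ham; congr (A + _ *: (_ + _ ^t*))%R; apply/matrixP => i j;
    by rewrite XE matE mxE mul1r.
exists true, (Num.sqrt 2^-1)%R; split.
- by rewrite sqrtr_gt0 invr_gt0.
- by rewrite sqr_sqrtr// invr_ge0.
- by split; [exact: sa | ].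
- by exists y; [move=> p; exact: measurable_funP | exact: VyE].
move=> phi phi0 mphi; rewrite (gauss_transfer (P := P) my _ mphi (fun y => phi0 _)).
  by apply: eq_integral => w _; rewrite VyE.
exact: independent_normal_box.
Qed.

End transfer.

Section wegner.
Local Open Scope ereal_scope.
Context {R : realType} d (T : measurableType d) (P : probability T R) (N : nat).
Local Notation C := R[i].
Variables (A : 'M[C]_N) (V : T -> 'M[C]_N).
Hypothesis N0 : (0 < N)%N.
Hypothesis AV : (A \is a realmx /\ A \is symmetricmx /\ GOE P V) \/ (A \is hermsymmx /\ GUE P V).

Let F w : 'M[C]_N := (A + V w)%R.

Lemma ensemble_measurable : mxmeas F /\ forall w, selfadjoint (F w).
Proof.
have [S [tau [_ _ aA [f mf fE] _]]] := ensemble_law AV; split.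
  by apply: (eq_mxmeas (fun t i j => congr1 (fun M : 'M[C]_N => M i j) (esym (fE t)))); exact: mxmeas_ham.
by move=> w; rewrite /F fE; exact: ham_selfadjoint aA.1.
Qed.

(** The factors sqrt N of the sign argument and sqrt (2 N) of the normalization
multiply to O(N), and e_j is half the length of I_j. *)
Lemma expected_joint_count k (w : nat -> R * R) : (forall j, (0 <= (w j).2)%R) ->
  \int[P]_t (joint_count k w (F t))%:R%:E <=
  (\prod_(j < k) (5120 * (2 * (w j).2) * N%:R))%:E.
Proof.
move=> w0; have [S [tau [tau0 tau2 aA _ law]]] := ensemble_law AV.
have N0' : (0 < N%:R :> R)%R by rewrite ltr0n.
have kap0 : (0 < ensemble_scale N :> R)%R by rewrite invr_gt0 sqrtr_gt0 mulr_gt0.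
rewrite (law (fun M => (joint_count k w M)%:R%:E)); last 2 first.
- by move=> M; rewrite lee_fin.
- by apply/measurable_EFinP; exact: measurable_joint_count.
apply: (le_trans (wegner_bound_le kap0 tau0 (leqnn N) k aA w0)); rewrite lee_fin.
have cst : (wegner_const (ensemble_scale N) tau N <= 5120 * (2 * N%:R))%R.
  have a0 : (0 <= Num.sqrt (N%:R : R))%R by exact: sqrtr_ge0.
  have bt : (Num.sqrt (2 * N%:R) / tau <= 2 * Num.sqrt N%:R)%R.
    rewrite ler_pdivrMr// -(@ler_pXn2r _ 2)// ?nnegrE ?sqrtr_ge0//; last first.
      by apply: mulr_ge0; [exact: mulr_ge0 | exact: ltW].
    rewrite !exprMn !sqr_sqrtr ?mulr_ge0 ?(ltW N0')//.
    by move: (N%:R : R)%R N0' => x x0; nra.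
  have -> : (wegner_const (ensemble_scale N) tau N =
      5120 * (Num.sqrt N%:R * (Num.sqrt (2 * N%:R) / tau)))%R.
    by rewrite /wegner_const /ensemble_scale invfM invrK; ring.
  apply: ler_wpM2l; first exact: (ler0n R 5120).
  apply: (le_trans (ler_wpM2l a0 bt)).
  by rewrite mulrCA -expr2 sqr_sqrtr// ltW.
apply: ler_prod => j _; apply/andP; split.
  by apply: mulr_ge0 => //; exact: wegner_const_ge0.
apply: (le_trans (ler_wpM2r (w0 j) cst)); rewrite le_eqVlt; apply/orP; left; apply/eqP.
by rewrite -!mulrA; congr (_ * (_ * _))%R; rewrite mulrC.
Qed.

Local Notation mu := (@lebesgue_measure R).

Let mF : mxmeas F. Proof. exact: ensemble_measurable.1. Qed.
Let hF w : selfadjoint (F w). Proof. exact: ensemble_measurable.2. Qed.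

Lemma mu_ge0 (I : interval R) : 0 <= mu [set` I]. Proof. exact: measure_ge0. Qed.

Lemma mu_finE (I : interval R) : mu [set` I] < +oo -> mu [set` I] = (fine (mu [set` I]))%:E.
Proof. by move=> Ioo; rewrite fineK// ge0_fin_numE// mu_ge0. Qed.

Lemma count_le_window (I : interval R) : mu [set` I] < +oo -> exists E : R, forall w,
  (eigenvalue_count (F w) [set` I] <= cnt (F w) E (fine (mu [set` I]) / 2))%N.
Proof.
move=> /itv_window[E IE]; exists E => w; apply: eigenvalue_count_le => // x; exact: IE.
Qed.

Lemma half_mu_ge0 (I : interval R) : (0 <= fine (mu [set` I]) / 2)%R.
Proof. by rewrite divr_ge0// fine_ge0// mu_ge0. Qed.

(** For k equal windows, the product is the falling factorial of the count. *)
Lemma probability_count_ge k (I : interval R) : (0 < k)%N ->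
  P [set w | (k <= eigenvalue_count (F w) [set` I])%N] <=
  (5120%:E * mu [set` I] * N%:R%:E) ^+ k * (k`!%:R^-1)%:E.
Proof.
move=> k0; have kf0 : (0 < k`!%:R :> R)%R by rewrite ltr0n fact_gt0.
have N0' : (0 < N%:R :> R)%R by rewrite ltr0n.
have c0 : (0 < 5120 :> R)%R by rewrite (ltr0n R 5120).
have [Ioo|] := ltP (mu [set` I]) +oo; last first.
  rewrite leye_eq => /eqP ->.
  have -> : (5120%:E * +oo * N%:R%:E = +oo :> \bar R) by rewrite gt0_muley ?lte_fin// gt0_mulye ?lte_fin.
  have -> : (+oo ^+ k = +oo :> \bar R).
    by case: k k0 {kf0} => // k _; elim: k => [|k IHk]; rewrite ?expe1// expeS IHk mulyy.
  by rewrite gt0_mulye ?leey// lte_fin invr_gt0.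
have [E IE] := count_le_window Ioo; set e := (fine (mu [set` I]) / 2)%R.
have e0 : (0 <= e)%R := half_mu_ge0 I.
have mB := measurable_count_ge k Ioo mF hF; set B := [set w | _] in mB *.
have le1 : k`!%:R%:E * P B <= (\prod_(j < k) (5120 * (2 * e) * N%:R))%:E.
  have bd := @expected_joint_count k (fun=> (E, e)) (fun=> e0).
  apply: le_trans bd.
  have -> : P B = \int[P]_w (\1_B w)%:E by rewrite integral_indic// setIT.
  have -> : k`!%:R%:E * \int[P]_w (\1_B w)%:E = \int[P]_w (k`!%:R%:E * (\1_B w)%:E).
    apply/esym; apply: ge0_integralZl_EFin => //.
    by apply/measurable_EFinP; exact: measurable_indic.
  apply: ge0_le_integral_any => [w|w].
    by rewrite mule_ge0// lee_fin.
  rewrite -EFinM lee_fin indicE; case: (boolP (w \in B)) => [|_]; last by rewrite mulr0.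
  rewrite mulr1 ler_nat => /set_mem/= kc.
  rewrite -ffactnn ffact_prod; apply: leq_prod => j _; apply: leq_sub2r.
  exact: leq_trans (IE w).
rewrite -(@lee_pmul2l _ k`!%:R%:E)//.
apply: (le_trans le1).
rewrite (mu_finE Ioo) -!EFinM -EFin_expe -!EFinM lee_fin prodr_const card_ord.
rewrite [leRHS]mulrCA divff ?gt_eqF// mulr1 (_ : 2 * e = fine (mu [set` I]))%R//.
by rewrite /e mulrCA divff// mulr1.
Qed.

Lemma maxr_subn (a b : nat) : (Num.max (a%:R - b%:R) 0 = (a - b)%N%:R :> R)%R.
Proof.
have [ab|/ltnW ba] := leqP a b.
  have -> : (a - b = 0)%N by apply/eqP; rewrite subn_eq0.
  by rewrite max_r// subr_le0 ler_nat.
by rewrite natrB// max_l// subr_ge0 ler_nat.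
Qed.

(** A null interval must be treated apart, since the right-hand side contains the
product 0 * oo when another interval is infinite; if none is null and one is
infinite the right-hand side is infinite. *)
Lemma expectation_product_le k (I : 'I_k -> interval R) :
  'E_P[fun w => (\prod_(j < k)
     Num.max ((eigenvalue_count (F w) [set` I j])%:R - (j : nat)%:R) 0)%R] <=
  \prod_(j < k) (5120%:E * mu [set` I j] * N%:R%:E).
Proof.
have N0' : (0 < N%:R :> R)%R by rewrite ltr0n.
have c0 : (0 < 5120 :> R)%R by rewrite (ltr0n R 5120).
rewrite expectation.unlock.
pose c j w := (eigenvalue_count (F w) [set` I j] - j)%N.
under eq_integral do under eq_bigr do rewrite maxr_subn.
have rhs0 j : 0 <= 5120%:E * mu [set` I j] * N%:R%:E.
  apply: mule_ge0; last by rewrite lee_fin.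
  by apply: mule_ge0; [rewrite lee_fin (ltW c0) | exact: mu_ge0].
have [[j0 Ij0]|Ipos] := pselect (exists j0, mu [set` I j0] = 0).
  apply: (@le_trans _ _ 0); last by apply: prode_ge0.
  have Ioo : mu [set` I j0] < +oo by rewrite Ij0 ltry.
  have [E IE] := count_le_window Ioo; rewrite Ij0 /= mul0r in IE.
  pose Q : R := (\prod_(j < k | j != j0) N%:R)%R.
  have Q0 : (0 <= Q)%R by rewrite prodr_ge0.
  have mc : measurable_fun setT (fun w => (joint_count 1%N (fun=> (E, 0%R)) (F w))%:R : R).
    rewrite (_ : (fun w => _) = (fun w => (cnt (F w) E 0%R)%:R : R)).
      exact: (measurable_cnt E (fun c => c%:R) mF hF (lexx 0%R)).
    by apply/funext => w; rewrite /joint_count big_ord1 subn0.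
  have := @expected_joint_count 1%N (fun=> (E, 0%R)) (fun=> lexx 0%R).
  rewrite big_ord1/= !mulr0 mul0r => c_le0.
  apply: (@le_trans _ _ (\int[P]_w (Q%:E * (joint_count 1%N (fun=> (E, 0%R)) (F w))%:R%:E))).
    apply: ge0_le_integral_any => w; first by rewrite lee_fin prodr_ge0.
    rewrite -EFinM lee_fin (bigD1 j0)//= mulrC; apply: ler_pM => //.
    - by rewrite prodr_ge0.
    - apply: ler_prod => j _; rewrite ler0n ler_nat; apply: leq_trans (leq_subr _ _) _.
      have [f fE] := exists_eigenvalues (hF w); rewrite fE.
      by rewrite -[X in (_ <= X)%N]card_ord -sum1_card; apply: leq_sum => i _; case: `[< _ >].
    by rewrite ler_nat /joint_count big_ord1 subn0 (leq_trans (leq_subr _ _)).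
  rewrite ge0_integralZl_EFin//; last exact/measurable_EFinP.
  by apply: mule_ge0_le0.
have Ip j : 0 < mu [set` I j].
  by rewrite lt_def mu_ge0 andbT; apply/eqP => Ij; apply: Ipos; exists j.
have [[j1 Ij1]|Ifin] := pselect (exists j1, mu [set` I j1] = +oo).
  have -> : \prod_(j < k) (5120%:E * mu [set` I j] * N%:R%:E) = +oo; last exact: leey.
  rewrite (bigD1 j1)//= Ij1 gt0_muley ?lte_fin// gt0_mulye ?lte_fin// gt0_mulye//.
  apply: (big_ind (fun x => 0 < x)); [exact: lte01 | by move=> x y; exact: mule_gt0 |].
  move=> j _; apply: mule_gt0; last by rewrite lte_fin.
  by apply: mule_gt0; [rewrite lte_fin c0 | exact: Ip].
have Ioo j : mu [set` I j] < +oo.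
  by rewrite ltey; apply/eqP => Ij; apply: Ifin; exists j.
have [E IE] := choice (fun j => count_le_window (Ioo j)).
pose w (j : nat) : R * R := if insub j is Some i then (E i, fine (mu [set` I i]) / 2)%R else (0, 0)%R.
have wE (j : 'I_k) : w j = (E j, fine (mu [set` I j]) / 2)%R by rewrite /w valK.
have w0 j : (0 <= (w j).2)%R by rewrite /w; case: insub => [i|]//=; exact: half_mu_ge0.
apply: (@le_trans _ _ (\int[P]_t (joint_count k w (F t))%:R%:E)).
  apply: ge0_le_integral_any => t; first by rewrite lee_fin prodr_ge0.
  rewrite lee_fin /joint_count natr_prod; apply: ler_prod => j _.
  by rewrite ler0n ler_nat wE leq_sub2r.
apply: (le_trans (@expected_joint_count k w w0)).
rewrite -prodEFin le_eqVlt; apply/orP; left; apply/eqP; apply: eq_bigr => j _.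
by rewrite wE/= [in RHS](mu_finE (Ioo j)) -!EFinM [(2 * _)%R]mulrC divfK.
Qed.

End wegner.

Theorem theorem2 (R : realType) :
  exists C : R,
  forall (N : nat), (1 <= N)%N ->
  forall (d : measure_display) (T : measurableType d) (P : probability T R)
    (A : 'M[R[i]]_N) (V : T -> 'M[R[i]]_N),
  (A \is a realmx /\ A \is symmetricmx /\ GOE P V) \/
  (A \is hermsymmx /\ GUE P V) ->
  let nev (w : T) (B : set R) : nat := eigenvalue_count (A + V w) B in
  forall k : nat, (1 <= k <= N)%N ->
    (forall I : interval R,
      (P [set w | (k <= nev w [set` I])%N] <=
       (C%:E * lebesgue_measure [set` I] * N%:R%:E) ^+ k * (k`!%:R^-1)%:E)%E)
    /\
    (forall I : 'I_k -> interval R,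
      ('E_P[fun w => (\prod_(j < k)
              Num.max ((nev w [set` I j])%:R - (j : nat)%:R) 0)%R] <=
       \prod_(j < k) (C%:E * lebesgue_measure [set` I j] * N%:R%:E))%E).
Proof.
exists 5120 => N N0 d T P A V AV nev k /andP[k0 _]; split => [I|I].
  exact: probability_count_ge.
exact: expectation_product_le.
Qed.
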